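(* Let $(M,g,J)$ be a pseudo-Kähler manifold of (real) dimension $2n+4$, $n\geq 0$, admitting a strongly degenerate homogeneous pseudo-Kähler structure $S$ of linear type. Then each $p\in M$ has a neighborhood holomorphically isometric to an open subset of $\mathbb{C}^{n+2}$, with complex coordinates $w=w^1+iw^2$, $z=z^1+iz^2$, $z^a=x^a+iy^a$ ($a=1,\ldots,n$), endowed with the pseudo-Kähler metric $$g = dw^1dz^1+dw^2dz^2+b(dw^1dw^1+dw^2dw^2)+\sum_{a=1}^n r_a(dx^adw^1+dy^adw^2)+\sum_{a=1}^n s_a(dx^adw^2-dy^adw^1)+\sum_{a=1}^n\epsilon_a(dx^adx^a+dy^ady^a),$$ where $\epsilon_a=\pm 1$, and the real functions $b,r_a,s_a$ only depend on the coordinates $\{w^1,w^2\}$ and satisfy $$\frac{\partial s_a}{\partial w^1}=\frac{\partial r_a}{\partial w^2},\qquad \frac{\partial s_a}{\partial w^2}=-\frac{\partial r_a}{\partial w^1},\qquad \Delta b=\frac{b_0}{\left((w^1)^2+(w^2)^2\right)^2},$$ for some $b_0\in\mathbb{R}$ and all $a=1,\ldots,n$.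
   Context: A pseudo-Kähler manifold $(M,g,J)$ is a pseudo-Riemannian manifold with a pseudo-Hermitian structure $J$ ($J^2=-1$, $g(JX,JY)=g(X,Y)$) that is parallel for the Levi-Civita connection $\nabla$. A homogeneous pseudo-Kähler structure is a $(1,2)$-tensor field $S$ such that the connection $\widetilde{\nabla}=\nabla-S$ satisfies $\widetilde{\nabla}g=0$, $\widetilde{\nabla}R=0$, $\widetilde{\nabla}S=0$, $\widetilde{\nabla}J=0$, where $R$ is the curvature tensor of $\nabla$. It is of linear type if $S_XY=g(X,Y)\xi-g(Y,\xi)X-g(X,JY)J\xi+g(JY,\xi)JX-2g(JX,\zeta)JY$ for some vector fields $\xi,\zeta$; it is strongly degenerate (of linear type) if moreover $\xi\neq 0$ (nowhere vanishing; on a connected manifold this is equivalent to $\xi\not\equiv 0$ since $\widetilde\nabla\xi=0$), $g(\xi,\xi)=0$ and $\zeta=0$, i.e. $S_XY=g(X,Y)\xi-g(Y,\xi)X-g(X,JY)J\xi+g(JY,\xi)JX$. $\Delta=\partial^2/\partial (w^1)^2+\partial^2/\partial (w^2)^2$. The complex structure on $\mathbb{C}^{n+2}$ is the standard one, and the open subset does not meet $\{w=0\}$. Convention for products of one-forms: for distinct coordinates $u,v$, $du\,dv$ means $du\otimes dv+dv\otimes du$, while $du\,du=du\otimes du$; thus $g(\partial_{w^i},\partial_{z^j})=\delta_{ij}$, $g(\partial_{w^i},\partial_{w^j})=b\,\delta_{ij}$, $g(\partial_{w^1},\partial_{x^a})=r_a$, etc. *)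

(* Defs.v *)
From HB Require Import structures.
From mathcomp Require Import all_boot all_order all_algebra.
From mathcomp Require Import all_classical all_reals all_analysis.
Set Implicit Arguments.
Unset Strict Implicit.
Unset Printing Implicit Defensive.
Import Order.TTheory GRing.Theory Num.Theory.
Import numFieldNormedType.Exports.
Local Open Scope classical_set_scope.
Local Open Scope ring_scope.

(* Tangent vectors are row vectors, as in the library's ['J f x]: the matrix  *)
(* of a linear map acts on the right, so its row i is the image of the i-th   *)
(* coordinate vector field.                                                   *)

(** Smooth functions *)

Fixpoint Ck (R : realType) (E W : normedModType R) (k : nat)
    (D : set E) (f : E -> W) : Prop :=
  if k is k'.+1 then
    (forall x, D x -> differentiable f x) /\ (forall v : E, Ck k' D ('D_v f))
  else forall x, D x -> {for x, continuous f}.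

(* Only used for open [D]. *)
Definition smooth_on (R : realType) (E W : normedModType R)
    (D : set E) (f : E -> W) : Prop :=
  forall k, Ck k D f.

Definition pd (R : realType) (m : nat) (W : normedModType R) (i : 'I_m)
    (f : 'rV[R]_m -> W) : 'rV[R]_m -> W :=
  'D_(delta_mx 0 i) f.

(** Smooth manifolds *)

Record chart (R : realType) (M : topologicalType) (m : nat) := Chart {
  cdom : set M;
  cimg : set 'rV[R]_m;
  cmap : M -> 'rV[R]_m;
  cinv : 'rV[R]_m -> M;
  cdom_open : open cdom;
  cimg_open : open cimg;
  cmap_img : forall p, cdom p -> cimg (cmap p);
  cinv_dom : forall x, cimg x -> cdom (cinv x);
  cmapK : forall p, cdom p -> cinv (cmap p) = p;
  cinvK : forall x, cimg x -> cmap (cinv x) = x;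
  cmap_continuous : forall p, cdom p -> {for p, continuous cmap};
  cinv_continuous : forall x, cimg x -> {for x, continuous cinv}
}.

Definition tdom (R : realType) (M : topologicalType) (m : nat)
    (c d : chart R M m) : set 'rV[R]_m :=
  [set x | cimg c x /\ cdom d (cinv c x)].

Definition transition (R : realType) (M : topologicalType) (m : nat)
    (c d : chart R M m) : 'rV[R]_m -> 'rV[R]_m :=
  fun x => cmap d (cinv c x).

Definition compatible (R : realType) (M : topologicalType) (m : nat)
    (c d : chart R M m) : Prop :=
  smooth_on (tdom c d) (transition c d) /\
  smooth_on (tdom d c) (transition d c).

Record manifold (R : realType) (m : nat) := Manifold {
  points :> topologicalType;
  points_hausdorff : hausdorff_space points;
  points_second_countable : @second_countable points;
  chart_index : Type;
  atlas : chart_index -> chart R points m;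
  atlas_cover : forall p : points, exists i, cdom (atlas i) p;
  atlas_compatible : forall i j, compatible (atlas i) (atlas j)
}.

(** Tensor fields on open subsets of R^m *)

(* vector field: coefficients *)
Definition vfield (R : realType) (m : nat) := 'rV[R]_m -> 'rV[R]_m.
(* (0,2)-tensor: Gram matrix; (1,1)-tensor: matrix acting on the right *)
Definition mfield (R : realType) (m : nat) := 'rV[R]_m -> 'M[R]_m.
(* (1,2)-tensor S, or the Christoffel symbols of a connection nabla:          *)
(* [S x i] is the matrix of Y |-> S_{d_i} Y, resp. row j of [A x i] is        *)
(* nabla_{d_i} d_j                                                            *)
Definition cfield (R : realType) (m : nat) := 'rV[R]_m -> 'I_m -> 'M[R]_m.

Definition bil (R : realType) (m : nat) (G : 'M[R]_m) (X Y : 'rV[R]_m) : R :=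
  (X *m G *m Y^T) 0 0.

Definition along (R : realType) (m : nat) (T : 'I_m -> 'M[R]_m)
    (X : 'rV[R]_m) : 'M[R]_m :=
  \sum_i X 0 i *: T i.

Definition christoffel (R : realType) (m : nat) (g : mfield R m) : cfield R m :=
  fun x i => \matrix_(j, k)
    \sum_l 2^-1 * (pd i g x j l + pd j g x i l - pd l g x i j)
           * invmx (g x) l k.

(* [curvature A x i j] is the matrix of the endomorphism                      *)
(* Y |-> nabla_{d_i} nabla_{d_j} Y - nabla_{d_j} nabla_{d_i} Y                *)
Definition curvature (R : realType) (m : nat) (A : cfield R m)
    (x : 'rV[R]_m) (i j : 'I_m) : 'M[R]_m :=
  pd i (A^~ j) x - pd j (A^~ i) x + A x j *m A x i - A x i *m A x j.

(* Covariant derivatives nabla_{d_i} of a (0,2)-, (1,1)-, (1,2)- and          *)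
(* (1,3)-tensor field, for the connection with Christoffel symbols A.         *)

Definition cov02 (R : realType) (m : nat) (A : cfield R m) (g : mfield R m)
    (x : 'rV[R]_m) (i : 'I_m) : 'M[R]_m :=
  pd i g x - A x i *m g x - g x *m (A x i)^T.

Definition cov11 (R : realType) (m : nat) (A : cfield R m) (J : mfield R m)
    (x : 'rV[R]_m) (i : 'I_m) : 'M[R]_m :=
  pd i J x + J x *m A x i - A x i *m J x.

Definition cov12 (R : realType) (m : nat) (A : cfield R m) (S : cfield R m)
    (x : 'rV[R]_m) (i j : 'I_m) : 'M[R]_m :=
  pd i (S^~ j) x + S x j *m A x i - A x i *m S x j
  - \sum_k A x i j k *: S x k.

Definition cov13 (R : realType) (m : nat) (A : cfield R m)
    (Q : 'rV[R]_m -> 'I_m -> 'I_m -> 'M[R]_m)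
    (x : 'rV[R]_m) (i j k : 'I_m) : 'M[R]_m :=
  pd i (fun y => Q y j k) x + Q x j k *m A x i - A x i *m Q x j k
  - \sum_l A x i j l *: Q x l k - \sum_l A x i k l *: Q x j l.

Definition pseudo_kahler_on (R : realType) (m : nat) (D : set 'rV[R]_m)
    (g J : mfield R m) : Prop :=
  [/\ smooth_on D g,
      smooth_on D J,
      forall x, D x -> (g x)^T = g x /\ g x \in unitmx,
      forall x, D x -> J x *m J x = - 1%:M /\
        (forall X Y, bil (g x) (X *m J x) (Y *m J x) = bil (g x) X Y)
    & forall x, D x -> forall i, cov11 (christoffel g) J x i = 0].

Definition homogeneous_structure_on (R : realType) (m : nat)
    (D : set 'rV[R]_m) (g J : mfield R m) (S : cfield R m) : Prop :=
  let nabla := christoffel g in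
  let nablat : cfield R m := fun x i => nabla x i - S x i in
  [/\ forall j, smooth_on D (S^~ j),
      forall x, D x -> forall i, cov02 nablat g x i = 0,
      forall x, D x -> forall i j k, cov13 nablat (curvature nabla) x i j k = 0,
      forall x, D x -> forall i j, cov12 nablat S x i j = 0
    & forall x, D x -> forall i, cov11 nablat J x i = 0].

Definition linear_type_on (R : realType) (m : nat)
    (D : set 'rV[R]_m) (g J : mfield R m) (S : cfield R m)
    (xi zeta : vfield R m) : Prop :=
  forall x, D x -> forall X Y : 'rV[R]_m,
    let G := bil (g x) in
    let Jx := fun Z : 'rV[R]_m => Z *m J x in
    Y *m along (S x) X =
      G X Y *: xi x - G Y (xi x) *: X - G X (Jx Y) *: Jx (xi x)
      + G (Jx Y) (xi x) *: Jx X - (2 * G (Jx X) (zeta x)) *: Jx Y.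

(** Change of coordinates: tensor fields on both sides of a diffeomorphism
    [tau] defined on [D] correspond to each other. *)

Definition related_vector (R : realType) (m : nat) (D : set 'rV[R]_m)
    (tau : 'rV[R]_m -> 'rV[R]_m) (xi xi' : vfield R m) : Prop :=
  forall x, D x -> xi x *m jacobian tau x = xi' (tau x).

Definition related_metric (R : realType) (m : nat) (D : set 'rV[R]_m)
    (tau : 'rV[R]_m -> 'rV[R]_m) (g g' : mfield R m) : Prop :=
  forall x, D x -> forall X Y,
    bil (g' (tau x)) (X *m jacobian tau x) (Y *m jacobian tau x) =
    bil (g x) X Y.

Definition related_endo (R : realType) (m : nat) (D : set 'rV[R]_m)
    (tau : 'rV[R]_m -> 'rV[R]_m) (J J' : mfield R m) : Prop :=
  forall x, D x -> J x *m jacobian tau x = jacobian tau x *m J' (tau x).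

Definition related_12 (R : realType) (m : nat) (D : set 'rV[R]_m)
    (tau : 'rV[R]_m -> 'rV[R]_m) (S S' : cfield R m) : Prop :=
  forall x, D x -> forall X,
    along (S x) X *m jacobian tau x =
    jacobian tau x *m along (S' (tau x)) (X *m jacobian tau x).

(** Pseudo-Kähler manifolds and homogeneous structures. A tensor field on a
    manifold is the family of its expressions in the charts of the atlas. *)

Definition pseudo_kahler (R : realType) (m : nat) (M : manifold R m)
    (g J : chart_index M -> mfield R m) : Prop :=
  (forall i, pseudo_kahler_on (cimg (atlas i)) (g i) (J i)) /\
  (forall i j,
     let D := tdom (atlas i) (atlas j) in
     let tau := transition (atlas i) (atlas j) in
     related_metric D tau (g i) (g j) /\ related_endo D tau (J i) (J j)).

Definition vector_field (R : realType) (m : nat) (M : manifold R m)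
    (xi : chart_index M -> vfield R m) : Prop :=
  (forall i, smooth_on (cimg (atlas i)) (xi i)) /\
  (forall i j, related_vector (tdom (atlas i) (atlas j))
     (transition (atlas i) (atlas j)) (xi i) (xi j)).

Definition homogeneous_pseudo_kahler_structure (R : realType) (m : nat)
    (M : manifold R m) (g J : chart_index M -> mfield R m)
    (S : chart_index M -> cfield R m) : Prop :=
  (forall i, homogeneous_structure_on (cimg (atlas i)) (g i) (J i) (S i)) /\
  (forall i j, related_12 (tdom (atlas i) (atlas j))
     (transition (atlas i) (atlas j)) (S i) (S j)).

Definition strongly_degenerate (R : realType) (m : nat)
    (M : manifold R m) (g J : chart_index M -> mfield R m)
    (S : chart_index M -> cfield R m) : Prop :=
  exists xi zeta : chart_index M -> vfield R m,
    [/\ vector_field xi, vector_field zeta,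
        forall i, linear_type_on (cimg (atlas i))
                    (g i) (J i) (S i) (xi i) (zeta i),
        forall i x, cimg (atlas i) x -> xi i x != 0 /\
                    bil (g i x) (xi i x) (xi i x) = 0
      & forall i x, cimg (atlas i) x -> zeta i x = 0].

(* [psi] is a holomorphic isometry from [cdom psi], an open subset of M, onto *)
(* the open subset [cimg psi] of R^m endowed with g' and J'.                  *)
Definition holomorphic_isometry (R : realType) (m : nat) (M : manifold R m)
    (g J : chart_index M -> mfield R m) (psi : chart R M m)
    (g' J' : mfield R m) : Prop :=
  forall i,
    let D := tdom (atlas i) psi in
    let tau := transition (atlas i) psi in
    [/\ compatible (atlas i) psi,
        related_metric D tau (g i) g'
      & related_endo D tau (J i) J'].

(** The model. The real coordinates of C^(n+2) are ordered as
    w^1, w^2, z^1, z^2, x^1, y^1, ..., x^n, y^n. *)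

Definition cw1 (n : nat) : 'I_n.*2.+4 := inord 0.
Definition cw2 (n : nat) : 'I_n.*2.+4 := inord 1.
Definition cz1 (n : nat) : 'I_n.*2.+4 := inord 2.
Definition cz2 (n : nat) : 'I_n.*2.+4 := inord 3.
Definition cx (n : nat) (a : 'I_n) : 'I_n.*2.+4 := inord (4 + a.*2).
Definition cy (n : nat) (a : 'I_n) : 'I_n.*2.+4 := inord (5 + a.*2).

(* d_{2k} |-> d_{2k+1} and d_{2k+1} |-> - d_{2k} *)
Definition standard_J (R : realType) (n : nat) : mfield R n.*2.+4 :=
  fun=> \matrix_(i, j)
    if odd i then - (j.+1 == i :> nat)%:R else (j == i.+1 :> nat)%:R.

Definition wpart (R : realType) (n : nat) (x : 'rV[R]_n.*2.+4) : 'rV[R]_2 :=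
  \row_k if k == 0 then x 0 (cw1 n) else x 0 (cw2 n).

(* Gram matrix of du dv: for distinct coordinates this is                     *)
(* du (x) dv + dv (x) du, whereas du du = du (x) du.                          *)
Definition dd (R : realType) (m : nat) (u v : 'I_m) : 'M[R]_m :=
  if u == v then delta_mx u u else delta_mx u v + delta_mx v u.

Definition model_metric (R : realType) (n : nat) (eps : 'I_n -> R)
    (b : 'rV[R]_2 -> R) (r s : 'I_n -> 'rV[R]_2 -> R) : mfield R n.*2.+4 :=
  fun x => let w := wpart x in
    dd R (cw1 n) (cz1 n) + dd R (cw2 n) (cz2 n)
    + b w *: (dd R (cw1 n) (cw1 n) + dd R (cw2 n) (cw2 n))
    + \sum_a r a w *: (dd R (cx a) (cw1 n) + dd R (cy a) (cw2 n))
    + \sum_a s a w *: (dd R (cx a) (cw2 n) - dd R (cy a) (cw1 n))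
    + \sum_a eps a *: (dd R (cx a) (cx a) + dd R (cy a) (cy a)).

Definition laplacian (R : realType) (f : 'rV[R]_2 -> R) (w : 'rV[R]_2) : R :=
  pd 0 (pd 0 f) w + pd 1 (pd 1 f) w.

(* Main.v *)
Require Import Defs.
From HB Require Import structures.
From mathcomp Require Import all_boot all_order all_algebra.
From mathcomp Require Import all_classical all_reals all_analysis.
From mathcomp Require Import ring lra zify.
Import Order.TTheory GRing.Theory Num.Theory.
Import numFieldNormedType.Exports.
Local Open Scope classical_set_scope.
Local Open Scope ring_scope.

(** The connection [nabla - S] makes [g], [J], [S], the curvature [R] and, as a
    consequence, the vector field [xi] parallel ([xi_parallel]). Write [theta1]
    and [theta2] for the one-forms dual to [xi] and [J xi], and
    [phi = theta1 + i theta2], which is complex linear. That [xi] is parallel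
    means that [nabla phi = phi (x) phi]; so [phi] is closed, the Levi-Civita
    connection is flat on the complex null line spanned by [xi], and [xi] lies
    in the kernel of the curvature ([xi_riemann]).

    Since [R] is parallel for [nabla - S], its covariant derivative is an
    algebraic expression in [S] and [R]. The second Bianchi identity becomes a
    linear condition on [R] at each point, which leaves one number
    ([curvature_shape]): with [area = theta1 /\ theta2] and
    [turn X = theta1 (X) J xi - theta2 (X) xi], the curvature is
    [R (X, Y) = K area (X, Y) turn] ([riemann_turn]). As [area] and [turn] are
    parallel for [nabla - S] too, [K] is a constant ([curvature_constant]).

    Put [c = K / 2]. Adding to [nabla] a multiple by [c] of the real part of
    [phi^2 (x) (xi - i J xi)] gives a connection ([flat_form]) that has no torsion
    and commutes with [J]. Its curvature vanishes ([flat_curvature]), and it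
    preserves the metric [g - c |phi|^2] ([flat_metric_parallel]), while
    [nabla phi = phi (x) phi] still holds for it. A flat connection without torsion
    has affine coordinates ([affine_coordinates]): this is the theorem of
    Frobenius for linear total differential systems ([frobenius]), proved by
    solving a linear differential equation along the rays issued from a point.

    In affine coordinates [J] and [g - c |phi|^2] are constant, so that it
    suffices to bring them to normal form at one point. A Gram-Schmidt process
    that starts with the null vector [xi] does this ([normal_family_exists]) and
    makes [theta1] and [theta2] equal to [dw^1] and [dw^2] at that point. Choosing
    the origin of the coordinates such that [w = -1] there, [phi] and [- dw / w]
    solve the same differential system with the same initial value, hence
    agree near the point ([flat_coordinates], by [vanish_near]). Therefore
    [g = flat metric + (c / |w|^2) |dw|^2] ([local_model]). This is the model with
    [r_a = s_a = 0] and [b = c / |w|^2], whose Laplacian is [4 c / |w|^4]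
    ([laplacian_radial]), so [b0 = 4 c]. By the inverse function theorem
    ([inverse_function]) the affine coordinates form a chart. *)

Set Implicit Arguments.
Unset Strict Implicit.
Unset Printing Implicit Defensive.

(** * Differentials and directional derivatives *)

Section Differential.
Variable R : realType.
Implicit Types V W : normedModType R.

Lemma is_diff_littleo V W (f : V -> W) (df : {linear V -> W}) x :
  continuous df ->
  (forall e, 0 < e -> \forall h \near (0 : V),
     `|f (h + x) - f x - df h| <= e * `|h|) ->
  is_diff x f df.
Proof.
move=> dfc H.
have E : f \o shift x = cst (f x) + df +o_ 0 id.
  apply/eqaddoP => e e0; near=> h.
  rewrite [X in `|X|](_ : _ = f (h + x) - f x - df h); first by near: h; exact: H.
  by rewrite /= !fctE opprD addrA.
have D := diff_unique dfc E.
apply: DiffDef => //; apply/diff_locallyP; rewrite D; split => //.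
Unshelve. all: by end_near. Qed.

Lemma differentiable_near_eq V W (f h : V -> W) x :
  (\near x, f x = h x) -> differentiable f x -> differentiable h x.
Proof.
move=> E df; have fx : f x = h x by exact: (nbhs_singleton E).
have [C D] := iffLR (diff_locallyP _ _) df.
have : is_diff x h ('d f x).
  apply: is_diff_littleo => // e e0.
  move/eqaddoP : D => /(_ e e0) D.
  have E' : \forall k \near 0, f (k + x) = h (k + x).
    by move: E; rewrite (near_shift 0 x)/= subr0.
  near=> k.
  have <- : f (k + x) = h (k + x) by near: k.
  rewrite -fx.
  rewrite [X in `|X|](_ : _ = (f \o shift x - (cst (f x) + 'd f x)) k).
    by near: k.
  by rewrite /= !fctE opprD addrA.
by case.
Unshelve. all: by end_near. Qed.

(** The candidate differential of a map on row vectors with partial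
    derivatives [T i]. *)
Definition lincomb m W (T : 'I_m -> W) (h : 'rV[R]_m) : W :=
  \sum_i h 0 i *: T i.

Lemma lincomb_linear m W (T : 'I_m -> W) : linear (lincomb T).
Proof.
move=> a u v; rewrite /lincomb scaler_sumr -big_split; apply: eq_bigr => i _.
by rewrite !mxE scalerDl scalerA.
Qed.

HB.instance Definition _ m W (T : 'I_m -> W) :=
  GRing.isLinear.Build R 'rV[R]_m W _ (lincomb T) (lincomb_linear T).

Lemma lincomb_continuous m W (T : 'I_m -> W) : continuous (lincomb T).
Proof.
move=> x; apply: differentiable_continuous.
rewrite (_ : (lincomb T : 'rV_m -> W) = \sum_i (fun h : 'rV[R]_m => h 0 i *: T i)).
  apply: differentiable_sum => i; apply: differentiableZl.
  exact: differentiable_coord.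
by rewrite funeqE => h; rewrite fct_sumE.
Qed.

Lemma lincomb_norm m W (T : 'I_m -> W) h C :
  (forall i, `|T i| <= C) -> `|lincomb T h| <= m%:R * C * `|h|.
Proof.
move=> TC; apply: le_trans (ler_norm_sum _ _ _) _.
apply: (@le_trans _ _ (\sum_(i < m) C * `|h|)).
  apply: ler_sum => i _; rewrite normrZ mulrC ler_pM//.
  by rewrite [leRHS]/Num.Def.normr/= mx_normrE (le_bigmax _ _ (0, i)).
by rewrite sumr_const card_ord -mulrA mulr_natl.
Qed.

Lemma derivE_pd m W (f : 'rV[R]_m -> W) x v :
  differentiable f x -> 'D_v f x = lincomb (fun i => pd i f x) v.
Proof.
move=> df; rewrite deriveE// {1}(row_sum_delta v) linear_sum.
by apply: eq_bigr => i _; rewrite linearZ/= /pd deriveE.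
Qed.

Lemma differentiable_lincomb m W (f : 'rV[R]_m -> W) (T : 'I_m -> W)
    (x : 'rV[R]_m) :
  (forall e, 0 < e -> \forall h \near (0 : 'rV[R]_m),
     `|f (h + x) - f x - lincomb T h| <= e * `|h|) ->
  differentiable f x /\ forall v, 'D_v f x = lincomb T v.
Proof.
move=> H; have [D E] := is_diff_littleo (@lincomb_continuous m W T) H.
by split=> // v; rewrite deriveE// E.
Qed.

Lemma derivable_of_diff V W (f : V -> W) x v :
  differentiable f x -> is_derive x v f ('D_v f x).
Proof. by move=> /diff_derivable df; apply: DeriveDef. Qed.

Lemma is_derive_mxP V a b (f : V -> 'M[R]_(a, b)) x v df :
  is_derive x v f df <-> forall i j, is_derive x v (fun y => f y i j) (df i j).
Proof.
split=> [[D <-] i j|H].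
  rewrite derive_mx// mxE; apply: DeriveDef => //.
  by move/derivable_mxP : D.
have D : derivable f x v by apply/derivable_mxP => i j; have [] := H i j.
apply: DeriveDef => //; rewrite derive_mx//; apply/matrixP => i j.
by rewrite mxE; have [] := H i j.
Qed.

Lemma is_derive_bigsum V W (I : finType) (f : I -> V -> W) x v df :
  (forall i, is_derive x v (f i) (df i)) ->
  is_derive x v (fun y => \sum_i f i y) (\sum_i df i).
Proof.
move=> H; rewrite (_ : (fun y => _) = \sum_i f i); last first.
  by rewrite funeqE => y; rewrite fct_sumE.
elim/big_ind2 : _ => //[|g dg h dh ? ?]; first exact: is_derive_cst.
exact: is_deriveD.
Qed.

Lemma is_derive_mulmx V a b c (f : V -> 'M[R]_(a, b)) (h : V -> 'M[R]_(b, c))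
    x v df dh :
  is_derive x v f df -> is_derive x v h dh ->
  is_derive x v (fun y => f y *m h y) (df *m h x + f x *m dh).
Proof.
move=> /is_derive_mxP F /is_derive_mxP H; apply/is_derive_mxP => i j.
rewrite (_ : (fun y => _) = fun y => \sum_k f y i k * h y k j); last first.
  by rewrite funeqE => y; rewrite mxE.
rewrite [X in is_derive _ _ _ X](_ : _ =
    \sum_k (f x i k *: dh k j + h x k j *: df i k)); last first.
  rewrite !mxE -big_split; apply: eq_bigr => k _ /=.
  by rewrite /GRing.scale/= addrC [df i k * _]mulrC.
by apply: is_derive_bigsum => k; apply: is_deriveM.
Qed.

Lemma is_derive_scale V a b (f : V -> R) (h : V -> 'M[R]_(a, b)) x v df dh :
  is_derive x v f df -> is_derive x v h dh ->
  is_derive x v (fun y => f y *: h y) (df *: h x + f x *: dh).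
Proof.
move=> F /is_derive_mxP H; apply/is_derive_mxP => i j.
rewrite (_ : (fun y => _) = f * (fun y => h y i j)); last first.
  by rewrite funeqE => y; rewrite mxE.
apply: is_derive_eq; rewrite !mxE /GRing.scale/= addrC; congr (_ + _).
exact: mulrC.
Qed.

Lemma is_derive_trmx V a b (f : V -> 'M[R]_(a, b)) x v df :
  is_derive x v f df -> is_derive x v (fun y => (f y)^T) df^T.
Proof.
move=> /is_derive_mxP F; apply/is_derive_mxP => i j; rewrite mxE.
by rewrite (_ : (fun y => _) = fun y => f y j i)// funeqE => y; rewrite mxE.
Qed.

Lemma is_derive_unique V W (f : V -> W) x v d1 d2 :
  is_derive x v f d1 -> is_derive x v f d2 -> d1 = d2.
Proof. by move=> [_ <-] [_ <-]. Qed.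

Lemma differentiable_entry V a b (f : V -> 'M[R]_(a, b)) x i j :
  differentiable f x -> differentiable (fun y => f y i j) x.
Proof.
move=> df; apply: (@differentiable_comp _ _ _ _ f (fun N : 'M[R]_(a, b) => N i j)) => //.
exact: differentiable_coord.
Qed.

End Differential.

(** * The class of smooth functions *)

Section Smooth.
Variable R : realType.
Implicit Types V W : normedModType R.

Lemma Ck_congr k V W (D : set V) (f h : V -> W) :
  open D -> (forall x, D x -> f x = h x) -> Ck k D f -> Ck k D h.
Proof.
move=> oD; have near_eq (f' h' : V -> W) : (forall x, D x -> f' x = h' x) ->
    forall x, D x -> \near x, f' x = h' x.
  by move=> E x Dx; apply: filterS (open_nbhs_nbhs (conj oD Dx)).
elim: k f h => [|k IH] f h E /=.
  move=> fc x Dx; rewrite /prop_for /continuous_at -E//.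
  by apply: cvg_trans (fc x Dx); apply: near_eq_cvg; exact: near_eq.
move=> [fd fC]; split=> [x Dx|v].
  by apply: differentiable_near_eq (fd x Dx); exact: near_eq.
by apply: IH (fC v) => x Dx; apply: near_eq_derive; exact: near_eq.
Qed.

Lemma Ck_pred k V W (D : set V) (f : V -> W) : Ck k.+1 D f -> Ck k D f.
Proof.
elim: k f => [|k IH] f [fd fC].
  by move=> x /fd; exact: differentiable_continuous.
by split=> // v; apply: IH.
Qed.

Lemma Ck_sub k V W (D D' : set V) (f : V -> W) :
  D' `<=` D -> Ck k D f -> Ck k D' f.
Proof.
move=> DD'; elim: k f => [|k IH] f /=; first by move=> H x /DD'; exact: H.
by move=> [fd fC]; split=> [x /DD'/fd//|v]; apply: IH.
Qed.

Lemma Ck_cst k V W (D : set V) (w : W) : Ck k D (fun _ : V => w).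
Proof.
elim: k w => [|k IH] w /=; first by move=> x _; exact: cst_continuous.
split=> [x _|v]; first exact: differentiable_cst.
rewrite (_ : 'D_v _ = fun=> 0); first exact: IH.
by rewrite funeqE => x; rewrite derive_cst.
Qed.

Lemma CkD k V W (D : set V) (f h : V -> W) :
  open D -> Ck k D f -> Ck k D h -> Ck k D (fun x => f x + h x).
Proof.
move=> oD; elim: k f h => [|k IH] f h /=.
  by move=> fc hc x Dx; apply: cvgD; [exact: fc|exact: hc].
move=> [fd fC] [hd hC]; split=> [x Dx|v].
  by apply: differentiableD; [exact: fd|exact: hd].
apply: Ck_congr (IH _ _ (fC v) (hC v)) => // x Dx.
by rewrite -deriveD//; apply: diff_derivable; [exact: fd|exact: hd].
Qed.

Lemma CkN k V W (D : set V) (f : V -> W) :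
  open D -> Ck k D f -> Ck k D (fun x => - f x).
Proof.
move=> oD; elim: k f => [|k IH] f /=.
  by move=> fc x Dx; apply: cvgN; exact: fc.
move=> [fd fC]; split=> [x Dx|v]; first by apply: differentiableN; exact: fd.
apply: (Ck_congr (f := fun x => - 'D_v f x)) => // [x Dx|]; last exact: IH.
by rewrite -deriveN//; exact: diff_derivable (fd _ Dx).
Qed.

Lemma CkB k V W (D : set V) (f h : V -> W) :
  open D -> Ck k D f -> Ck k D h -> Ck k D (fun x => f x - h x).
Proof. by move=> oD fC hC; apply: CkD => //; exact: CkN. Qed.

Lemma Ck_sum k V W (D : set V) (I : finType) (P : pred I) (f : I -> V -> W) :
  open D -> (forall i, P i -> Ck k D (f i)) ->
  Ck k D (fun x => \sum_(i | P i) f i x).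
Proof.
move=> oD H; rewrite (_ : (fun x => _) = \sum_(i | P i) f i); last first.
  by rewrite funeqE => x; rewrite fct_sumE.
elim/big_ind : _ => //; first exact: Ck_cst.
by move=> f1 f2; exact: CkD.
Qed.

Lemma CkZl k V W (D : set V) (f : V -> R) (w : W) :
  open D -> Ck k D f -> Ck k D (fun x => f x *: w).
Proof.
move=> oD; elim: k f => [|k IH] f /=.
  by move=> fc x Dx; apply: cvgZr_tmp; exact: fc.
move=> [fd fC]; split=> [x Dx|v]; first by apply: differentiableZl; exact: fd.
apply: Ck_congr (IH _ (fC v)) => // x Dx.
have fx := fd x Dx; rewrite [RHS]deriveE; last exact: differentiableZl.
by rewrite diffZl// deriveE.
Qed.

Lemma CkM k V (D : set V) (f h : V -> R) :
  open D -> Ck k D f -> Ck k D h -> Ck k D (fun x => f x * h x).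
Proof.
move=> oD; elim: k f h => [|k IH] f h /=.
  by move=> fc hc x Dx; apply: cvgM; [exact: fc|exact: hc].
move=> fS hS; have [fk hk] := (Ck_pred fS, Ck_pred hS).
have [fd fC] := fS; have [hd hC] := hS.
split=> [x Dx|v]; first by apply: differentiableM; [exact: fd|exact: hd].
apply: Ck_congr (CkD oD (IH _ _ fk (hC v)) (IH _ _ hk (fC v))) => // x Dx.
by rewrite -[in RHS](_ : f * h = (fun y => f y * h y))// deriveM//;
  apply: diff_derivable; [exact: fd|exact: hd].
Qed.

Lemma Ck_prod k V (D : set V) (I : finType) (P : pred I) (f : I -> V -> R) :
  open D -> (forall i, P i -> Ck k D (f i)) ->
  Ck k D (fun x => \prod_(i | P i) f i x).
Proof.
move=> oD H; rewrite (_ : (fun x => _) = \prod_(i | P i) f i); last first.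
  rewrite funeqE => x; elim/big_ind2 : _ => // f1 y1 f2 y2 -> ->.
  by [].
elim/big_ind : _ => //; first exact: Ck_cst.
by move=> f1 f2; exact: CkM.
Qed.

Lemma CkV k V (D : set V) (f : V -> R) :
  open D -> (forall x, D x -> f x != 0) -> Ck k D f -> Ck k D (fun x => (f x)^-1).
Proof.
move=> oD f0; elim: k => [|k IH] /=.
  by move=> fc x Dx; apply: cvgV; [exact: f0|exact: fc].
move=> fS; have [fd fC] := fS; have {}IH := IH (Ck_pred fS).
split=> [x Dx|v]; first by apply: differentiableV; [exact: fd|exact: f0].
have H : Ck k D (fun x => (f x)^-1 * (f x)^-1 * (-1) * 'D_v f x).
  by apply: CkM => //; apply: CkM => //; [exact: CkM|exact: Ck_cst].
apply: Ck_congr H => // x Dx.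
rewrite deriveV//; [|exact: f0|exact: diff_derivable (fd x Dx)].
by rewrite /GRing.scale/= mulrN1 expr2 invfM.
Qed.

Lemma Ck_entry k V a b (D : set V) (f : V -> 'M[R]_(a, b)) i j :
  open D -> Ck k D f -> Ck k D (fun x => f x i j).
Proof.
move=> oD; elim: k f => [|k IH] f /=.
  move=> fc x Dx; apply: (@continuous_comp _ _ _ f (fun N : 'M[R]_(a, b) => N i j)).
    exact: fc.
  exact: coord_continuous.
move=> [fd fC]; split=> [x Dx|v].
  by apply: differentiable_entry; exact: fd.
apply: Ck_congr (IH _ (fC v)) => // x Dx.
by rewrite derive_mx ?mxE//; apply: diff_derivable; exact: fd.
Qed.

Lemma Ck_mx k V a b (D : set V) (f : V -> 'M[R]_(a, b)) :
  open D -> (forall i j, Ck k D (fun x => f x i j)) -> Ck k D f.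
Proof.
move=> oD H.
rewrite (_ : f = fun x => \sum_i \sum_j f x i j *: delta_mx i j); last first.
  by rewrite funeqE => y; rewrite {1}[f y]matrix_sum_delta.
by apply: Ck_sum => // i _; apply: Ck_sum => // j _; apply: CkZl.
Qed.

Lemma Ck_comp k V m a b (D : set V) (D' : set 'rV[R]_m) (f : V -> 'rV[R]_m)
    (h : 'rV[R]_m -> 'M[R]_(a, b)) :
  open D -> (forall x, D x -> D' (f x)) -> Ck k D f -> Ck k D' h ->
  Ck k D (fun x => h (f x)).
Proof.
move=> oD fD; elim: k h => [|k IH] h fS.
  move=> hc x Dx; apply: (@continuous_comp _ _ _ f h); first exact: fS.
  by apply: hc; exact: fD.
have [fd fC] := fS; move=> [hd hC]; split=> [x Dx|v].
  by apply: (@differentiable_comp _ _ _ _ f h); [exact: fd|apply: hd; exact: fD].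
have {}IH h' := IH h' (Ck_pred fS).
have H : Ck k D (fun x => \sum_i 'D_v f x 0 i *: pd i h (f x)).
  apply: Ck_sum => // i _; apply: Ck_mx => // p q.
  under eq_fun do rewrite mxE.
  apply: CkM => //; first by apply: Ck_entry => //; exact: fC.
  by apply: Ck_entry => //; apply: IH; exact: hC.
apply: Ck_congr H => // x Dx.
rewrite [RHS]deriveE; last first.
  by apply: (@differentiable_comp _ _ _ _ f h); [exact: fd|apply: hd; exact: fD].
have hdx : differentiable h (f x) by apply: hd; exact: fD.
rewrite (@diff_comp _ _ _ _ f h)//; last exact: fd.
by rewrite /= -!deriveE ?derivE_pd//; exact: fd.
Qed.

Lemma Ck_mulmx k V a b c (D : set V) (f : V -> 'M[R]_(a, b))
    (h : V -> 'M[R]_(b, c)) :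
  open D -> Ck k D f -> Ck k D h -> Ck k D (fun x => f x *m h x).
Proof.
move=> oD fC hC; apply: Ck_mx => // i j; under eq_fun do rewrite mxE.
by apply: Ck_sum => // l _; apply: CkM => //; exact: Ck_entry.
Qed.

Lemma Ck_trmx k V a b (D : set V) (f : V -> 'M[R]_(a, b)) :
  open D -> Ck k D f -> Ck k D (fun x => (f x)^T).
Proof.
move=> oD fC; apply: Ck_mx => // i j; under eq_fun do rewrite mxE.
exact: Ck_entry.
Qed.

Lemma Ck_scale k V a b (D : set V) (f : V -> R) (h : V -> 'M[R]_(a, b)) :
  open D -> Ck k D f -> Ck k D h -> Ck k D (fun x => f x *: h x).
Proof.
move=> oD fC hC; apply: Ck_mx => // i j; under eq_fun do rewrite mxE.
by apply: CkM => //; exact: Ck_entry.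
Qed.

Lemma Ck_det k V a (D : set V) (f : V -> 'M[R]_a) :
  open D -> Ck k D f -> Ck k D (fun x => \det (f x)).
Proof.
move=> oD fC; apply: Ck_sum => // s _; apply: CkM => //; first exact: Ck_cst.
by apply: Ck_prod => // i _; exact: Ck_entry.
Qed.

Lemma Ck_invmx k V a (D : set V) (f : V -> 'M[R]_a) :
  open D -> (forall x, D x -> f x \in unitmx) -> Ck k D f ->
  Ck k D (fun x => invmx (f x)).
Proof.
move=> oD fU fC.
have H : Ck k D (fun x => (\det (f x))^-1 *: \adj (f x)).
  apply: Ck_scale => //.
    apply: CkV => //; last exact: Ck_det.
    by move=> x /fU; rewrite unitmxE unitfE.
  apply: Ck_mx => // i j; under eq_fun do rewrite mxE.
  apply: CkM => //; first exact: Ck_cst.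
  apply: Ck_det => //; apply: Ck_mx => // p q; under eq_fun do rewrite !mxE.
  exact: Ck_entry.
by apply: Ck_congr H => // x Dx; rewrite /invmx fU.
Qed.

(** A solution of a differential system with smooth coefficients gains one
    derivative at a time from the system. *)
Lemma smooth_bootstrap V W (D : set V) (f : V -> W) (Phi : V -> V -> W) :
  open D -> (forall x, D x -> differentiable f x) ->
  (forall v x, D x -> 'D_v f x = Phi v x) ->
  (forall k, Ck k D f -> forall v, Ck k D (Phi v)) -> smooth_on D f.
Proof.
move=> oD fd fE H; elim=> [|k IH]; first by move=> x /fd; exact: differentiable_continuous.
split=> // v; apply: Ck_congr (H k IH v) => // x Dx.
by rewrite fE.
Qed.

Lemma smooth_differentiable V W (D : set V) (f : V -> W) x :
  smooth_on D f -> D x -> differentiable f x.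
Proof. by move=> /(_ 1%N)[+ _]; exact. Qed.

Lemma smooth_derive V W (D : set V) (f : V -> W) v :
  smooth_on D f -> smooth_on D ('D_v f).
Proof. by move=> fS k; have [_ H] := fS k.+1; exact: H. Qed.

End Smooth.

(** * Mean value estimates *)

Section MeanValue.
Variable R : realType.
Implicit Types V W : normedModType R.

Lemma entry_norm_le a b (A : 'M[R]_(a, b)) i j : `|A i j| <= `|A|.
Proof. by rewrite [leRHS]/Num.Def.normr/= mx_normrE (le_bigmax _ _ (i, j)). Qed.

Lemma mx_norm_le a b (A : 'M[R]_(a, b)) C :
  0 <= C -> (forall i j, `|A i j| <= C) -> `|A| <= C.
Proof.
by move=> C0 H; rewrite [leLHS]/Num.Def.normr/= mx_normrE bigmax_le// => -[i j] _.
Qed.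

Lemma mulmx_norm_le a b c (A : 'M[R]_(a, b)) (B : 'M[R]_(b, c)) :
  `|A *m B| <= b%:R * `|A| * `|B|.
Proof.
apply: mx_norm_le => [|i j]; first by rewrite !mulr_ge0.
rewrite mxE; apply: le_trans (ler_norm_sum _ _ _) _.
apply: (@le_trans _ _ (\sum_(k < b) `|A| * `|B|)).
  by apply: ler_sum => k _; rewrite normrM ler_pM ?entry_norm_le.
by rewrite sumr_const card_ord -mulrA mulr_natl.
Qed.

Lemma nbhs_dist V (x : V) (P : set V) :
  nbhs x P -> exists2 r : R, 0 < r & forall y, `|y - x| < r -> P y.
Proof.
by move=> /nbhs_normP[r r0 H]; exists r => // y yr; apply: H; rewrite /= distrC.
Qed.

Lemma dist_nbhs V (x : V) (P : set V) (r : R) :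
  0 < r -> (forall y, `|y - x| < r -> P y) -> nbhs x P.
Proof.
move=> r0 H; apply/nbhs_normP; exists r => // y /= yr.
by apply: H; rewrite distrC.
Qed.

Lemma open_dist V (x : V) (r : R) : open [set y | `|y - x| < r].
Proof.
rewrite (_ : mkset _ = ball x r); first exact: ball_open.
by rewrite -ball_normE; apply/seteqP; split=> y /=; rewrite distrC.
Qed.

(** The norm of matrices is the sup norm, so the mean value theorem in one
    variable applies entry by entry without loss in the constant. *)
Lemma mean_value a b (f df : R -> 'M[R]_(a, b)) (s t C : R) :
  s <= t -> (forall x, s <= x <= t -> is_derive x 1 f (df x)) ->
  (forall x, s <= x <= t -> `|df x| <= C) -> `|f t - f s| <= C * (t - s).
Proof.
move=> st fd dC.
have C0 : 0 <= C by apply: le_trans (dC s _) => //; rewrite lexx.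
apply: mx_norm_le => [|i j]; first by rewrite mulr_ge0// subr_ge0.
have fij x : s <= x <= t -> is_derive x 1 (fun y => f y i j) (df x i j).
  by move=> /fd /is_derive_mxP; exact.
have [||c + E] := @MVT_segment R (fun y => f y i j) (fun y => df y i j) s t st.
- by move=> x; rewrite in_itv/= => /andP[? ?]; apply: fij; rewrite !ltW.
- apply: derivable_within_continuous => x; rewrite in_itv/= => /fij.
  by case.
rewrite in_itv/= => cst; rewrite !mxE E normrM [`|t - s|]ger0_norm ?subr_ge0//.
by rewrite ler_wpM2r ?subr_ge0// (le_trans (entry_norm_le _ _ _))// dC.
Qed.

(** Evaluating the estimate where [|delta|] is maximal absorbs the term
    [|delta| / 2]. *)
Lemma gronwall a b (delta ddelta : R -> 'M[R]_(a, b)) (K : R) :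
  (forall t : R, 0 <= t <= 1 -> is_derive t 1 delta (ddelta t)) -> delta 0 = 0 ->
  (forall t : R, 0 <= t <= 1 -> `|ddelta t| <= 2^-1 * `|delta t| + K) ->
  forall t : R, 0 <= t <= 1 -> `|delta t| <= 2 * K.
Proof.
move=> dd d0 dK.
have dC : {within `[0, 1], continuous (fun t => `|delta t|)}.
  move=> x; apply: continuous_comp; last exact: norm_continuous.
  apply: derivable_within_continuous => t; rewrite in_itv/= => /dd.
  by case.
have [c c01 cmax] := EVT_max (@ler01 R) dC.
have {}c01 : 0 <= c <= 1 by move: c01; rewrite in_itv.
have {}cmax t : 0 <= t <= 1 -> `|delta t| <= `|delta c|.
  by move=> t01; apply: cmax; rewrite in_itv.
have [c0 c1] := andP c01.
have H : `|delta c - delta 0| <= (2^-1 * `|delta c| + K) * (c - 0).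
  apply: mean_value => // x /andP[x0 xc]; have x1 := le_trans xc c1.
    by apply: dd; rewrite x0 x1.
  by apply: le_trans (dK _ _) _; rewrite ?x0 ?x1// lerD2r ler_wpM2l// cmax// x0 x1.
have B : 0 <= 2^-1 * `|delta c| + K by apply: le_trans (dK c c01).
move=> t t01; apply: le_trans (cmax t t01) _.
rewrite d0 !subr0 in H.
have : (2^-1 * `|delta c| + K) * c <= 2^-1 * `|delta c| + K.
  by rewrite ler_piMr.
set u := `|delta c| in H B *; lra.
Qed.

Lemma is_derive_line V W (f : V -> W) (x h : V) (t : R) df :
  is_derive (x + t *: h) h f df -> is_derive t 1 (fun s => f (x + s *: h)) df.
Proof.
move=> [D E].
have H : (fun u : R => u^-1 *: ((fun s => f (x + s *: h)) (u *: 1 + t) - f (x + t *: h)))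
       = (fun u : R => u^-1 *: (f (u *: h + (x + t *: h)) - f (x + t *: h))).
  rewrite funeqE => u; congr (_ *: (f _ - _)).
  by rewrite -[u%:A]/(u * 1) mulr1 scalerDl addrCA.
by apply: DeriveDef; rewrite /derivable /derive ?H// -E.
Qed.

Lemma mean_value_line V a b (f : V -> 'M[R]_(a, b)) (x h : V) (C : R) :
  (forall t : R, 0 <= t <= 1 -> derivable f (x + t *: h) h) ->
  (forall t : R, 0 <= t <= 1 -> `|'D_h f (x + t *: h)| <= C) ->
  `|f (x + h) - f x| <= C.
Proof.
move=> fd fC.
have := @mean_value a b (fun t => f (x + t *: h)) (fun t => 'D_h f (x + t *: h))
  0 1 C ler01.
rewrite scale1r scale0r addr0 subr0 mulr1; apply => t t01; last exact: fC.
by apply: is_derive_line; apply: DeriveDef => //; exact: fd.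
Qed.

Lemma segment_dist V (x0 x h : V) (r t : R) :
  0 <= t <= 1 -> `|x - x0| < r -> `|x + h - x0| < r -> `|x + t *: h - x0| < r.
Proof.
move=> /andP[t0 t1] xr yr.
rewrite (_ : x + t *: h - x0 = (1 - t) *: (x - x0) + t *: (x + h - x0)); last first.
  by rewrite [x + h - x0]addrAC [t *: (x - x0 + h)]scalerDr addrA -scalerDl subrK scale1r addrAC.
apply: le_lt_trans (ler_normD _ _) _; rewrite !normrZ.
rewrite (ger0_norm t0) ger0_norm ?subr_ge0//.
move: xr yr; set u := `|_|; set v := `|_| => ur vr.
have [->|t0'] := eqVneq t 0; first by rewrite subr0 mul0r addr0 mul1r.
have tp : 0 < t by rewrite lt_neqAle eq_sym t0'.
have : t * v < t * r by rewrite ltr_pM2l.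
have : (1 - t) * u <= (1 - t) * r by rewrite ler_wpM2l ?subr_ge0// ltW.
by lra.
Qed.

(** Uniqueness for total differential systems: near [x0] the estimate along
    the segment issued from [x0] is that of [gronwall] with [K = 0]. *)
Lemma vanish_near V a b (Y : V -> 'M[R]_(a, b)) (x0 : V) (r C : R) :
  0 < r -> Y x0 = 0 ->
  (forall x, `|x - x0| < r -> differentiable Y x) ->
  (forall x v, `|x - x0| < r -> `|'D_v Y x| <= C * `|v| * `|Y x|) ->
  exists2 r', 0 < r' & forall x, `|x - x0| < r' -> Y x = 0.
Proof.
move=> r0 Y0 Yd YC; pose q := (2 * (`|C| + 1))^-1.
have q0 : 0 < q by rewrite invr_gt0 mulr_gt0// ltr_wpDl.
exists (Num.min r q) => [|x]; first by rewrite lt_min r0.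
rewrite lt_min => /andP[xr xq]; pose h := x - x0.
have seg t : 0 <= t <= 1 -> `|x0 + t *: h - x0| < r.
  by move=> t01; apply: segment_dist => //; rewrite ?subrr ?normr0// addrCA subrr addr0.
have := @gronwall a b (fun t => Y (x0 + t *: h)) (fun t => 'D_h Y (x0 + t *: h)) 0.
rewrite mulr0 scale0r addr0 => /(_ _ Y0) H.
have : `|Y (x0 + 1 *: h)| <= 0.
  apply: H => [t /seg tr|t /seg tr|]; last by rewrite lexx ler01.
    by apply: is_derive_line; apply: derivable_of_diff; exact: Yd.
  rewrite addr0; apply: le_trans (YC _ _ tr) _; rewrite ler_wpM2r//.
  have : `|h| * (2 * (`|C| + 1)) <= 1.
    by rewrite -ler_pdivlMr ?mulr_gt0 ?ltr_wpDl// mul1r; exact: ltW.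
  have : C * `|h| <= `|C| * `|h| by rewrite ler_wpM2r// ler_norm.
  have := normr_ge0 h; nra.
by rewrite scale1r addrCA subrr addr0 normr_le0 => /eqP.
Qed.

Lemma locally_constant V a b (Y : V -> 'M[R]_(a, b)) (x0 : V) (r : R) :
  (forall x, `|x - x0| < r -> differentiable Y x) ->
  (forall x v, `|x - x0| < r -> 'D_v Y x = 0) ->
  forall x, `|x - x0| < r -> Y x = Y x0.
Proof.
move=> Yd Y0 x xr; apply/eqP; rewrite -subr_eq0 -normr_le0; apply/eqP/eqP.
have E : x = x0 + (x - x0) by rewrite addrCA subrr addr0.
have r0 : 0 < r by apply: le_lt_trans xr.
have seg t : 0 <= t <= 1 -> `|x0 + t *: (x - x0) - x0| < r.
  by move=> t01; apply: segment_dist => //; rewrite ?subrr ?normr0// -E.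
rewrite {1}E; apply: mean_value_line => t /seg tr.
  by apply: diff_derivable; exact: Yd.
by rewrite Y0// normr0.
Qed.

Lemma smooth_lipschitz m a b (D : set 'rV[R]_m)
    (f : 'rV[R]_m -> 'M[R]_(a, b)) (x0 : 'rV[R]_m) :
  open D -> D x0 -> smooth_on D f ->
  exists r C, [/\ 0 < r, 0 <= C, forall x, `|x - x0| < r -> D x,
    forall x, `|x - x0| < r -> `|f x| <= C &
    forall x y, `|x - x0| < r -> `|y - x0| < r -> `|f y - f x| <= C * `|y - x|].
Proof.
move=> oD Dx0 fS.
have bounded_near c d (h : 'rV[R]_m -> 'M[R]_(c, d)) : {for x0, continuous h} ->
    \forall x \near x0, `|h x| <= `|h x0| + 1.
  move=> hc; have : \forall x \near x0, `|h x0 - h x| < 1.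
    by move/cvgrPdist_lt : hc; apply.
  apply: filterS => x xr; rewrite -[h x](subrK (h x0)) addrC.
  by rewrite (le_trans (ler_normD _ _))// lerD2l distrC ltW.
pose P x := [/\ D x, `|f x| <= `|f x0| + 1 &
  forall i : 'I_m, `|pd i f x| <= `|pd i f x0| + 1].
have : \forall x \near x0, P x.
  have H1 : \forall x \near x0, D x by exact: open_nbhs_nbhs.
  have H2 := bounded_near _ _ f (fS 0%N x0 Dx0).
  have H3 : \forall x \near x0, forall i : 'I_m, `|pd i f x| <= `|pd i f x0| + 1.
    apply: (@filter_forall _ _ (fun i x => `|pd i f x| <= `|pd i f x0| + 1) (nbhs x0)).
    move=> i; apply: bounded_near.
    by have [_ /(_ (delta_mx 0 i)) H] := fS 1%N; exact: (H x0 Dx0).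
  by near=> x; split; near: x.
move=> /nbhs_dist[r r0 rP].
pose K := \sum_i (`|pd i f x0| + 1); pose C := `|f x0| + 1 + m%:R * K.
have K0 : 0 <= K by apply: sumr_ge0 => i _; rewrite addr_ge0.
have iK i : `|pd i f x0| + 1 <= K.
  by rewrite /K (bigD1 i)//= lerDl sumr_ge0// => j _; rewrite addr_ge0.
have f0 := normr_ge0 (f x0).
have mK : 0 <= m%:R * K by rewrite mulr_ge0.
exists r, C; split=> // [|x /rP[]//|x /rP[_ + _]|x y xr yr].
- by rewrite /C; lra.
- by rewrite /C; lra.
have E : y = x + (y - x) by rewrite addrCA subrr addr0.
have seg t : 0 <= t <= 1 -> `|x + t *: (y - x) - x0| < r.
  by move=> t01; apply: segment_dist => //; rewrite -E.
rewrite {1}E; apply: mean_value_line => t /seg/rP[Dt _ tK].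
  by apply: diff_derivable; exact: smooth_differentiable fS Dt.
rewrite derivE_pd; last exact: smooth_differentiable fS Dt.
apply: le_trans (lincomb_norm (C := K) _ _) _ => [i|].
  exact: le_trans (tK i) (iK i).
by rewrite ler_wpM2r// /C; lra.
Unshelve. all: by end_near. Qed.

Lemma is_derive_translate V W (f : V -> W) (x c v : V) df :
  is_derive (x + c) v f df -> is_derive x v (fun y => f (y + c)) df.
Proof.
move=> [D E].
have H : (fun u : R => u^-1 *: (f (u *: v + x + c) - f (x + c)))
       = (fun u : R => u^-1 *: (f (u *: v + (x + c)) - f (x + c))).
  by rewrite funeqE => u; rewrite addrA.
by apply: DeriveDef; rewrite /derivable /derive ?H// -E.
Qed.

Lemma mvt_line V (f : V -> R) (x h : V) (s : R) :
  0 <= s -> (forall t, 0 <= t <= s -> derivable f (x + t *: h) h) ->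
  exists2 c, 0 <= c <= s & f (x + s *: h) - f x = s * 'D_h f (x + c *: h).
Proof.
move=> s0 fd.
have dl t : 0 <= t <= s ->
    is_derive t 1 (fun t => f (x + t *: h)) ('D_h f (x + t *: h)).
  by move=> ts; apply: is_derive_line; apply: DeriveDef => //; exact: fd.
have [||c + E] := @MVT_segment R (fun t => f (x + t *: h))
  (fun t => 'D_h f (x + t *: h)) 0 s s0.
- by move=> t; rewrite in_itv/= => /andP[? ?]; apply: dl; rewrite !ltW.
- apply: derivable_within_continuous => t; rewrite in_itv/= => /dl.
  by case.
rewrite in_itv/= => cs; exists c => //; move: E.
by rewrite scale0r addr0 subr0 mulrC.
Qed.

(** Both mixed derivatives are limits of the same second difference quotient
    of [f] at [x]. *)
Lemma second_difference V (D : set V) (f : V -> R) (x u v : V) (e : R) :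
  open D -> D x -> Ck 2 D f -> 0 < e ->
  exists2 s0 : R, 0 < s0 & forall s : R, 0 < s < s0 ->
    `|f (x + s *: u + s *: v) - f (x + s *: u) - (f (x + s *: v) - f x)
      - s ^+ 2 * 'D_v ('D_u f) x| <= s ^+ 2 * e.
Proof.
move=> oD Dx [fd fC] e0; have [fud fuC] := fC u.
have : \forall y \near x, D y /\ `|'D_v ('D_u f) x - 'D_v ('D_u f) y| < e.
  apply: filterI; first exact: open_nbhs_nbhs.
  by move/cvgrPdist_lt : (fuC v x Dx); apply.
move=> /nbhs_dist[r r0 rP].
have q0 : 0 < `|u| + `|v| + 1 by rewrite ltr_wpDl.
have near_x (s a b : R) : 0 < s < r / (`|u| + `|v| + 1) -> 0 <= a <= s ->
    0 <= b <= s -> `|x + a *: u + b *: v - x| < r.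
  move=> /andP[s0 sr] /andP[a0 a_s] /andP[b0 b_s].
  rewrite -(addrA x) (addrC x) addrK (le_lt_trans (ler_normD _ _))// !normrZ.
  rewrite !ger0_norm//; move: sr; rewrite ltr_pdivlMr// => sr.
  have := normr_ge0 u; have := normr_ge0 v.
  have : a * `|u| <= s * `|u| by rewrite ler_wpM2r.
  have : b * `|v| <= s * `|v| by rewrite ler_wpM2r.
  lra.
exists (r / (`|u| + `|v| + 1)) => [|s sr]; first by rewrite divr_gt0.
have s0 : 0 <= s by case/andP : sr => /ltW.
have ss : 0 <= s <= s by rewrite s0 lexx.
have zs : 0 <= (0 : R) <= s by rewrite s0 lexx.
have Dxab (a b : R) : 0 <= a <= s -> 0 <= b <= s -> D (x + a *: u + b *: v).
  by move=> ? ?; have [] := rP _ (near_x s a b sr _ _).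
have du (a b : R) : 0 <= a <= s -> 0 <= b <= s ->
    is_derive (x + a *: u + b *: v) u f ('D_u f (x + a *: u + b *: v)).
  by move=> ? ?; apply: derivable_of_diff; apply: fd; exact: Dxab.
pose F y := f (y + s *: v) - f y.
have dF (a : R) : 0 <= a <= s -> is_derive (x + a *: u) u F
    ('D_u f (x + a *: u + s *: v) - 'D_u f (x + a *: u)).
  move=> a_s; apply: is_deriveB; first by apply: is_derive_translate; exact: du.
  by have := du a 0 a_s zs; rewrite scale0r addr0.
have [a a_s Ea] := mvt_line s0 (fun t ts => let: DeriveDef D _ := dF t ts in D).
have [|b b_s Eb] := @mvt_line _ ('D_u f) (x + a *: u) v s s0.
  by move=> t ts; apply: diff_derivable; apply: fud; exact: Dxab.
rewrite [X in `|X - _|](_ : _ = s ^+ 2 * 'D_v ('D_u f) (x + a *: u + b *: v)).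
  rewrite -mulrBr normrM ger0_norm ?sqr_ge0// ler_wpM2l ?sqr_ge0//.
  have [_] := rP _ (near_x s a b sr a_s b_s).
  by move=> h; apply: ltW; rewrite -[X in X < _]normrN opprB; exact: h.
have [_ EF] := dF a a_s; move: Ea; rewrite EF Eb mulrA -expr2 => <-.
by rewrite /F addrAC.
Qed.

Lemma schwarz V (D : set V) (f : V -> R) (x u v : V) :
  open D -> D x -> Ck 2 D f -> 'D_u ('D_v f) x = 'D_v ('D_u f) x.
Proof.
move=> oD Dx fC; apply/eqP; rewrite -subr_eq0 -normr_le0.
apply/ler_addgt0Pr => e e0; rewrite add0r.
have e2 : 0 < e / 2 by rewrite divr_gt0.
have [s1 s10 H1] := second_difference u v oD Dx fC e2.
have [s2 s20 H2] := second_difference v u oD Dx fC e2.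
pose s := Num.min s1 s2 / 2.
have m0 : 0 < Num.min s1 s2 by rewrite lt_min s10.
have s0 : 0 < s by rewrite divr_gt0.
have sm : s < Num.min s1 s2 by rewrite ltr_pdivrMr// ltr_pMr// ltr1n.
move: (sm); rewrite lt_min => /andP[ss1 ss2].
have := H1 s; rewrite s0 ss1 => /(_ isT) {}H1.
have := H2 s; rewrite s0 ss2 => /(_ isT) {}H2.
have ps : 0 < s ^+ 2 by rewrite exprn_gt0.
rewrite -(ler_pM2l ps) -[X in X * `|_|]gtr0_norm// -normrM.
rewrite [x + s *: v + s *: u]addrAC in H2.
suff key (q A B C E M N d : R) : `|A - B - (C - E) - q * M| <= q * (d / 2) ->
    `|A - C - (B - E) - q * N| <= q * (d / 2) -> `|q * (N - M)| <= q * d.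
  exact: key H1 H2.
clear; rewrite !ler_norml => /andP[? ?] /andP[? ?]; apply/andP; split; lra.
Qed.

Lemma schwarz_mx V a b (D : set V) (f : V -> 'M[R]_(a, b)) (x u v : V) :
  open D -> D x -> smooth_on D f -> 'D_u ('D_v f) x = 'D_v ('D_u f) x.
Proof.
move=> oD Dx fS; have fd := fS 1%N; have [f1 _] := fd.
have fent w1 w2 : 'D_w1 ('D_w2 f) x
    = \matrix_(i, j) 'D_w1 ('D_w2 (fun y => f y i j)) x.
  have [H _] := smooth_derive w2 fS 1%N.
  rewrite derive_mx; last by apply: diff_derivable; exact: H.
  apply/matrixP => i j; rewrite !mxE; apply: near_eq_derive.
  apply: filterS (open_nbhs_nbhs (conj oD Dx)) => y Dy.
  by rewrite derive_mx ?mxE//; apply: diff_derivable; exact: f1.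
apply: etrans (fent u v) (etrans _ (esym (fent v u))).
apply: eq_mx => i j.
exact: (schwarz _ _ oD Dx (Ck_entry i j oD (fS 2%N))).
Qed.

End MeanValue.

(** * Linear ordinary differential equations *)

Section LinearODE.
Variable R : realType.
Notation mu := (@lebesgue_measure R).

Lemma small_geometric (c e : R) : 0 <= c -> 0 < e -> exists K, c / 2 ^+ K <= e.
Proof.
move=> c0 e0; exists (Num.bound (c / e)).
rewrite ler_pdivrMr ?exprn_gt0// mulrC -ler_pdivrMr//.
apply: ltW; apply: lt_le_trans (archi_boundP _) _; first by rewrite divr_ge0// ltW.
by rewrite -natrX ler_nat ltnW// ltn_expl.
Qed.

Lemma geometric_le0 (x c : R) :
  0 <= c -> (forall K, x <= c / 2 ^+ K) -> x <= 0.
Proof.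
move=> c0 H; apply/ler_addgt0Pr => e e0; rewrite add0r.
by have [K] := small_geometric c0 e0; exact: le_trans.
Qed.

Lemma geometric_sum (c : R) K : 0 <= c -> \sum_(k < K) c / 2 ^+ k <= 2 * c.
Proof.
move=> c0; suff -> : \sum_(k < K) c / 2 ^+ k = 2 * c - 2 * c / 2 ^+ K.
  by rewrite lerBlDr lerDl divr_ge0 ?mulr_ge0// exprn_ge0.
elim: K => [|K IH]; first by rewrite big_ord0 expr0 divr1 subrr.
rewrite big_ord_recr /= IH exprS invfM; have := exprn_gt0 K (@ltr0n R 2).
by move: (2 ^+ K)^-1 => q _; field.
Qed.

(** The tail estimate holds entrywise, and each entry is a convergent series
    of reals. *)
Lemma geometric_limit a b (u : nat -> 'M[R]_(a, b)) c :
  0 <= c -> (forall k, `|u k| <= c / 2 ^+ k) ->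
  exists l, forall K, `|l - \sum_(k < K) u k| <= 2 * c / 2 ^+ K.
Proof.
move=> c0 uc.
have tail i j K L : `|\sum_(k < L) u (K + k)%N i j| <= 2 * c / 2 ^+ K.
  apply: le_trans (ler_norm_sum _ _ _) _.
  apply: (@le_trans _ _ (\sum_(k < L) (c / 2 ^+ K) / 2 ^+ k)).
    apply: ler_sum => k _; apply: le_trans (entry_norm_le _ _ _) _.
    by apply: le_trans (uc _) _; rewrite exprD invfM mulrA.
  by rewrite -mulrA geometric_sum// divr_ge0// exprn_ge0.
have cv i j : cvgn (series (fun k => u k i j)).
  apply: (@normed_cvg R R^o).
  apply: (series_le_cvg (v_ := geometric c 2^-1)) => [n|n|n|].
  - exact: normr_ge0.
  - by rewrite /= mulr_ge0// exprn_ge0// invr_ge0.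
  - by rewrite /= exprVn; apply: le_trans (entry_norm_le _ _ _) (uc n).
  apply: is_cvg_geometric_series.
  by rewrite ger0_norm ?invr_ge0// invf_lt1 ?ltr1n.
exists (\matrix_(i, j) limn (series (fun k => u k i j))) => K.
apply: mx_norm_le => [|i j].
  by rewrite divr_ge0 ?mulr_ge0// exprn_ge0.
apply/ler_addgt0Pr => e e0.
have : \forall L \near \oo, `|limn (series (fun k => u k i j)) -
    series (fun k => u k i j) L| < e.
  by have /cvgrPdist_lt := cv i j; apply.
move=> [L0 _ /(_ (K + L0)%N (leq_addl _ _))] /= HL.
rewrite !mxE summxE.
move: HL; rewrite seriesEord /= big_split_ord /= => HL.
suff key (l S T q d : R) : `|T| <= q -> `|l - (S + T)| < d -> `|l - S| <= q + d.
  exact: key (tail i j K L0) HL.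
clear=> Tq lS; have -> : l - S = T + (l - (S + T)) by ring.
by rewrite (le_trans (ler_normD _ _))// lerD// ltW.
Qed.

Lemma norm_dist3 a b (x y u v : 'M[R]_(a, b)) :
  `|x - y| <= `|x - u| + `|u - v| + `|y - v|.
Proof.
have -> : x - y = (x - u) + (u - v) - (y - v) by rewrite subrKA opprB subrKA.
by rewrite (le_trans (ler_normB _ _))// lerD2r ler_normD.
Qed.

Lemma primitive (f : R -> R) : continuous f ->
  exists2 F : R -> R, F 0 = 0 & forall t : R, -2 < t < 3 -> is_derive t 1 F (f t).
Proof.
move=> fc; pose G x := (\int[mu]_(t in `[(-2), x]) f t)%R.
exists (fun x => G x - G 0) => [|t /andP[t2 t3]]; first by rewrite subrr.
have fi : mu.-integrable `[(-2), 3] (EFin \o f).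
  apply: continuous_compact_integrable; first exact: segment_compact.
  exact: continuous_subspaceT.
have [|dG EG] := @continuous_FTC1 R f (BLeft (-2)) t 3 t3 fi _ (fc t).
  by rewrite /= lte_fin.
rewrite -EG derive1E -[X in is_derive _ _ _ X]subr0.
by apply: is_deriveB; apply: DeriveDef.
Qed.

Lemma primitive_mx a b (f : R -> 'M[R]_(a, b)) : continuous f ->
  exists2 F : R -> 'M[R]_(a, b), F 0 = 0 &
    forall t : R, -2 < t < 3 -> is_derive t 1 F (f t).
Proof.
move=> fc.
have H (ij : 'I_a * 'I_b) : exists F : R -> R, F 0 = 0 /\
    forall t : R, -2 < t < 3 -> is_derive t 1 F (f t ij.1 ij.2).
  have [|F F0 FE] := @primitive (fun t => f t ij.1 ij.2); last by exists F.
  move=> t; apply: (@continuous_comp _ _ _ f (fun N : 'M[R]_(a, b) => N ij.1 ij.2)).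
    exact: fc.
  exact: coord_continuous.
have [F FE] := choice H.
exists (fun t => \matrix_(i, j) F (i, j) t) => [|t t23].
  by apply/matrixP => i j; rewrite !mxE; have [] := FE (i, j).
apply/is_derive_mxP => i j; rewrite (_ : (fun y => _) = F (i, j)).
  by have [_] := FE (i, j); exact.
by rewrite funeqE => y; rewrite mxE.
Qed.

Lemma mean_value_dist a b (f df : R -> 'M[R]_(a, b)) (s t C : R) :
  (forall x : R, Num.min s t <= x <= Num.max s t -> is_derive x 1 f (df x)) ->
  (forall x : R, Num.min s t <= x <= Num.max s t -> `|df x| <= C) ->
  `|f t - f s| <= C * `|t - s|.
Proof.
have [st|ts] := leP s t => fd dC.
  by rewrite [`|t - s|]ger0_norm ?subr_ge0//; exact: mean_value fd dC.
rewrite distrC [`|t - s|]distrC [`|s - t|]ger0_norm; last by rewrite subr_ge0 ltW.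
exact: mean_value (ltW ts) fd dC.
Qed.

Definition clamp (t : R) : R := Num.max (-1) (Num.min t 2).

Lemma clamp_itv t : -1 <= clamp t <= 2.
Proof.
rewrite /clamp le_max lexx/= ge_max (le_trans (lerN10 R))//=.
by rewrite ge_min lexx orbT.
Qed.

Lemma clamp_id t : -1 <= t <= 2 -> clamp t = t.
Proof. by move=> /andP[t1 t2]; rewrite /clamp min_l// max_r. Qed.

Lemma clamp_continuous : continuous clamp.
Proof.
move=> t; apply: (@continuous_max _ R (fun=> -1) (fun t => Num.min t 2)).
  exact: cst_continuous.
by apply: (@continuous_min _ R id (fun=> 2)); [exact: cvg_id|exact: cst_continuous].
Qed.

(** Picard iteration on [-1, 2], so that [0, 1] is interior: the distance to
    time [0] is at most [2], so each term of the Picard series is at most half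
    the preceding one. Clamping the time makes the integrands continuous on
    the whole line, where they have primitives. *)
Lemma linear_ode N p (A : R -> 'M[R]_N) (y0 : 'M[R]_(N, p)) :
  continuous A -> (forall t : R, N%:R * `|A t| <= 4^-1) ->
  exists2 Y : R -> 'M[R]_(N, p), Y 0 = y0 &
    forall t : R, 0 <= t <= 1 -> is_derive t 1 Y (A t *m Y t).
Proof.
move=> Ac Asmall.
have exP (f : R -> 'M[R]_(N, p)) : exists F : R -> 'M[R]_(N, p), continuous f ->
    F 0 = 0 /\ forall t : R, -2 < t < 3 -> is_derive t 1 F (f t).
  have [fc|] := pselect (continuous f); last by move=> nf; exists f.
  by have [F F0 FE] := primitive_mx fc; exists F.
have [P PE] := choice exP.
have step_bound (t : R) (M : 'M[R]_(N, p)) : `|A t *m M| <= 4^-1 * `|M|.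
  by apply: le_trans (mulmx_norm_le _ _) _; rewrite ler_wpM2r.
have itv_open (t : R) : -1 <= t <= 2 -> -2 < t < 3.
  by move=> /andP[? ?]; apply/andP; split; lra.
have itv_conv (s t x : R) : -1 <= s <= 2 -> -1 <= t <= 2 ->
    Num.min s t <= x <= Num.max s t -> -1 <= x <= 2.
  by case: (leP s t) => _ /andP[? ?] /andP[? ?] /andP[? ?]; apply/andP; split; lra.
have z12 : -1 <= (0 : R) <= 2 by apply/andP; split; lra.
pose I12 := [set t : R | -1 <= t <= 2].
have step_cont (f : R -> 'M[R]_(N, p)) : (forall t : R, I12 t -> {for t, continuous f}) ->
    continuous (fun t => A t *m f (clamp t)).
  move=> fg t; apply: (@Ck_mulmx R 0 _ _ _ _ setT A (fun t => f (clamp t))) => //.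
  + exact: openT.
  + by move=> s _; exact: Ac.
  move=> s _; apply: (@continuous_comp _ _ _ clamp f); first exact: clamp_continuous.
  by apply: fg; exact: clamp_itv.
pose E := fix E k := if k is k'.+1 then P (fun t => A t *m E k' (clamp t)) else cst y0.
have der_cont (f : R -> 'M[R]_(N, p)) df (t : R) : is_derive t 1 f df -> {for t, continuous f}.
  by move=> [fd _]; apply: differentiable_continuous; apply/derivable1_diffP.
have Ec k (t : R) : I12 t -> {for t, continuous (E k)}.
  elim: k t => [|k IH] t It; first exact: cst_continuous.
  have [_ H] := PE _ (step_cont (E k) IH); exact: der_cont (H t (itv_open t It)).
have Ed k (t : R) : -2 < t < 3 -> is_derive t 1 (E k.+1) (A t *m E k (clamp t)).
  by have [_ H] := PE _ (step_cont (E k) (Ec k)); exact: H.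
have E0 k : E k.+1 0 = 0 by have [H _] := PE _ (step_cont (E k) (Ec k)).
pose c := `|y0|; have c0 : 0 <= c by exact: normr_ge0.
have size_le (t : R) : -1 <= t <= 2 -> `|t| <= 2.
  by move=> /andP[? ?]; rewrite ler_norml; apply/andP; split; lra.
have Eb k (t : R) : I12 t -> `|E k t| <= c / 2 ^+ k.
  elim: k t => [|k IH] t It; first by rewrite expr0 divr1.
  rewrite -[E k.+1 t]subr0 -(E0 k).
  apply: le_trans (mean_value_dist (f := E k.+1)
    (df := fun x => A x *m E k (clamp x)) (C := 4^-1 * (c / 2 ^+ k)) _ _) _ => [x|x|].
  - by move=> /(itv_conv _ _ _ z12 It)/itv_open; exact: Ed.
  - move=> _; apply: le_trans (step_bound _ _) _; rewrite ler_wpM2l//.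
    by apply: IH; exact: clamp_itv.
  rewrite subr0 exprS invfM.
  have := size_le _ It.
  have : 0 <= c / 2 ^+ k by rewrite divr_ge0// exprn_ge0.
  rewrite (mulrCA c); move: (c / 2 ^+ k) `|t| => q u; clear; nra.
have exY (t : R) : exists l, I12 t ->
    forall K, `|l - \sum_(k < K) E k t| <= 2 * c / 2 ^+ K.
  have [It|] := pselect (I12 t); last by exists 0.
  by have [l lE] := geometric_limit c0 (fun k => Eb k t It); exists l.
have [Y YE] := choice exY.
have Sb K (t : R) : I12 t -> `|\sum_(k < K) E k t| <= 2 * c.
  move=> It; apply: le_trans (ler_norm_sum _ _ _) _.
  apply: le_trans (geometric_sum K c0).
  by apply: ler_sum => k _; exact: Eb.
have Sd K (t : R) : -2 < t < 3 -> is_derive t 1 (fun t => \sum_(k < K.+1) E k t)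
    (A t *m \sum_(k < K) E k (clamp t)).
  move=> t23; rewrite (_ : A t *m _ =
      \sum_(k < K.+1) if unlift ord0 k is Some k' then A t *m E k' (clamp t) else 0).
    apply: is_derive_bigsum => k; case: unliftP => [j|] ->; first exact: Ed.
    exact: is_derive_cst.
  rewrite big_ord_recl unlift_none add0r mulmx_sumr.
  by apply: eq_bigr => k _; rewrite liftK.
have Ylip (t s : R) : I12 t -> I12 s -> `|Y t - Y s| <= 4^-1 * (2 * c) * `|t - s|.
  move=> It Is; rewrite -subr_le0; apply: (@geometric_le0 _ (2 * c)) => [|K].
    by rewrite mulr_ge0.
  have := YE t It K.+1; have := YE s Is K.+1.
  have : `|\sum_(k < K.+1) E k t - \sum_(k < K.+1) E k s|
      <= 4^-1 * (2 * c) * `|t - s|.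
    apply: (mean_value_dist (f := fun t => \sum_(k < K.+1) E k t)
      (df := fun x => A x *m \sum_(k < K) E k (clamp x))) => x.
      by move=> /(itv_conv _ _ _ Is It)/itv_open; exact: Sd.
    move=> _; apply: le_trans (step_bound _ _) _; rewrite ler_wpM2l//.
    by apply: Sb; exact: clamp_itv.
  move: (\sum_(k < K.+1) E k t) (\sum_(k < K.+1) E k s) => a b.
  rewrite exprS invfM; move: (4^-1 * (2 * c) * `|t - s|) => L abL Yb Ya.
  have H := norm_dist3 (Y t) (Y s) a b; rewrite lerBlDr (le_trans H)//.
  move: `|Y t - a| `|Y s - b| `|a - b| Ya Yb abL; clear=> u v w.
  by move: (2 ^+ K)^-1 => q; lra.
have Yc : continuous (fun t => Y (clamp t)).
  move=> t; apply/cvgrPdist_lt => e e0; pose L := 4^-1 * (2 * c).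
  have L0 : 0 < L + 1 by rewrite ltr_wpDl// !mulr_ge0.
  have : \forall s \near t, `|clamp t - clamp s| < e / (L + 1).
    by move/cvgrPdist_lt : (@clamp_continuous t); apply; rewrite divr_gt0.
  apply: filterS => s; rewrite ltr_pdivlMr// => sL.
  apply: le_lt_trans (Ylip _ _ (clamp_itv t) (clamp_itv s)) _.
  apply: le_lt_trans sL; rewrite mulrC ler_wpM2l//.
  by rewrite lerDl.
pose B t := A t *m Y (clamp t).
have Bc : continuous B.
  move=> t; apply: (@Ck_mulmx R 0 _ _ _ _ setT A (fun t => Y (clamp t))) => //.
  - exact: openT.
  - by move=> s _; exact: Ac.
  - by move=> s _; exact: Yc.
have [PB0 PBd] := PE _ Bc.
pose Z t := y0 + P B t.
have Zd (t : R) : -2 < t < 3 -> is_derive t 1 Z (B t).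
  move=> /PBd Bd; rewrite -[B t]add0r.
  exact: (is_deriveD (is_derive_cst y0 t 1) Bd).
have YZ (t : R) : I12 t -> Y t = Z t.
  move=> It; apply/eqP; rewrite -subr_eq0 -normr_le0.
  apply: (@geometric_le0 _ (2 * c)) => [|K]; first by rewrite mulr_ge0.
  have H1 := YE t It K.+1.
  pose f t := \sum_(k < K.+1) E k t - Z t.
  have f0 : f 0 = 0.
    rewrite /f big_ord_recl big1 => [|k _]; last exact: E0.
    by rewrite addr0 /Z PB0 addr0 subrr.
  have H2 : `|f t - f 0| <= 4^-1 * (2 * c / 2 ^+ K) * `|t - 0|.
    apply: (mean_value_dist (f := f)
      (df := fun x => A x *m (\sum_(k < K) E k (clamp x) - Y (clamp x)))) => x.
      move=> /(itv_conv _ _ _ z12 It)/itv_open xt; rewrite mulmxBr.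
      by apply: is_deriveB; [exact: Sd|exact: Zd].
    move=> _; apply: le_trans (step_bound _ _) _; rewrite ler_wpM2l//.
    by rewrite -normrN opprB; apply: YE; exact: clamp_itv.
  have H3 := norm_dist3 (Y t) (Z t) (\sum_(k < K.+1) E k t) (Z t).
  apply: le_trans H3 _; rewrite subrr normr0 addr0.
  move: H2; rewrite f0 !subr0 /f; have := size_le t It; move: H1.
  rewrite exprS invfM.
  have : 0 <= c / 2 ^+ K by rewrite divr_ge0// exprn_ge0.
  move: `|Y t - _| `|_ - Z t| `|t| => u v w; clear.
  have -> : 2 * c * (2^-1 * (2 ^+ K)^-1) = c / 2 ^+ K.
    by rewrite mulrA [2 * c]mulrC mulfK.
  rewrite -!(mulrA 2 c); move: (c / 2 ^+ K) => q; nra.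
exists Z => [|t /andP[t0 t1]]; first by rewrite /Z PB0 addr0.
have It : I12 t by apply/andP; split; lra.
rewrite -(YZ t It) -[in Y t](clamp_id It); apply: Zd.
exact: itv_open.
Qed.

End LinearODE.

(** * Linear total differential systems *)

Section Frobenius.
Variable R : realType.

Lemma lincombB m (W : normedModType R) (T T' : 'I_m -> W) h :
  lincomb T h - lincomb T' h = lincomb (fun i => T i - T' i) h.
Proof. by rewrite /lincomb -sumrB; apply: eq_bigr => i _; rewrite scalerBr. Qed.

Lemma lincombD m (W : normedModType R) (T T' : 'I_m -> W) h :
  lincomb T h + lincomb T' h = lincomb (fun i => T i + T' i) h.
Proof. by rewrite /lincomb -big_split; apply: eq_bigr => i _; rewrite scalerDr. Qed.

Lemma lincomb0 m (W : normedModType R) h : lincomb (fun _ : 'I_m => 0 : W) h = 0.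
Proof. by rewrite /lincomb big1// => i _; rewrite scaler0. Qed.

Lemma lincomb_mulmxl m a b c (T : 'I_m -> 'M[R]_(a, b)) (M : 'M[R]_(b, c)) h :
  lincomb T h *m M = lincomb (fun i => T i *m M) h.
Proof.
by rewrite /lincomb mulmx_suml; apply: eq_bigr => i _; rewrite scalemxAl.
Qed.

Lemma lincomb_mulmxr m a b c (T : 'I_m -> 'M[R]_(b, c)) (M : 'M[R]_(a, b)) h :
  M *m lincomb T h = lincomb (fun i => M *m T i) h.
Proof.
by rewrite /lincomb mulmx_sumr; apply: eq_bigr => i _; rewrite scalemxAr.
Qed.

Lemma eq_lincomb m (W : normedModType R) (T T' : 'I_m -> W) h :
  (forall i, T i = T' i) -> lincomb T h = lincomb T' h.
Proof. by move=> E; apply: eq_bigr => i _; rewrite E. Qed.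

Lemma lincomb_exchange m n (W : normedModType R) (F : 'I_m -> 'I_n -> W) u v :
  lincomb (fun i => lincomb (F i) u) v =
  lincomb (fun j => lincomb (F^~ j) v) u.
Proof.
rewrite /lincomb (eq_bigr _ (fun i _ => scaler_sumr _ _ _ _)) exchange_big.
apply: eq_bigr => j _; rewrite scaler_sumr; apply: eq_bigr => i _.
by rewrite !scalerA mulrC.
Qed.

Lemma is_derive_lincomb m (V W : normedModType R) (T : 'I_m -> V -> W) h (x v : V) dT :
  (forall i, is_derive x v (T i) (dT i)) ->
  is_derive x v (fun y => lincomb (T^~ y) h) (lincomb dT h).
Proof.
move=> H; apply: is_derive_bigsum => i.
rewrite (_ : (fun y => h 0 i *: T i y) = h 0 i \*: T i)//.
exact: is_deriveZ.
Qed.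

Lemma finite_lipschitz (I : finType) m a b (D : set 'rV[R]_m)
    (f : I -> 'rV[R]_m -> 'M[R]_(a, b)) (x0 : 'rV[R]_m) :
  open D -> D x0 -> (forall i, smooth_on D (f i)) ->
  exists r C, [/\ 0 < r, 0 <= C, forall x, `|x - x0| < r -> D x,
    forall i x, `|x - x0| < r -> `|f i x| <= C &
    forall i x y, `|x - x0| < r -> `|y - x0| < r -> `|f i y - f i x| <= C * `|y - x|].
Proof.
move=> oD Dx0 fS.
have [r0 r00 r0D] : exists2 r : R, 0 < r & forall y, `|y - x0| < r -> D y.
  by apply: nbhs_dist; exact: open_nbhs_nbhs.
have H i : exists rC : R * R, [/\ 0 < rC.1, 0 <= rC.2,
    forall x, `|x - x0| < rC.1 -> `|f i x| <= rC.2 &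
    forall x y, `|x - x0| < rC.1 -> `|y - x0| < rC.1 ->
      `|f i y - f i x| <= rC.2 * `|y - x|].
  by have [r [C [? ? ? ? ?]]] := smooth_lipschitz oD Dx0 (fS i); exists (r, C).
have [rC HrC] := choice H.
pose r := \big[Num.min/r0]_i (rC i).1; pose C := \sum_i (rC i).2.
have ri i x : `|x - x0| < r -> `|x - x0| < (rC i).1.
  by move=> /lt_le_trans; apply; exact: bigmin_le.
have Ci i : (rC i).2 <= C.
  rewrite /C (bigD1 i)//= lerDl sumr_ge0// => j _.
  by have [] := HrC j.
exists r, C; split.
- by apply/bigmin_gtP; split=> // i _; have [] := HrC i.
- by apply: sumr_ge0 => i _; have [] := HrC i.
- by move=> x xr; apply: r0D; apply: lt_le_trans xr _; exact: bigmin_le_id.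
- by move=> i x /(ri i) xr; have [_ _ /(_ x xr)/le_trans + _] := HrC i; apply.
move=> i x y /(ri i) xr /(ri i) yr.
have [_ _ _ /(_ x y xr yr)/le_trans] := HrC i; apply.
by rewrite ler_wpM2r.
Qed.

Lemma quarter_bound (a q : R) :
  0 <= q -> 0 <= a -> q * (4 * (a + 1)) <= 1 -> a * q <= 4^-1.
Proof. by nra. Qed.

Lemma quarter_split (a b c : R) :
  0 <= b -> a <= b + c -> 4^-1 * a <= 2^-1 * b + 4^-1 * c.
Proof. by lra. Qed.

Lemma quarter_sum (b c : R) : 0 <= c -> b <= 2 * (4^-1 * c) -> b + c <= 2 * c.
Proof. by lra. Qed.

Lemma second_order_bound (K u k h : R) : 0 <= K -> 0 <= u -> u <= k ->
  0 <= h -> h <= 1 -> K * u ^+ 2 * h + K * u * k <= 2 * K * k ^+ 2.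
Proof.
move=> K0 u0 uk h0 h1; have k0 := le_trans u0 uk.
have H1 : u ^+ 2 * h <= k ^+ 2.
  by rewrite -[leRHS]mulr1 ler_pM ?exprn_ge0// lerXn2r.
have H2 : u * k <= k ^+ 2 by rewrite expr2 ler_wpM2r.
rewrite -!mulrA -mulrDr [2 * _]mulrCA ler_wpM2l// mulr_natl mulr2n.
by rewrite lerD// mulrA -expr2.
Qed.

Lemma first_order_bound (K u k h : R) : 0 <= K -> 0 <= u -> u <= k ->
  0 <= h -> h <= 1 -> K * u * h + K * k <= 2 * K * k.
Proof.
move=> K0 u0 uk h0 h1; rewrite -!mulrA -mulrDr [2 * _]mulrCA ler_wpM2l//.
by rewrite mulr_natl mulr2n lerD2r -[leRHS]mulr1 ler_pM.
Qed.

Variables (m N : nat) (D : set 'rV[R]_m) (B : 'I_m -> 'rV[R]_m -> 'M[R]_N).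

Definition oneform (x h : 'rV[R]_m) : 'M[R]_N := lincomb (B^~ x) h.

Definition doneform (x u v : 'rV[R]_m) : 'M[R]_N :=
  lincomb (fun i => lincomb (fun j => pd j (B i) x) u) v.

Hypothesis oD : open D.
Hypothesis BS : forall i, smooth_on D (B i).

Lemma is_derive_oneform x u v : D x ->
  is_derive x u (fun y => oneform y v) (doneform x u v).
Proof.
move=> Dx; apply: is_derive_lincomb => i.
have Bd := smooth_differentiable (BS i) Dx.
by rewrite -derivE_pd//; exact: derivable_of_diff.
Qed.

Lemma oneform_bounds x0 : D x0 -> exists r K, [/\ 0 < r, 0 <= K,
  (forall x, `|x - x0| < r -> D x),
  (forall x h, `|x - x0| < r -> `|oneform x h| <= K * `|h|) &
  (forall x y, `|x - x0| < r -> `|y - x0| < r ->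
    (forall h, `|oneform y h - oneform x h| <= K * `|y - x| * `|h|) /\
    (forall u v, `|doneform y u v - doneform x u v| <=
       K * `|y - x| * `|u| * `|v|))].
Proof.
move=> Dx0.
have [r1 [C1 [r10 C10 r1D B1 L1]]] := finite_lipschitz oD Dx0 BS.
have [r2 [C2 [r20 C20 _ _ L2]]] := finite_lipschitz
  (f := fun ij : 'I_m * 'I_m => pd ij.1 (B ij.2)) oD Dx0
  (fun ij => smooth_derive (delta_mx 0 ij.1) (BS ij.2)).
have m0 : 0 <= m%:R :> R by [].
exists (Num.min r1 r2), (m%:R * C1 + m%:R * (m%:R * C2)).
have K0 : 0 <= m%:R * C1 by rewrite mulr_ge0.
have K1 : 0 <= m%:R * (m%:R * C2) by rewrite !mulr_ge0.
split; first by rewrite lt_min r10.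
- by rewrite addr_ge0.
- by move=> x; rewrite lt_min => /andP[/r1D].
- move=> x h; rewrite lt_min => /andP[xr _].
  apply: le_trans (lincomb_norm (C := C1) _ _) _ => [i|]; first exact: B1.
  by rewrite ler_wpM2r// lerDl.
move=> x y; rewrite !lt_min => /andP[xr1 xr2] /andP[yr1 yr2]; split=> [h|u v].
  rewrite /oneform lincombB.
  apply: le_trans (lincomb_norm (C := C1 * `|y - x|) _ _) _ => [i|]; first exact: L1.
  by rewrite ler_wpM2r// mulrA ler_wpM2r// lerDl.
rewrite /doneform lincombB.
apply: le_trans (lincomb_norm (C := m%:R * (C2 * `|y - x|) * `|u|) _ _) _ => [i|].
  rewrite lincombB; apply: lincomb_norm => j.
  exact: (L2 (j, i)).
rewrite ler_wpM2r// !mulrA ler_wpM2r// ler_wpM2r//.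
by rewrite -!mulrA lerDr.
Qed.

Hypothesis flat : forall x u v, D x ->
  doneform x u v - doneform x v u + oneform x v *m oneform x u
    - oneform x u *m oneform x v = 0.

Lemma flat_oneform x u v : D x ->
  doneform x u v = doneform x v u - oneform x v *m oneform x u
    + oneform x u *m oneform x v.
Proof.
move=> Dx; have := flat u v Dx.
move: (doneform x u v) (doneform x v u) (oneform x v *m _) (oneform x u *m _).
by move=> a b c d /matrixP E; apply/matrixP => i j; have := E i j; rewrite !mxE; lra.
Qed.

Lemma oneform_taylor r K x0 : 0 <= K ->
  (forall x, `|x - x0| < r -> D x) ->
  (forall x y, `|x - x0| < r -> `|y - x0| < r -> forall u v,
     `|doneform y u v - doneform x u v| <= K * `|y - x| * `|u| * `|v|) ->
  forall x u v, `|x - x0| < r -> `|x + u - x0| < r ->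
  `|oneform (x + u) v - oneform x v - doneform x u v| <= K * `|u| ^+ 2 * `|v|.
Proof.
move=> K0 rD DL x u v xr yr.
pose f (s : R) := oneform (x + s *: u) v - s *: doneform x u v.
have seg (s : R) : 0 <= s <= 1 -> `|x + s *: u - x0| < r.
  by move=> s01; exact: segment_dist.
have fd (s : R) : 0 <= s <= 1 ->
    is_derive s 1 f (doneform (x + s *: u) u v - doneform x u v).
  move=> s01; apply: is_deriveB.
    apply: (is_derive_line (f := fun y => oneform y v)).
    by apply: is_derive_oneform; apply: rD; exact: seg.
  rewrite -[X in is_derive _ _ _ X]addr0 -[X in X + 0]scale1r -(scaler0 _ s).
  exact: (is_derive_scale (is_derive_id s 1) (is_derive_cst (doneform x u v) s 1)).
suff H : `|f 1 - f 0| <= K * `|u| ^+ 2 * `|v| * (1 - 0).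
  move: H; rewrite /f !scale1r !scale0r addr0 subr0 [_ - _ - oneform x v]addrAC.
  by rewrite subr0 mulr1.
apply: mean_value ler01 fd _ => s s01.
apply: le_trans (DL _ _ xr (seg s s01) u v) _.
rewrite addrAC subrr add0r normrZ expr2 !mulrA ler_wpM2r// ler_wpM2r//.
move/andP : s01 => [s0 s1]; rewrite ger0_norm// -mulrA ler_wpM2l//.
by rewrite ler_piMl.
Qed.

(** The left side is the derivative of [delta] in [frobenius_local]; on the
    right it is a linear function of [delta], the first bracket, up to terms
    that [oneform_taylor] makes small. *)
Lemma ray_difference p (a1 a bk dkh : 'M[R]_N) (Y1 Y : 'M[R]_(N, p)) (t : R) :
  a1 *m Y1 - a *m Y - ((1 *: bk + t *: (dkh - bk *m a + a *m bk)) *m Y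
    + (t *: bk) *m (a *m Y)) =
  a1 *m (Y1 - Y - (t *: bk) *m Y) + (a1 - a - bk - t *: dkh) *m Y
    + (t *: ((a1 - a) *m bk)) *m Y.
Proof.
rewrite !(mulmxBr, mulmxBl, mulmxDl, mulmxDr) -!(scalemxAl, scalemxAr) -?mulmxA.
rewrite !(mulmxBr, mulmxBl, mulmxDl, mulmxDr) -!mulmxA.
move: (a1 *m Y1) (a1 *m Y) (a *m Y) (bk *m Y) (a1 *m (bk *m Y)) (a *m (bk *m Y)).
move: (bk *m (a *m Y)) (dkh *m Y) => u0 u1 u2 u3 u4 u5 u6 u7.
by apply/matrixP => i j; rewrite !mxE; ring.
Qed.

(** Solve the equation along the rays issued from [x0]. For two neighbouring
    rays, ending at [x] and [x + k], the difference [delta] between the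
    solution on the second ray and the first order prediction of the system
    satisfies, by flatness, a linear equation up to terms of size [|k|^2];
    [gronwall] then says that the end value is differentiable and has the
    prescribed differential. *)
Lemma frobenius_local p x0 (U0 : 'M[R]_(N, p)) : D x0 ->
  exists (r : R) U, [/\ 0 < r, forall x, `|x - x0| < r -> D x, U x0 = U0 &
    forall x, `|x - x0| < r -> differentiable U x /\
      forall v, 'D_v U x = oneform x v *m U x].
Proof.
move=> Dx0; have [r0 [K [r00 K0 r0D Bb BL]]] := oneform_bounds Dx0.
pose nn : R := N%:R; have nn0 : 0 <= nn by [].
(* Clamped times reach 2, whence r0 / 2; the last bound is the smallness
   that linear_ode asks for. *)
pose r := Num.min (r0 / 2) (Num.min 1 (4 * (nn * K + 1))^-1).
have q0 : 0 < 4 * (nn * K + 1) by rewrite mulr_gt0// ltr_wpDl// mulr_ge0.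
have r_gt0 : 0 < r by rewrite !lt_min ltr01 divr_gt0//= invr_gt0.
have rr0 : r <= r0 / 2 by rewrite ge_min lexx.
have r1 : r <= 1 by rewrite !ge_min lexx orbT.
have rq : nn * (K * r) <= 4^-1.
  rewrite mulrA; apply: quarter_bound; [exact: ltW|exact: mulr_ge0|].
  by rewrite -ler_pdivlMr// mul1r !ge_min lexx !orbT.
have ray x (t : R) : `|x - x0| < r -> `|t| <= 2 -> `|x0 + t *: (x - x0) - x0| < r0.
  move=> xr t2; rewrite addrAC subrr add0r normrZ.
  apply: (@le_lt_trans _ _ (2 * `|x - x0|)); first by rewrite ler_wpM2r.
  by rewrite mulrC -ltr_pdivlMr//; exact: lt_le_trans rr0.
have ray1 x (t : R) : `|x - x0| < r -> 0 <= t <= 1 ->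
    `|x0 + t *: (x - x0) - x0| < r.
  by move=> xr t01; apply: segment_dist => //; rewrite ?subrr ?normr0// addrCA subrr addr0.
have rD x : `|x - x0| < r -> D x.
  by move=> xr; apply: r0D; apply: lt_trans xr _; rewrite (le_lt_trans rr0)// ltr_pdivrMr// ltr_pMr// ltr1n.
have b01 (t : R) : 0 <= t <= 1 -> `|t| <= 1.
  by move=> /andP[? ?]; rewrite ger0_norm.
have small x h : `|x - x0| < r0 -> `|h| < r -> nn * `|oneform x h| <= 4^-1.
  move=> xr hr; apply: le_trans rq; rewrite ler_wpM2l//.
  by apply: le_trans (Bb x h xr) _; rewrite ler_wpM2l// ltW.
have exY x : exists Y : R -> 'M[R]_(N, p), `|x - x0| < r -> Y 0 = U0 /\
    forall t : R, 0 <= t <= 1 ->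
      is_derive t 1 Y (oneform (x0 + t *: (x - x0)) (x - x0) *m Y t).
  have [xr|] := pselect (`|x - x0| < r); last by exists (fun=> U0).
  pose A t := oneform (x0 + clamp t *: (x - x0)) (x - x0).
  have c2 (t : R) : `|clamp t| <= 2.
    have := clamp_itv t; rewrite ler_norml => /andP[? ?].
    by apply/andP; split; lra.
  have [||Y Y0 Yd] := @linear_ode R N p A U0.
  - move=> t; apply: (@continuous_comp _ _ _ (fun t => x0 + clamp t *: (x - x0))
      (fun y => oneform y (x - x0))).
      apply: cvgD; first exact: cvg_cst.
      by apply: cvgZr_tmp; exact: clamp_continuous.
    have Dc := r0D _ (ray x _ xr (c2 t)).
    apply: (@Ck_sum R 0 _ _ D _ _ (fun i y => (x - x0) 0 i *: B i y)) => // i _.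
    exact: (Ck_scale oD (Ck_cst 0 D ((x - x0) 0 i)) (BS i 0%N)).
  - by move=> t; apply: small => //; exact: ray.
  exists Y => _; split=> // t t01; have := Yd t t01.
  by rewrite /A clamp_id//; case/andP: t01 => *; apply/andP; split; lra.
have [Y YE] := choice exY.
pose U x := Y x 1.
have Ybound x (t : R) : `|x - x0| < r -> 0 <= t <= 1 -> `|Y x t| <= 2 * `|U0|.
  move=> xr t01; have [Y0 Yd] := YE x xr.
  have := @gronwall R N p (fun t => Y x t - U0)
    (fun t => oneform (x0 + t *: (x - x0)) (x - x0) *m Y x t) (4^-1 * `|U0|).
  rewrite Y0 subrr => /(_ _ erefl) H.
  have {}H : `|Y x t - U0| <= 2 * (4^-1 * `|U0|).
    apply: H => // s s01.
      rewrite -[X in is_derive _ _ _ X]subr0.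
      exact: (is_deriveB (Yd s s01) (is_derive_cst U0 s 1)).
    have s2 : `|s| <= 2 by rewrite (le_trans (b01 s s01))// ler1n.
    apply: le_trans (mulmx_norm_le _ _) _.
    apply: (@le_trans _ _ (4^-1 * `|Y x s|)).
      by rewrite ler_wpM2r//; apply: small => //; exact: ray.
    have : `|Y x s| <= `|Y x s - U0| + `|U0| by rewrite -[X in `|X|](subrK U0) ler_normD.
    by apply: quarter_split; exact: normr_ge0.
  have : `|Y x t| <= `|Y x t - U0| + `|U0| by rewrite -[X in `|X|](subrK U0) ler_normD.
  by move/le_trans; apply; exact: quarter_sum.
pose Q := nn * (2 * K) * (2 * `|U0|) + nn * (nn * (2 * K * K)) * (2 * `|U0|).
have key x k : `|x - x0| < r -> `|x + k - x0| < r ->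
    `|U (x + k) - U x - oneform x k *m U x| <= 2 * (Q * `|k| ^+ 2).
  move=> xr xkr; pose h := x - x0.
  have hk : x + k - x0 = h + k by rewrite /h addrAC.
  have [Y0 Yd] := YE x xr; have [Y10 Y1d] := YE (x + k) xkr.
  pose c (t : R) := x0 + t *: h; pose q (t : R) := x0 + t *: (x + k - x0).
  have qE t : q t = c t + t *: k by rewrite /q /c hk scalerDr addrA.
  pose bk (t : R) := oneform (c t) k.
  pose delta (t : R) := Y (x + k) t - Y x t - (t *: bk t) *m Y x t.
  have cr (t : R) : 0 <= t <= 1 -> `|c t - x0| < r by exact: ray1.
  have qr (t : R) : 0 <= t <= 1 -> `|q t - x0| < r by exact: ray1.
  have rr0' y : `|y - x0| < r -> `|y - x0| < r0.
    move=> yr; apply: lt_trans yr _; rewrite (le_lt_trans rr0)//.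
    by rewrite ltr_pdivrMr// ltr_pMr// ltr1n.
  pose a1 t := oneform (q t) (x + k - x0); pose a t := oneform (c t) h.
  pose rest t := (a1 t - a t - bk t - t *: doneform (c t) k h) *m Y x t
    + (t *: ((a1 t - a t) *m bk t)) *m Y x t.
  have dd (t : R) : 0 <= t <= 1 -> is_derive t 1 delta (a1 t *m delta t + rest t).
    move=> t01; have Dc := rD _ (cr t t01).
    rewrite /rest addrA -ray_difference -flat_oneform//.
    apply: is_deriveB; first by apply: is_deriveB; [exact: Y1d|exact: Yd].
    apply: is_derive_mulmx; last exact: Yd.
    apply: (is_derive_scale (is_derive_id t 1)).
    apply: (is_derive_line (f := fun y => oneform y k)).
    exact: is_derive_oneform.
  have delta0 : delta 0 = 0.
    by rewrite /delta Y0 Y10 subrr scale0r mul0mx subr0.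
  have delta1 : delta 1 = U (x + k) - U x - oneform x k *m U x.
    by rewrite /delta scale1r /bk /c scale1r /h addrCA subrr addr0.
  rewrite -delta1; apply: (gronwall dd) => // [t t01|]; last by rewrite ler01 lexx.
  have [cr0 qr0] := (rr0' _ (cr t t01), rr0' _ (qr t t01)).
  have k0 := normr_ge0 k; have h1 : `|h| <= 1 by apply: ltW; apply: lt_le_trans r1.
  have [_ t1] := andP t01; have t0 : 0 <= t by case/andP : t01.
  have tk : `|t *: k| <= `|k| by rewrite normrZ ger0_norm// ler_piMl.
  have qc : q t - c t = t *: k by rewrite qE addrAC subrr add0r.
  have [L1 L2] := BL (c t) (q t) cr0 qr0.
  have a1E : a1 t = oneform (q t) h + oneform (q t) k by rewrite /a1 hk /oneform linearD.
  have Yb := Ybound x t xr t01.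
  have B1 : `|a1 t - a t - bk t - t *: doneform (c t) k h| <= 2 * K * `|k| ^+ 2.
    have -> : a1 t - a t - bk t - t *: doneform (c t) k h =
        (oneform (q t) h - oneform (c t) h - doneform (c t) (t *: k) h)
        + (oneform (q t) k - oneform (c t) k).
      have -> : doneform (c t) (t *: k) h = t *: doneform (c t) k h.
        rewrite /doneform /lincomb scaler_sumr; apply: eq_bigr => i _.
        by rewrite -/(lincomb _ (t *: k)) linearZ /= scalerA mulrC -scalerA.
      rewrite a1E /a /bk; move: (oneform _ _) (oneform _ _) (oneform _ _) (oneform _ _).
      by move=> u1 u2 u3 u4; move: (t *: _) => u5; apply/matrixP => i j; rewrite !mxE; ring.
    apply: le_trans (ler_normD _ _) _.
    have T1 : `|oneform (q t) h - oneform (c t) h - doneform (c t) (t *: k) h|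
        <= K * `|t *: k| ^+ 2 * `|h|.
      rewrite qE; apply: (oneform_taylor K0 r0D) => //; last by rewrite -qE.
      by move=> y z yr zr; have [_] := BL y z yr zr.
    have T2 : `|oneform (q t) k - oneform (c t) k| <= K * `|t *: k| * `|k|.
      by rewrite -qc.
    apply: le_trans (lerD T1 T2) _; apply: second_order_bound => //.
  have B2 : `|a1 t - a t| <= 2 * K * `|k|.
    rewrite a1E addrAC (le_trans (ler_normD _ _))//.
    apply: le_trans (lerD (L1 h) (Bb _ k qr0)) _; rewrite qc.
    exact: first_order_bound.
  have B3 : `|bk t| <= K * `|k| by exact: Bb.
  have half : 4^-1 <= 2^-1 :> R by rewrite lef_pV2 ?posrE// ler_nat.
  apply: le_trans (ler_normD _ _) _; apply: lerD.
    apply: le_trans (mulmx_norm_le _ _) _; rewrite ler_wpM2r//.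
    by apply: le_trans half; apply: small.
  rewrite /rest /Q mulrDl; apply: le_trans (ler_normD _ _) _; apply: lerD.
    apply: le_trans (mulmx_norm_le _ _) _.
    rewrite -(mulrA nn) -(mulrA nn) [_ * _ * `|k| ^+ 2]mulrAC -(mulrA nn).
    rewrite ler_wpM2l// ler_pM//.
  apply: le_trans (mulmx_norm_le _ _) _.
  rewrite -(mulrA nn) -(mulrA nn) [_ * _ * `|k| ^+ 2]mulrAC -(mulrA nn).
  rewrite ler_wpM2l// ler_pM// normrZ.
  apply: (@le_trans _ _ `|(a1 t - a t) *m bk t|).
    by rewrite ger0_norm// ler_piMl.
  apply: le_trans (mulmx_norm_le _ _) _.
  rewrite -!(mulrA nn) ler_wpM2l// expr2.
  by rewrite mulrACA ler_pM.
exists r, U; split=> //.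
  have x0r : `|x0 - x0| < r by rewrite subrr normr0.
  have [Y0 Yd] := YE x0 x0r.
  rewrite /U -Y0; apply/eqP; rewrite -subr_eq0 -normr_le0.
  suff : `|Y x0 1 - Y x0 0| <= 0 * (1 - 0) by rewrite mul0r.
  apply: mean_value ler01 Yd _ => t t01.
  by rewrite subrr /oneform linear0 mul0mx normr0.
move=> x xr.
have Q0 : 0 <= Q by rewrite addr_ge0// !mulr_ge0.
have [|UD UE] := @differentiable_lincomb R m _ U (fun i => B i x *m U x) x.
  move=> e e0; pose d := Num.min (r - `|x - x0|) (e / (2 * Q + 1)).
  have Q1 : 0 < 2 * Q + 1 by rewrite ltr_wpDl// mulr_ge0.
  have d0 : 0 < d by rewrite lt_min subr_gt0 xr divr_gt0.
  apply: (dist_nbhs d0) => k; rewrite subr0 lt_min => /andP[kr ke].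
  have xkr : `|x + k - x0| < r.
    rewrite addrAC (le_lt_trans (ler_normD _ _))//.
    by move: kr; rewrite ltrBrDl.
  rewrite [k + x]addrC -lincomb_mulmxl; apply: le_trans (key x k xr xkr) _.
  rewrite expr2 !mulrA ler_wpM2r// (le_trans _ (_ : (2 * Q + 1) * `|k| <= e))//.
    by rewrite ler_wpM2r// lerDl.
  by rewrite mulrC -ler_pdivlMr//; exact: ltW.
by split=> // v; rewrite UE -lincomb_mulmxl.
Qed.

Lemma Ck_oneform k v : Ck k D (fun x => oneform x v).
Proof.
apply: Ck_sum => // i _.
exact: (Ck_scale oD (Ck_cst k D (v 0 i)) (BS i k)).
Qed.

Lemma frobenius p x0 (U0 : 'M[R]_(N, p)) : D x0 ->
  exists (r : R) U, [/\ 0 < r, forall x, `|x - x0| < r -> D x, U x0 = U0,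
    smooth_on [set x | `|x - x0| < r] U &
    forall x v, `|x - x0| < r -> 'D_v U x = oneform x v *m U x].
Proof.
move=> Dx0; have [r [U [r0 rD UE Ud]]] := frobenius_local U0 Dx0.
exists r, U; split=> //; last by move=> x v /Ud[].
apply: (smooth_bootstrap (Phi := fun v x => oneform x v *m U x)).
- exact: open_dist.
- by move=> x /Ud[].
- by move=> v x /Ud[_]; exact.
move=> k UC v; apply: Ck_mulmx => //; first exact: open_dist.
by apply: Ck_sub (Ck_oneform k v) => x /rD.
Qed.

End Frobenius.

(** * The inverse function theorem *)

Section InverseFunction.
Variable R : realType.

Lemma differentiable_near m n (F : 'rV[R]_m -> 'rV[R]_n) (x : 'rV[R]_m) e :
  differentiable F x -> 0 < e ->
  exists2 d : R, 0 < d & forall h, `|h| < d ->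
    `|F (x + h) - F x - 'D_h F x| <= e * `|h|.
Proof.
move=> dF e0; have [C /eqaddoP/(_ e e0)/nbhs_dist[d d0 H]] := iffLR (diff_locallyP _ _) dF.
exists d => // h hd; rewrite deriveE//.
have := H h; rewrite subr0 => /(_ hd).
rewrite [X in `|X|](_ : _ = F (x + h) - F x - 'd F x h)//.
by rewrite /= !fctE opprD addrA [h + x]addrC.
Qed.

Section Local.
Variables (m : nat) (D : set 'rV[R]_m) (F : 'rV[R]_m -> 'rV[R]_m)
  (U : 'rV[R]_m -> 'M[R]_m) (x0 : 'rV[R]_m).
Hypotheses (oD : open D) (Dx0 : D x0).
Hypothesis Fd : forall x, D x -> differentiable F x.
Hypothesis FU : forall x v, D x -> 'D_v F x = v *m U x.
Hypothesis US : smooth_on D U.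
Hypothesis Uunit : forall x, D x -> U x \in unitmx.

Let L := invmx (U x0).
Let phi x := F x *m L - x.

Lemma near_contraction : exists r : R, [/\ 0 < r,
  forall x, `|x - x0| < r -> D x &
  forall x y, `|x - x0| < r -> `|y - x0| < r ->
    `|phi y - phi x| <= 2^-1 * `|y - x|].
Proof.
pose e : R := (2 * m.+1%:R)^-1; have e0 : 0 < e by rewrite invr_gt0 mulr_gt0.
have ULc : Ck 0 D (fun x => U x *m L).
  exact: (Ck_mulmx oD (US 0%N) (Ck_cst 0 D L)).
have : \forall x \near x0, D x /\ `|1%:M - U x *m L| < e.
  apply: filterI; first exact: open_nbhs_nbhs.
  move/cvgrPdist_lt : (ULc x0 Dx0) => /(_ e e0).
  by rewrite /L mulmxV; last exact: Uunit.
move=> /nbhs_dist[r r0 rP]; exists r; split=> // [x /rP[]//|x y xr yr].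
have E : y = x + (y - x) by rewrite addrCA subrr addr0.
have seg (t : R) : 0 <= t <= 1 -> `|x + t *: (y - x) - x0| < r.
  by move=> t01; apply: segment_dist => //; rewrite -E.
have phid z v : D z -> is_derive z v phi (v *m (U z *m L - 1%:M)).
  move=> Dz; rewrite mulmxBr mulmx1 mulmxA -FU//.
  apply: is_deriveB; rewrite -[X in is_derive _ _ _ X]addr0 -(mulmx0 _ (F z)).
  by apply: is_derive_mulmx; exact/derivable_of_diff/Fd.
rewrite {1}E; apply: mean_value_line => t /seg/rP[Dt Ut].
  by case: (phid _ (y - x) Dt).
case: (phid _ (y - x) Dt) => _ ->.
apply: le_trans (mulmx_norm_le _ _) _; rewrite mulrAC ler_wpM2r//.
have : `|U (x + t *: (y - x)) *m L - 1%:M| <= e by rewrite -normrN opprB ltW.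
move=> /(ler_wpM2l (ler0n R m))/le_trans; apply.
rewrite /e invfM mulrCA ler_piMr// ler_pdivrMr ?ltr0Sn// mul1r ler_nat.
exact: leqnSn.
Qed.

(** Newton's iteration with frozen derivative, [x |-> x - (F x - y) L], is a
    contraction near [x0]. *)
Lemma local_inverse : exists (r s c : R) G, [/\ 0 < r, 0 < s,
  forall x, `|x - x0| < r -> D x,
  (forall x y, `|x - x0| < r -> `|y - x0| < r -> `|y - x| <= c * `|F y - F x|) &
  forall y, `|y - F x0| < s -> `|G y - x0| < r /\ F (G y) = y].
Proof.
have [r [r0 rD phiC]] := near_contraction.
have LU : L \in unitmx by rewrite unitmx_inv Uunit.
pose c : R := 2 * (m%:R * `|L|).
have c0 : 0 <= c by rewrite !mulr_ge0.
have lip x y : `|x - x0| < r -> `|y - x0| < r -> `|y - x| <= c * `|F y - F x|.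
  move=> xr yr; have H := phiC x y xr yr.
  have B : `|(F y - F x) *m L| <= m%:R * `|L| * `|F y - F x|.
    by rewrite mulrAC; exact: mulmx_norm_le.
  have : `|y - x| <= `|(F y - F x) *m L| + `|phi y - phi x|.
    rewrite -[X in X <= _]normrN; rewrite opprB.
    have -> : x - y = - ((F y - F x) *m L) + (phi y - phi x).
      rewrite /phi mulmxBl; move: (F y *m L) (F x *m L) => a b.
      by apply/matrixP => i j; rewrite !mxE; ring.
    by rewrite (le_trans (ler_normD _ _))// normrN.
  rewrite /c -mulrA; move: `|_ *m L| `|y - x| `|phi y - phi x| H B.
  by move: (m%:R * `|L| * _) => u a b d; lra.
pose s := r / (4 * (c + 1)).
have s0 : 0 < s by rewrite divr_gt0// mulr_gt0// ltr_wpDl.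
have exG y : exists x, `|y - F x0| < s -> `|x - x0| < r /\ F x = y.
  have [ys|] := pselect (`|y - F x0| < s); last by exists 0.
  pose T x := y *m L - phi x.
  have TB a b : T a - T b = - (phi a - phi b).
    rewrite /T; move: (y *m L) (phi a) (phi b) => u v w.
    by apply/matrixP => i j; rewrite !mxE; ring.
  pose X k := iter k T x0.
  pose d := `|T x0 - x0|.
  have d0 : 0 <= d by exact: normr_ge0.
  have dr : 2 * d < r.
    have -> : d = `|(y - F x0) *m L|.
      by rewrite /d /T /phi mulmxBl opprB [_ + (x0 - _)]addrCA [x0 + _]addrC addrK.
    have B : `|(y - F x0) *m L| <= m%:R * `|y - F x0| * `|L| by exact: mulmx_norm_le.
    have : c * `|y - F x0| < r.
      have : c * `|y - F x0| <= (c + 1) * `|y - F x0| by rewrite ler_wpM2r// lerDl.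
      move=> /le_lt_trans; apply; rewrite mulrC -ltr_pdivlMr ?ltr_wpDl//.
      apply: lt_trans ys _; rewrite /s invfM mulrA ltr_pM2r ?invr_gt0 ?ltr_wpDl//.
      by rewrite gtr_pMr// invf_lt1// ltr1n.
    by apply: le_lt_trans; rewrite /c -mulrA ler_wpM2l// mulrAC.
  have Xb k : `|X k - x0| <= 2 * d - 2 * d / 2 ^+ k /\ `|X k.+1 - X k| <= d / 2 ^+ k.
    elim: k => [|k [IH1 IH2]].
      by rewrite expr0 !divr1 subrr normr0 subrr.
    have e1 : d / 2 ^+ k = 2 * (d / 2 ^+ k.+1).
      by rewrite exprS invfM; move: (2 ^+ k)^-1 => q; field.
    have p0 : 0 <= d / 2 ^+ k.+1 by rewrite divr_ge0// exprn_ge0.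
    have p1 : 0 <= d / 2 ^+ k by rewrite divr_ge0// exprn_ge0.
    have E : `|X k.+1 - x0| <= 2 * d - 2 * d / 2 ^+ k.+1.
      rewrite -(subrK (X k) (X k.+1)) -addrA (le_trans (ler_normD _ _))//.
      apply: le_trans (lerD IH2 IH1) _; rewrite -!mulrA e1.
      by move: (d / 2 ^+ k.+1) => q; lra.
    split=> //; have -> : X k.+2 - X k.+1 = - (phi (X k.+1) - phi (X k)) by exact: TB.
    rewrite normrN; apply: le_trans (phiC _ _ _ _) _.
    + apply: le_lt_trans IH1 _; apply: le_lt_trans dr.
      by rewrite gerBl -mulrA mulr_ge0.
    + apply: le_lt_trans E _; apply: le_lt_trans dr.
      by rewrite gerBl -mulrA mulr_ge0.
    by move: IH2; rewrite e1; move: (d / 2 ^+ k.+1) `|_ - _| => q a; lra.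
  have [l lE] := geometric_limit d0 (fun k => (Xb k).2).
  have {}lE k : `|x0 + l - X k| <= 2 * d / 2 ^+ k.
    have -> : x0 + l - X k = l - \sum_(j < k) (X j.+1 - X j); last exact: lE.
    rewrite -(big_mkord xpredT (fun j => X j.+1 - X j)) telescope_sumr//.
    by rewrite opprB addrCA addrA.
  have lr : `|x0 + l - x0| < r by have := lE 0%N; rewrite expr0 divr1 => /le_lt_trans; apply.
  exists (x0 + l) => _; split=> //.
  have Tl : T (x0 + l) = x0 + l.
    apply/eqP; rewrite -subr_eq0 -normr_le0.
    apply: (geometric_le0 (c := 2 * d)) => [|k]; first by rewrite mulr_ge0.
    have H := norm_dist3 (T (x0 + l)) (x0 + l) (X k.+1) (X k.+1).
    apply: le_trans H _; rewrite subrr normr0 addr0.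
    have kr : `|X k - x0| < r.
      apply: le_lt_trans (Xb k).1 _; apply: le_lt_trans dr.
      by rewrite gerBl -mulrA mulr_ge0// divr_ge0// exprn_ge0.
    have H1 : `|T (x0 + l) - X k.+1| <= 2^-1 * `|x0 + l - X k|.
      rewrite [X k.+1]/(T (X k)) -[X in X <= _]normrN opprB.
      have -> : T (X k) - T (x0 + l) = phi (x0 + l) - phi (X k).
        by rewrite TB opprB.
      exact: phiC.
    apply: le_trans (lerD H1 (lE k.+1)) _; have := lE k.
    rewrite exprS invfM -!(mulrA 2) (mulrCA d); move: (d / 2 ^+ k) `|_ - _| => q a; lra.
  have /(canRL (mulmxK LU)) : (y - F (x0 + l)) *m L = 0.
    move: Tl; rewrite /T /phi mulmxBl opprB addrCA; move: (_ - F _ *m L) => w.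
    by move/(canRL (addKr _)); rewrite addNr.
  by rewrite mul0mx => /eqP; rewrite subr_eq0 => /eqP.
have [G GE] := choice exG.
by exists r, s, c, G.
Qed.

Lemma inverse_function : exists (r s : R) G, [/\ 0 < r /\ 0 < s,
  forall x, `|x - x0| < r -> D x,
  (forall x y, `|x - x0| < r -> `|y - x0| < r -> F x = F y -> x = y),
  (forall y, `|y - F x0| < s -> `|G y - x0| < r /\ F (G y) = y) &
  smooth_on [set y | `|y - F x0| < s] G].
Proof.
have [r [s [c [G [r0 s0 rD lip GE]]]]] := local_inverse.
have c1 : 0 < `|c| + 1 by rewrite ltr_wpDl.
exists r, s, G; split=> // [x y xr yr Fxy|].
  apply/eqP; rewrite eq_sym -subr_eq0 -normr_le0; have := lip x y xr yr.
  by rewrite Fxy subrr normr0 mulr0.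
pose V := [set y | `|y - F x0| < s].
have oV : open V by exact: open_dist.
have GD y : V y -> D (G y) by move=> /GE[/rD].
have Gd y : V y -> differentiable G y /\
    forall v, 'D_v G y = v *m invmx (U (G y)).
  move=> Vy; have [xr Fx] := GE y Vy; set x := G y in xr Fx *.
  have Dx := rD x xr.
  have mulE v : v *m invmx (U x) = lincomb (fun i => row i (invmx (U x))) v.
    by rewrite mulmx_sum_row.
  have [|Gd Gv] := @differentiable_lincomb R m _ G (fun i => row i (invmx (U x))) y.
    move=> e e0; pose b := m%:R * `|invmx (U x)|.
    have b0 : 0 <= b by rewrite mulr_ge0.
    have q0 : 0 < (b + 1) * (`|c| + 1) by rewrite mulr_gt0// ltr_wpDl.
    have [d d0 Hd] := differentiable_near (Fd Dx) (divr_gt0 e0 q0).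
    pose d' := Num.min (s - `|y - F x0|) (d / (`|c| + 1)).
    have d'0 : 0 < d' by rewrite lt_min subr_gt0 Vy divr_gt0.
    apply: (dist_nbhs d'0) => k; rewrite subr0 lt_min => /andP[ks kd].
    have Vyk : V (k + y).
      rewrite /V/= -addrA (le_lt_trans (ler_normD _ _))//.
      by rewrite -ltrBrDr.
    have [x'r Fx'] := GE _ Vyk; set x' := G (k + y) in x'r Fx' *.
    have hk : `|x' - x| <= (`|c| + 1) * `|k|.
      apply: le_trans (lip _ _ xr x'r) _; rewrite Fx' Fx addrK ler_wpM2r//.
      by rewrite (le_trans (ler_norm _))// lerDl.
    have hd : `|x' - x| < d.
      by apply: le_lt_trans hk _; rewrite mulrC -ltr_pdivlMr.
    have := Hd _ hd; rewrite FU// addrCA subrr addr0 Fx' Fx addrK => H.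
    rewrite -mulE.
    have -> : x' - x - k *m invmx (U x) = - ((k - (x' - x) *m U x) *m invmx (U x)).
      by rewrite mulmxBl -mulmxA mulmxV ?Uunit// mulmx1 opprB.
    rewrite normrN; apply: le_trans (mulmx_norm_le _ _) _; rewrite mulrAC -/b.
    apply: le_trans (ler_wpM2l b0 H) _.
    apply: le_trans (ler_wpM2l b0 (ler_wpM2l (ltW (divr_gt0 e0 q0)) hk)) _.
    rewrite !mulrA ler_wpM2r// invfM.
    rewrite mulrA divfK ?gt_eqF// ler_pdivrMr ?ltr_wpDl// mulrC.
    by rewrite ler_wpM2l ?(ltW e0)// lerDl.
  by split=> // v; rewrite Gv mulE.
apply: (@smooth_bootstrap _ _ _ _ _ (fun v y => v *m invmx (U (G y)))) => //.
- by move=> y /Gd[].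
- by move=> v y /Gd[_]; exact.
move=> k GC v; apply: Ck_mulmx => //; first exact: Ck_cst.
apply: (Ck_comp (D' := D) (h := fun x => invmx (U x))) => //.
by apply: Ck_invmx.
Qed.

End Local.
End InverseFunction.

(** * Algebraic curvature tensors annihilated by a null complex line *)

(** [th1] and [th2] are dual to a null vector [xi] and to [J xi], [gg] is the
    metric and [Rq X Y Z W = g (R (X, Y) Z, W)]. As [R] is parallel for
    [nabla - S], its covariant derivative is the algebraic action [dR] of [S]. *)
Section CurvatureAlgebra.
Variables (R : realFieldType) (V : lmodType R) (J : V -> V) (th1 th2 : V -> R)
  (gg : V -> V -> R) (xi : V) (Rq : V -> V -> V -> V -> R).

Let S X Y := gg X Y *: xi - th1 Y *: X - gg X (J Y) *: J xi - th2 Y *: J X.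
Let dR X Y Z W U := Rq (S X Y) Z W U + Rq Y (S X Z) W U + Rq Y Z (S X W) U
  + Rq Y Z W (S X U).
Definition omega X Y := th1 X * th2 Y - th2 X * th1 Y.

Hypothesis lin1 : forall a X X' Y Z W,
  Rq (a *: X + X') Y Z W = a * Rq X Y Z W + Rq X' Y Z W.
Hypothesis skew12 : forall X Y Z W, Rq X Y Z W = - Rq Y X Z W.
Hypothesis skew34 : forall X Y Z W, Rq X Y Z W = - Rq X Y W Z.
Hypothesis bianchi1 : forall X Y Z W, Rq X Y Z W + Rq Y Z X W + Rq Z X Y W = 0.
Hypothesis RJ : forall X Y Z W, Rq X Y (J Z) (J W) = Rq X Y Z W.
Hypothesis Rxi : forall X Y W, Rq X Y xi W = 0.
Hypothesis bianchi2 : forall X Y Z W U,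
  dR X Y Z W U + dR Y Z X W U + dR Z X Y W U = 0.
Hypothesis JJ : forall X, J (J X) = - X.
Hypothesis th1J : forall X, th1 (J X) = - th2 X.

Lemma pair_sym X Y Z W : Rq X Y Z W = Rq Z W X Y.
Proof.
have b1 := bianchi1 X Y Z W; have b2 := bianchi1 Y Z W X.
have b3 := bianchi1 Z W X Y; have b4 := bianchi1 W X Y Z.
have := (skew12 Y Z X W, skew34 Y Z X W, skew12 Z X Y W, skew34 Z X Y W).
have := (skew12 X Y Z W, skew34 X Y Z W, skew12 Z W X Y, skew34 Z W X Y).
have := (skew12 W X Y Z, skew34 W X Y Z, skew12 Y W X Z, skew34 Y W X Z).
have := (skew12 W X Z Y, skew34 Y W Z X, skew12 Z X W Y).
have := (skew12 X Y W Z, skew12 Z W Y X, skew12 W Y Z X, skew12 X Z W Y).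
have := (skew34 X Z W Y, skew34 W Y Z X, skew34 W Y X Z, skew34 X W Y Z).
move=> [[[? ?] ?] ?] [[[? ?] ?] ?] [[? ?] ?] [[[? ?] ?] ?] [[[? ?] ?] ?] [[[? ?] ?] ?].
lra.
Qed.

Lemma lin3 a X X' Y Z W : Rq Y Z (a *: X + X') W = a * Rq Y Z X W + Rq Y Z X' W.
Proof. by rewrite ![Rq Y Z _ _]pair_sym lin1. Qed.

Lemma lin4 a X X' Y Z W : Rq Y Z W (a *: X + X') = a * Rq Y Z W X + Rq Y Z W X'.
Proof. by rewrite !(skew34 Y Z W) lin3 opprD mulrN. Qed.

Lemma moveJ34 X Y Z W : Rq X Y (J Z) W = - Rq X Y Z (J W).
Proof.
have := RJ X Y Z (J W); rewrite JJ => <-.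
have := lin4 (-1) W 0 X Y (J Z); rewrite addr0 scaleN1r => ->.
have := lin4 (-1) 0 0 X Y (J Z); rewrite addr0 scaler0 => E.
by move: E; move: (Rq _ _ _ 0) (Rq _ _ _ W) => a b; lra.
Qed.

Lemma moveJ12 X Y Z W : Rq (J X) Y Z W = - Rq X (J Y) Z W.
Proof. by rewrite pair_sym moveJ34 pair_sym. Qed.

Lemma RJxi X Y W : Rq X Y (J xi) W = 0.
Proof. by rewrite moveJ34 Rxi oppr0. Qed.

Lemma SE X Y : S X Y = gg X Y *: xi
  + ((- th1 Y) *: X + ((- gg X (J Y)) *: J xi + ((- th2 Y) *: J X + 0))).
Proof. by rewrite /S !scaleNr addr0 !addrA. Qed.

Lemma Rq0 Y Z W : Rq 0 Y Z W = 0.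
Proof. by have := lin1 (-1) 0 0 Y Z W; rewrite scaler0 addr0; lra. Qed.

Lemma RS1 X Y Z W U :
  Rq (S X Y) Z W U = - th1 Y * Rq X Z W U - th2 Y * Rq (J X) Z W U.
Proof.
rewrite SE !lin1 Rq0 [Rq xi _ _ _]pair_sym [Rq (J xi) _ _ _]pair_sym.
rewrite [Rq W U xi Z]Rxi RJxi; lra.
Qed.

Lemma RS2 X Y Z W U :
  Rq Y (S X Z) W U = - th1 Z * Rq Y X W U - th2 Z * Rq Y (J X) W U.
Proof. by rewrite skew12 RS1 (skew12 X) (skew12 (J X)); lra. Qed.

Lemma RS3 X Y Z W U :
  Rq Y Z (S X W) U = - th1 W * Rq Y Z X U - th2 W * Rq Y Z (J X) U.
Proof. by rewrite pair_sym RS1 (pair_sym X) (pair_sym (J X)). Qed.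

Lemma RS4 X Y Z W U :
  Rq Y Z W (S X U) = - th1 U * Rq Y Z W X - th2 U * Rq Y Z W (J X).
Proof. by rewrite skew34 RS3 (skew34 Y Z X) (skew34 Y Z (J X)); lra. Qed.

(** In the second Bianchi identity the terms with [th1] or [th2] of the last
    two arguments cancel by the first Bianchi identity, and the remaining
    terms with [th2] cancel by invariance under [J]. *)
Lemma wedge_th1 X Y Z W U :
  th1 X * Rq Y Z W U + th1 Y * Rq Z X W U + th1 Z * Rq X Y W U = 0.
Proof.
have := bianchi2 X Y Z W U; rewrite /dR !RS1 !RS2 !RS3 !RS4 !moveJ12 !moveJ34.
have b1 V1 V2 : th1 V1 * (Rq X Y Z V2 + Rq Y Z X V2 + Rq Z X Y V2) = 0.
  by rewrite bianchi1 mulr0.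
have b2 V1 V2 : th2 V1 * (Rq X Y Z V2 + Rq Y Z X V2 + Rq Z X Y V2) = 0.
  by rewrite bianchi1 mulr0.
have := (b1 W U, b1 U W, b2 W (J U), b2 U (J W)).
rewrite !(skew34 _ _ W (J _)) !(moveJ34 _ _ _ W) !(skew34 _ _ W).
rewrite !(skew12 X (J Z)) !(skew12 Y (J X)) !(skew12 Z (J Y)) !moveJ12.
rewrite (skew12 X Z) (skew12 Y X) (skew12 Z Y).
move=> [[[? ?] ?] ?] ?; lra.
Qed.

(** [wedge_th1] with [X = E1] expresses [R] through [R (E1, _)], and invariance
    under [J] expresses [R (E1, _)] through [R (E1, J E1)]; the symmetry by
    pairs treats the other two arguments alike. *)
Lemma curvature_shape E1 : th1 E1 = 1 -> th2 E1 = 0 -> forall X Y Z W,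
  Rq X Y Z W = Rq E1 (J E1) E1 (J E1) * (omega X Y * omega Z W).
Proof.
move=> t1 t2.
have H1 Y Z W U : Rq Y Z W U = th1 Y * Rq E1 Z W U - th1 Z * Rq E1 Y W U.
  by have := wedge_th1 E1 Y Z W U; rewrite t1 (skew12 Z E1); lra.
have H2 Z W U : Rq E1 Z W U = th2 Z * Rq E1 (J E1) W U.
  have JJ12 : Rq (J E1) (J Z) W U = Rq E1 Z W U.
    by rewrite [LHS]pair_sym RJ pair_sym.
  by rewrite -JJ12 H1 !th1J t2 oppr0 mul0r sub0r mulNr opprK.
have H3 X Y W U : Rq X Y W U = omega X Y * Rq E1 (J E1) W U.
  by rewrite H1 (H2 X) (H2 Y) /omega; ring.
move=> X Y Z W; rewrite H3 [in LHS]pair_sym H3; ring.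
Qed.

End CurvatureAlgebra.

(** * Covariant derivatives *)

(* Expands both sides of an equation between matrix expressions and decides
   it by linear algebra, the products that remain being the unknowns. *)
Ltac mxlinear :=
  repeat first
    [ progress rewrite ?(mulmxDl, mulmxDr, mulNmx, mulmxN, mul0mx, mulmx0)
    | progress rewrite -?(scalemxAl, scalemxAr)
    | progress rewrite ?mulmxA ];
  repeat match goal with
  | |- context [@mulmx ?R ?m ?n ?p ?a ?b] => move: (@mulmx R m n p a b) => ?
  end;
  apply/matrixP => ? ?; rewrite !mxE; ring.

Section CovariantDerivative.
Variable R : realType.
Implicit Types V : normedModType R.

(** A matrix valued function is differentiated as a tensor, with connection
    matrix [L] for its row index and [M] for its column index; an index that
    is not a tensor index has connection matrix [0]. *)
Definition is_cov V a b (x v : V) (L : 'M[R]_a) (f : V -> 'M[R]_(a, b))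
    (M : 'M[R]_b) (d : 'M[R]_(a, b)) :=
  is_derive x v f (L *m f x - f x *m M + d).

Lemma cov_mul V a b c (x v : V) L (f : V -> 'M[R]_(a, b)) M d
    (h : V -> 'M[R]_(b, c)) P e :
  is_cov x v L f M d -> is_cov x v M h P e ->
  is_cov x v L (fun y => f y *m h y) P (d *m h x + f x *m e).
Proof.
move=> df dh; rewrite /is_cov.
rewrite [X in is_derive _ _ _ X](_ : _ = (L *m f x - f x *m M + d) *m h x
  + f x *m (M *m h x - h x *m P + e)); first exact: is_derive_mulmx.
mxlinear.
Qed.

Lemma cov_tr V a b (x v : V) L (f : V -> 'M[R]_(a, b)) M d :
  is_cov x v L f M d -> is_cov x v (- M^T) (fun y => (f y)^T) (- L^T) d^T.
Proof.
move=> df; rewrite /is_cov.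
rewrite [X in is_derive _ _ _ X](_ : _ = (L *m f x - f x *m M + d)^T).
  exact: is_derive_trmx.
rewrite raddfD raddfB /= !trmx_mul mulNmx mulmxN opprK.
by rewrite [- _ + (f x)^T *m _]addrC.
Qed.

Lemma cov_add V a b (x v : V) L (f h : V -> 'M[R]_(a, b)) M d e :
  is_cov x v L f M d -> is_cov x v L h M e ->
  is_cov x v L (fun y => f y + h y) M (d + e).
Proof.
move=> df dh; rewrite /is_cov.
rewrite [X in is_derive _ _ _ X](_ : _ = (L *m f x - f x *m M + d)
  + (L *m h x - h x *m M + e)); first exact: is_deriveD.
mxlinear.
Qed.

Lemma cov_opp V a b (x v : V) L (f : V -> 'M[R]_(a, b)) M d :
  is_cov x v L f M d -> is_cov x v L (fun y => - f y) M (- d).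
Proof.
move=> df; rewrite /is_cov.
rewrite [X in is_derive _ _ _ X](_ : _ = - (L *m f x - f x *m M + d)).
  exact: is_deriveN.
by rewrite mulNmx mulmxN !opprD opprK.
Qed.

Lemma cov_cst V a b (x v : V) L (X : 'M[R]_(a, b)) M :
  is_cov x v L (fun=> X) M (X *m M - L *m X).
Proof.
by rewrite /is_cov addrC subrKA subrr; exact: is_derive_cst.
Qed.

Lemma cov_unique V a b (x v : V) L (f : V -> 'M[R]_(a, b)) M d e :
  is_cov x v L f M d -> is_cov x v L f M e -> d = e.
Proof. by move=> df de; exact: addrI (is_derive_unique df de). Qed.

Lemma cov_change V a b (x v : V) L L' (f : V -> 'M[R]_(a, b)) M M' d :
  is_cov x v L f M d ->
  is_cov x v L' f M' (d + (L - L') *m f x - f x *m (M - M')).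
Proof.
move=> df; rewrite /is_cov.
rewrite [X in is_derive _ _ _ X](_ : _ = L *m f x - f x *m M + d)//.
mxlinear.
Qed.

(** A tensor [f] with [d f = L f - f M] has commuting second derivatives only
    if the curvatures of [L] and [M] act on it in the same way. *)
Lemma ricci m a b (D : set 'rV[R]_m) (f : 'rV[R]_m -> 'M[R]_(a, b))
    (L : 'rV[R]_m -> 'rV[R]_m -> 'M[R]_a) (M : 'rV[R]_m -> 'rV[R]_m -> 'M[R]_b)
    dL dM :
  open D -> smooth_on D f ->
  (forall x v, D x -> is_cov x v (L x v) f (M x v) 0) ->
  (forall x u v, D x -> is_derive x u (fun y => L y v) (dL x u v)) ->
  (forall x u v, D x -> is_derive x u (fun y => M y v) (dM x u v)) ->
  forall x u v, D x ->
  (dL x u v - dL x v u + L x v *m L x u - L x u *m L x v) *m f x =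
  f x *m (dM x u v - dM x v u + M x v *m M x u - M x u *m M x v).
Proof.
move=> oD fS fd Ld Md x u v Dx.
have second w z : is_derive x w ('D_z f)
    (dL x w z *m f x + L x z *m (L x w *m f x - f x *m M x w)
     - ((L x w *m f x - f x *m M x w) *m M x z + f x *m dM x w z)).
  have H : is_derive x w (fun y => L y z *m f y - f y *m M y z)
      (dL x w z *m f x + L x z *m (L x w *m f x - f x *m M x w)
     - ((L x w *m f x - f x *m M x w) *m M x z + f x *m dM x w z)).
    have fw : is_derive x w f (L x w *m f x - f x *m M x w).
      by have := fd x w Dx; rewrite /is_cov addr0.
    by apply: is_deriveB; apply: is_derive_mulmx => //; [exact: Ld|exact: Md].
  apply: near_eq_is_derive H.
  apply: filterS (open_nbhs_nbhs (conj oD Dx)) => y Dy.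
  by have [_ E] := fd y z Dy; apply: esym; apply: etrans E _; rewrite addr0.
have [_ E1] := second u v; have [_ E2] := second v u.
have := etrans (esym E1) (etrans (schwarz_mx u v oD Dx fS) E2).
move=> /eqP; rewrite -subr_eq0 => /eqP E; apply/eqP; rewrite -subr_eq0 -E; apply/eqP.
mxlinear.
Qed.

End CovariantDerivative.

(** * The Levi-Civita connection and the reductive connection in a chart *)

Section IndexToVector.
Variable R : realType.

Lemma is_derive_pd m (W : normedModType R) (f : 'rV[R]_m -> W) x v F :
  differentiable f x -> (forall i, pd i f x = F i) ->
  is_derive x v f (lincomb F v).
Proof.
move=> fd FE; rewrite -(eq_lincomb v FE) -derivE_pd//.
exact: derivable_of_diff.
Qed.

Lemma lincomb_trmx m a b (T : 'I_m -> 'M[R]_(a, b)) v :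
  (lincomb T v)^T = lincomb (fun i => (T i)^T) v.
Proof.
rewrite /lincomb raddf_sum; apply: eq_bigr => i _.
by apply/matrixP => p q; rewrite !mxE.
Qed.

Lemma lincomb_mul m (W : normedModType R) (T : 'I_m -> W) u (M : 'M[R]_m) :
  lincomb T (u *m M) = lincomb (fun j => \sum_l M j l *: T l) u.
Proof.
rewrite /lincomb; under eq_bigr do rewrite mxE scaler_suml.
rewrite exchange_big; apply: eq_bigr => j _; rewrite scaler_sumr.
by apply: eq_bigr => l _; rewrite scalerA.
Qed.

Lemma lincomb_entry_sum m n p (W : normedModType R) (T : 'I_m -> 'M[R]_(n, p))
    (Q : 'I_p -> W) v j :
  \sum_l lincomb T v j l *: Q l = lincomb (fun i => \sum_l T i j l *: Q l) v.
Proof.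
rewrite /lincomb; under eq_bigr do rewrite summxE scaler_suml.
rewrite exchange_big; apply: eq_bigr => i _; rewrite scaler_sumr.
by apply: eq_bigr => k _; rewrite mxE scalerA.
Qed.

(** Christoffel symbols symmetrize the derivatives of the metric; these two
    identities give metric compatibility and vanishing torsion. *)
Lemma koszul_sum (a a' b c : R) :
  a = a' -> a = 2^-1 * (a + b - c) + 2^-1 * (a' + c - b).
Proof. by move=> <-; lra. Qed.

Lemma koszul_swap (a b c c' : R) :
  c = c' -> 2^-1 * (a + b - c) = 2^-1 * (b + a - c').
Proof. by move=> <-; rewrite [a + b]addrC. Qed.

Lemma cov11_eq0 m (a b c : 'M[R]_m) : a + b - c = 0 -> a = c - b.
Proof. by move=> /eqP; rewrite subr_eq0 => /eqP <-; rewrite addrK. Qed.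

End IndexToVector.

Section Connections.
Variables (R : realType) (m : nat) (D : set 'rV[R]_m) (g J : mfield R m)
  (S : cfield R m).
Hypotheses (oD : open D) (kahler : pseudo_kahler_on D g J).
Hypothesis homog : homogeneous_structure_on D g J S.

Let gS : smooth_on D g. Proof. by case: kahler. Qed.
Let JS : smooth_on D J. Proof. by case: kahler. Qed.
Let gsym x : D x -> (g x)^T = g x.
Proof. by case: kahler => _ _ + _ _ => /[apply] -[]. Qed.
Let gunit x : D x -> g x \in unitmx.
Proof. by case: kahler => _ _ + _ _ => /[apply] -[]. Qed.
Let JJ x : D x -> J x *m J x = - 1%:M.
Proof. by case: kahler => _ _ _ + _ => /[apply] -[]. Qed.

Lemma bilE (G : 'M[R]_m) X Y : bil G X Y = (X *m G *m Y^T) 0 0.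
Proof. by []. Qed.

Lemma hermitian x : D x -> J x *m g x *m (J x)^T = g x.
Proof.
case: kahler => _ _ _ + _ => /[apply] -[_ H].
apply/matrixP => i j; have := H (delta_mx 0 i) (delta_mx 0 j).
rewrite /bil !trmx_mul !mulmxA -!(mulmxA (delta_mx 0 i)) -!rowE trmx_delta.
by rewrite -!colE !mxE.
Qed.

Lemma christoffel_smooth i : smooth_on D (fun x => christoffel g x i).
Proof.
move=> k; apply: Ck_mx => // p q; under eq_fun do rewrite mxE.
have pdS a b c : Ck k D (fun x => pd a g x b c).
  by apply: Ck_entry => //; exact: (smooth_derive (delta_mx 0 a) gS).
apply: Ck_sum => // l _; apply: CkM => //; last first.
  by apply: Ck_entry => //; apply: Ck_invmx.
apply: CkM => //; first exact: Ck_cst.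
apply: CkD => //; first exact: CkD.
by apply: (Ck_congr (f := fun x => -1 * pd l g x i p)) => //
  => [x _|]; [rewrite mulN1r|apply: CkM => //; exact: Ck_cst].
Qed.

Lemma pd_sym i x : D x -> (pd i g x)^T = pd i g x.
Proof.
move=> Dx; have dg := derivable_of_diff (delta_mx 0 i) (smooth_differentiable gS Dx).
have dgT := is_derive_trmx dg.
have : is_derive x (delta_mx 0 i) g (pd i g x)^T.
  apply: near_eq_is_derive dgT.
  by apply: filterS (open_nbhs_nbhs (conj oD Dx)) => y /gsym.
by move=> H; exact: is_derive_unique H dg.
Qed.

Lemma pd_symE i j l x : D x -> pd i g x j l = pd i g x l j.
Proof. by move=> Dx; rewrite -[in LHS](pd_sym i Dx) mxE. Qed.

Lemma christoffel_metric i x : D x ->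
  pd i g x = christoffel g x i *m g x + g x *m (christoffel g x i)^T.
Proof.
move=> Dx.
pose T := \matrix_(j, l) (2^-1 * (pd i g x j l + pd j g x i l - pd l g x i j)).
have AE : christoffel g x i = T *m invmx (g x).
  by apply/matrixP => j k; rewrite !mxE; apply: eq_bigr => l _; rewrite !mxE.
have AT : christoffel g x i *m g x = T by rewrite AE mulmxKV// gunit.
have -> : g x *m (christoffel g x i)^T = T^T.
  by rewrite -AT trmx_mul gsym.
rewrite AT; apply/matrixP => j l; rewrite !mxE.
exact: koszul_sum (pd_symE i j l Dx).
Qed.

Lemma christoffel_sym i j x : D x ->
  row j (christoffel g x i) = row i (christoffel g x j).
Proof.
move=> Dx; apply/rowP => k; rewrite !mxE; apply: eq_bigr => l _.
by congr (_ * _); exact: koszul_swap (pd_symE l i j Dx).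
Qed.

(** Connection matrices of [nabla] and of [nabla - S]: row [j] of their value
    at [x] and [v] is the derivative of [d_j] along [v]. *)
Definition levi_civita := oneform (fun i x => christoffel g x i).
Definition reductive := oneform (fun i x => christoffel g x i - S x i).

Lemma torsion_free x X Y : D x -> X *m levi_civita x Y = Y *m levi_civita x X.
Proof.
move=> Dx; rewrite /levi_civita /oneform !lincomb_mulmxr.
have E Z W : lincomb (fun i => Z *m christoffel g x i) W =
    lincomb (fun i => lincomb (fun j => row j (christoffel g x i)) Z) W.
  by apply: eq_lincomb => i; rewrite mulmx_sum_row.
rewrite !E lincomb_exchange; apply: eq_lincomb => j; apply: eq_lincomb => i.
exact: christoffel_sym.
Qed.

Lemma levi_civita_metric x v : D x ->
  is_cov x v (levi_civita x v) g (- (levi_civita x v)^T) 0.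
Proof.
move=> Dx; rewrite /is_cov addr0 mulmxN opprK /levi_civita /oneform.
rewrite lincomb_trmx lincomb_mulmxl lincomb_mulmxr lincombD.
apply: is_derive_pd; first exact: smooth_differentiable gS Dx.
by move=> i; exact: christoffel_metric.
Qed.

Lemma levi_civita_J x v : D x ->
  is_cov x v (levi_civita x v) J (levi_civita x v) 0.
Proof.
move=> Dx; rewrite /is_cov addr0 /levi_civita /oneform.
rewrite lincomb_mulmxl lincomb_mulmxr lincombB.
apply: is_derive_pd; first exact: smooth_differentiable JS Dx.
by move=> i; case: kahler => _ _ _ _ /(_ x Dx i) /cov11_eq0.
Qed.

Lemma reductive_metric x v : D x ->
  is_cov x v (reductive x v) g (- (reductive x v)^T) 0.
Proof.
move=> Dx; rewrite /is_cov addr0 mulmxN opprK /reductive /oneform.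
rewrite lincomb_trmx lincomb_mulmxl lincomb_mulmxr lincombD.
apply: is_derive_pd; first exact: smooth_differentiable gS Dx.
move=> i; case: homog => _ /(_ x Dx i) + _ _ _.
by rewrite /cov02 => /eqP; rewrite -addrA -opprD subr_eq0 => /eqP.
Qed.

Lemma reductive_J x v : D x ->
  is_cov x v (reductive x v) J (reductive x v) 0.
Proof.
move=> Dx; rewrite /is_cov addr0 /reductive /oneform.
rewrite lincomb_mulmxl lincomb_mulmxr lincombB.
apply: is_derive_pd; first exact: smooth_differentiable JS Dx.
by move=> i; case: homog => _ _ _ _ /(_ x Dx i) /cov11_eq0.
Qed.

Lemma reductive_S x v X : D x ->
  is_cov x v (reductive x v) (fun y => along (S y) X) (reductive x v)
    (along (S x) (X *m reductive x v)).
Proof.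
move=> Dx; case: homog => SS _ _ HS _; rewrite /is_cov.
rewrite [X in is_derive _ _ _ X](_ : _ = lincomb (fun j =>
    lincomb (fun i => (christoffel g x i - S x i) *m S x j
      - S x j *m (christoffel g x i - S x i)
      + \sum_k (christoffel g x i - S x i) j k *: S x k) v) X).
  apply: is_derive_lincomb => j; apply: is_derive_pd.
    exact: smooth_differentiable (SS j) Dx.
  move=> i; have := HS x Dx i j; rewrite /cov12.
  move: (pd _ _ _) (_ *m S x j) (S x j *m _) (\sum_k _) => a b c d /matrixP E.
  by apply/matrixP => p q; have := E p q; rewrite !mxE; lra.
rewrite /along -/(lincomb (S x) X) -/(lincomb (S x) (X *m _)).
rewrite (lincomb_mulmxl (S x)) (lincomb_mulmxr (S x)) lincombB lincomb_mul lincombD.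
apply: eq_lincomb => j; rewrite /reductive /oneform lincomb_mulmxl lincomb_mulmxr.
rewrite lincombB -[RHS]lincombD; congr (_ + _).
exact: lincomb_entry_sum.
Qed.

Definition riemann x u v :=
  lincomb (fun i => lincomb (fun j => curvature (christoffel g) x i j) v) u.

Let dlevi_civita := doneform (fun i x => christoffel g x i).

Lemma levi_civita_derive x u v : D x ->
  is_derive x u (fun y => levi_civita y v) (dlevi_civita x u v).
Proof. by move=> Dx; exact: (is_derive_oneform christoffel_smooth). Qed.

Lemma riemannE x u v : riemann x u v = dlevi_civita x u v - dlevi_civita x v u
  + levi_civita x v *m levi_civita x u - levi_civita x u *m levi_civita x v.
Proof.
rewrite /dlevi_civita /doneform (lincomb_exchange _ u v).
rewrite /levi_civita /oneform !lincomb_mulmxl.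
have -> : lincomb (fun j => christoffel g x j *m lincomb (christoffel g x) u) v =
    lincomb (fun i => lincomb (fun j => christoffel g x j *m christoffel g x i) v) u.
  by rewrite -lincomb_exchange; apply: eq_lincomb => j; rewrite lincomb_mulmxr.
under [X in _ - X]eq_lincomb do rewrite lincomb_mulmxr.
rewrite lincombB lincombD lincombB; apply: eq_lincomb => i.
by rewrite lincombB lincombD lincombB.
Qed.

Lemma riemann_linear x u u' v a :
  riemann x (a *: u + u') v = a *: riemann x u v + riemann x u' v.
Proof. by rewrite /riemann linearP. Qed.

Lemma riemann_metric x u v : D x ->
  riemann x u v *m g x = - (g x *m (riemann x u v)^T).
Proof.
move=> Dx.
have dT y w z : D y -> is_derive y w (fun y => - (levi_civita y z)^T)
    (- (dlevi_civita y w z)^T).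
  by move=> Dy; apply: is_deriveN; apply: is_derive_trmx; exact: levi_civita_derive.
have := ricci oD gS levi_civita_metric levi_civita_derive dT u v Dx.
rewrite -riemannE => ->; rewrite -[RHS]mulmxN riemannE; congr (_ *m _).
rewrite !mulNmx !mulmxN !opprK -!trmx_mul.
move: (dlevi_civita x u v) (dlevi_civita x v u) => a b.
move: (levi_civita x v *m levi_civita x u) (levi_civita x u *m levi_civita x v) => c d.
by apply/matrixP => i j; rewrite !mxE; ring.
Qed.

Lemma riemann_J x u v : D x -> riemann x u v *m J x = J x *m riemann x u v.
Proof.
move=> Dx; have := ricci oD JS levi_civita_J levi_civita_derive levi_civita_derive u v Dx.
by rewrite -riemannE.
Qed.

Lemma riemann_skew x u v : riemann x u v = - riemann x v u.
Proof.
rewrite !riemannE; move: (dlevi_civita x u v) (dlevi_civita x v u) => a b.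
by apply/matrixP => i j; rewrite !mxE; ring.
Qed.

Lemma dtorsion_free x u X Y : D x ->
  X *m dlevi_civita x u Y = Y *m dlevi_civita x u X.
Proof.
move=> Dx.
have H Z W : is_derive x u (fun y => Z *m levi_civita y W) (Z *m dlevi_civita x u W).
  have := is_derive_mulmx (is_derive_cst Z x u) (levi_civita_derive u W Dx).
  by rewrite mul0mx add0r.
apply: (is_derive_unique (H _ X Y)); apply: near_eq_is_derive (H _ Y X).
by apply: filterS (open_nbhs_nbhs (conj oD Dx)) => y Dy; exact: torsion_free.
Qed.

Lemma riemann_bianchi1 x u v w : D x ->
  w *m riemann x u v + u *m riemann x v w + v *m riemann x w u = 0.
Proof.
move=> Dx; rewrite !riemannE !(mulmxDr, mulmxN) !mulmxA.
rewrite (dtorsion_free v w u Dx) (dtorsion_free u w v Dx) (dtorsion_free w u v Dx).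
rewrite (torsion_free u v Dx) (torsion_free v w Dx) (torsion_free w u Dx).
mxlinear.
Qed.

Lemma curvature_smooth i j :
  smooth_on D (fun x => curvature (christoffel g) x i j).
Proof.
move=> k.
have dC a b : Ck k D (fun x => pd a (fun y => christoffel g y b) x).
  exact: (smooth_derive (delta_mx 0 a) (christoffel_smooth b)).
have C a : Ck k D (fun x => christoffel g x a) by exact: christoffel_smooth.
have CN (f : 'rV[R]_m -> 'M[R]_m) : Ck k D f -> Ck k D (fun x => - f x).
  move=> fC; apply: (Ck_congr (f := fun x => (-1) *: f x)) => // [x _|].
    by rewrite scaleN1r.
  by apply: Ck_scale => //; exact: Ck_cst.
apply: CkD => //; last by apply: CN; apply: Ck_mulmx.
apply: CkD => //; last by apply: Ck_mulmx.
by apply: CkD => //; apply: CN.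
Qed.

Lemma riemann_smooth u v : smooth_on D (fun x => riemann x u v).
Proof.
move=> k; apply: Ck_sum => // i _; apply: Ck_scale => //; first exact: Ck_cst.
apply: Ck_sum => // j _; apply: Ck_scale => //; first exact: Ck_cst.
exact: curvature_smooth.
Qed.

(** The second derivatives [dd] of the connection matrices are symmetric and
    cancel in the cyclic sum; what remains is algebra. *)
Lemma riemann_bianchi2 x u v w : D x ->
  let dR u v w := 'D_w (fun y => riemann y u v) x
    + riemann x u v *m levi_civita x w - levi_civita x w *m riemann x u v in
  dR u v w + dR v w u + dR w u v = 0.
Proof.
move=> Dx /=.
pose dd a b c := 'D_a ('D_b (fun y => levi_civita y c)) x.
have lcS c : smooth_on D (fun y => levi_civita y c).
  by move=> k; apply: Ck_oneform => //; exact: christoffel_smooth.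
have ddsym a b c : dd a b c = dd b a c.
  exact: (schwarz_mx a b oD Dx (lcS c)).
have dE a b c : is_derive x a (fun y => dlevi_civita y b c) (dd a b c).
  have := derivable_of_diff a (smooth_differentiable (smooth_derive b (lcS c)) Dx).
  apply: near_eq_is_derive.
  apply: filterS (open_nbhs_nbhs (conj oD Dx)) => y Dy.
  by have [_] := levi_civita_derive b c Dy.
have RE a b c : 'D_c (fun y => riemann y a b) x = dd c a b - dd c b a
   + (dlevi_civita x c b *m levi_civita x a + levi_civita x b *m dlevi_civita x c a)
   - (dlevi_civita x c a *m levi_civita x b + levi_civita x a *m dlevi_civita x c b).
  suff [] : is_derive x c (fun y => riemann y a b) (dd c a b - dd c b a
   + (dlevi_civita x c b *m levi_civita x a + levi_civita x b *m dlevi_civita x c a)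
   - (dlevi_civita x c a *m levi_civita x b + levi_civita x a *m dlevi_civita x c b)) by [].
  rewrite (_ : (fun y => riemann y a b) = fun y => dlevi_civita y a b - dlevi_civita y b a
    + levi_civita y b *m levi_civita y a - levi_civita y a *m levi_civita y b); last first.
    by rewrite funeqE => y; exact: riemannE.
  have P p q := is_derive_mulmx (levi_civita_derive c p Dx) (levi_civita_derive c q Dx).
  exact: (is_deriveB (is_deriveD (is_deriveB (dE c a b) (dE c b a)) (P b a)) (P a b)).
rewrite (RE u v w) (RE v w u) (RE w u v) !riemannE.
rewrite (ddsym w u v) (ddsym w v u) (ddsym v u w).
move: (dd u w v) (dd v w u) (dd u v w) => a b c.
mxlinear.
Qed.

Lemma reductive_riemann x u v w : D x ->
  is_cov x w (reductive x w) (fun y => riemann y u v) (reductive x w)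
    (riemann x (u *m reductive x w) v + riemann x u (v *m reductive x w)).
Proof.
move=> Dx; case: homog => _ _ HR _ _.
pose Q j k y := curvature (christoffel g) y j k.
have dQ j k : is_derive x w (Q j k) (reductive x w *m Q j k x
    - Q j k x *m reductive x w + (\sum_l reductive x w j l *: Q l k x
    + \sum_l reductive x w k l *: Q j l x)).
  rewrite !lincomb_entry_sum {1 2}/reductive /oneform.
  rewrite lincomb_mulmxl lincomb_mulmxr lincombB !lincombD.
  apply: is_derive_pd; first exact: smooth_differentiable (curvature_smooth j k) Dx.
  move=> i; have := HR x Dx i j k; rewrite /cov13 -/(Q j k).
  rewrite -/(Q j k x); move: (pd i _ x) (_ *m Q j k x) (Q j k x *m _) => a b c.
  move: (\sum_l _) (\sum_l _) => d e /matrixP E.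
  by apply/matrixP => p q; have := E p q; rewrite !mxE; lra.
rewrite /is_cov.
rewrite [X in is_derive _ _ _ X](_ : _ = lincomb (fun j => lincomb (fun k =>
    reductive x w *m Q j k x - Q j k x *m reductive x w
    + (\sum_l reductive x w j l *: Q l k x
    + \sum_l reductive x w k l *: Q j l x)) v) u).
  by apply: is_derive_lincomb => j; apply: is_derive_lincomb => k.
move: (reductive x w) => T; rewrite /riemann lincomb_mul.
rewrite (lincomb_mulmxr _ T) (lincomb_mulmxl _ T) lincombB !lincombD.
apply: eq_lincomb => j.
rewrite (lincomb_mulmxr _ T) (lincomb_mulmxl _ T) lincombB -[RHS]lincombD; congr (_ + _).
rewrite -[RHS]lincombD lincomb_mul; congr (_ + _).
rewrite /lincomb; under eq_bigr do rewrite scaler_sumr.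
rewrite exchange_big; apply: eq_bigr => k _; rewrite scaler_sumr.
by apply: eq_bigr => l _; rewrite !scalerA mulrC.
Qed.

End Connections.

(** * Strongly degenerate structures: the null line and the curvature *)

Section NullLine.
Variables (R : realType) (m : nat) (D : set 'rV[R]_m) (g J : mfield R m)
  (S : cfield R m) (xi zeta : vfield R m).
Hypotheses (oD : open D) (kahler : pseudo_kahler_on D g J).
Hypothesis homog : homogeneous_structure_on D g J S.
Hypothesis linear_type : linear_type_on D g J S xi zeta.
Hypothesis xi_smooth : smooth_on D xi.
Hypothesis xi_null : forall x, D x -> xi x != 0 /\ bil (g x) (xi x) (xi x) = 0.
Hypothesis zeta0 : forall x, D x -> zeta x = 0.

Let gS : smooth_on D g. Proof. by case: kahler. Qed.
Let JS : smooth_on D J. Proof. by case: kahler. Qed.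
Let gsym x : D x -> (g x)^T = g x.
Proof. by case: kahler => _ _ + _ _ => /[apply] -[]. Qed.
Let gunit x : D x -> g x \in unitmx.
Proof. by case: kahler => _ _ + _ _ => /[apply] -[]. Qed.
Let JJ x : D x -> J x *m J x = - 1%:M.
Proof. by case: kahler => _ _ _ + _ => /[apply] -[]. Qed.

Lemma mul_mx11 n (M : 'M[R]_1) (v : 'rV[R]_n) : M *m v = M 0 0 *: v.
Proof. by rewrite [M in LHS]mx11_scalar mul_scalar_mx. Qed.

Lemma trmx11 (M : 'M[R]_1) : M^T = M.
Proof. by rewrite [M]mx11_scalar tr_scalar_mx. Qed.

Lemma col_left_inverse (p : 'cV[R]_m) :
  p != 0 -> exists v : 'rV[R]_m, v *m p = 1%:M.
Proof.
move=> /cV0Pn[i pi0]; exists ((p i 0)^-1 *: delta_mx 0 i).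
rewrite -scalemxAl -rowE [LHS]mx11_scalar !mxE mulVf//.
Qed.

Lemma Jg x : D x -> J x *m g x = - (g x *m (J x)^T).
Proof.
move=> Dx; have := hermitian kahler Dx => E.
have : J x *m g x *m (J x)^T *m (J x)^T = g x *m (J x)^T by rewrite E.
by rewrite -mulmxA -trmx_mul JJ// raddfN /= trmx1 mulmxN mulmx1 => <-; rewrite opprK.
Qed.

(** The one-forms dual to [xi] and [J xi], as columns. *)
Definition theta1 x := g x *m (xi x)^T.
Definition theta2 x := g x *m (xi x *m J x)^T.

Lemma J_theta1 x : D x -> J x *m theta1 x = - theta2 x.
Proof. by move=> Dx; rewrite /theta1 /theta2 mulmxA Jg// trmx_mul mulmxA mulNmx. Qed.

Lemma J_theta2 x : D x -> J x *m theta2 x = theta1 x.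
Proof.
move=> Dx; have := J_theta1 Dx => /(congr1 (fun M => - (J x *m M))).
by rewrite mulmxN opprK mulmxA JJ// mulNmx mul1mx opprK.
Qed.

Lemma theta1_tr x : D x -> (theta1 x)^T = xi x *m g x.
Proof. by move=> Dx; rewrite trmx_mul trmxK gsym. Qed.

Lemma theta2_tr x : D x -> (theta2 x)^T = xi x *m J x *m g x.
Proof. by move=> Dx; rewrite trmx_mul trmxK gsym. Qed.

Lemma xi_theta1 x : D x -> xi x *m theta1 x = 0.
Proof.
move=> Dx; have [_ E] := xi_null Dx.
by rewrite [LHS]mx11_scalar /theta1 mulmxA [(_ *m _) 0 0]E raddf0.
Qed.

Lemma xi_theta2 x : D x -> xi x *m theta2 x = 0.
Proof.
move=> Dx.
have E : xi x *m theta2 x = - (xi x *m theta2 x).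
  rewrite -[LHS]trmx11 trmx_mul theta2_tr// -[RHS]mulmxN -J_theta1//.
  by rewrite /theta1 !mulmxA.
have : (2 : R) *: (xi x *m theta2 x) = 0 by rewrite scaler_nat mulr2n {2}E subrr.
by move/eqP; rewrite scaler_eq0 pnatr_eq0 => /eqP.
Qed.

Lemma xiJ_theta1 x : D x -> xi x *m J x *m theta1 x = 0.
Proof. by move=> Dx; rewrite -mulmxA J_theta1// mulmxN xi_theta2// oppr0. Qed.

Lemma xiJ_theta2 x : D x -> xi x *m J x *m theta2 x = 0.
Proof. by move=> Dx; rewrite -mulmxA J_theta2// xi_theta1. Qed.

(** The endomorphism [Y |-> g (Y, X) eta - g (Y, eta) X], the part of [S_X]
    that is not twisted by [J]. *)
Definition wedge x (eta X : 'rV[R]_m) : 'M[R]_m :=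
  g x *m X^T *m eta - g x *m eta^T *m X.

Lemma bil_mx x X Y : D x -> bil (g x) X Y = (Y *m (g x *m X^T)) 0 0.
Proof. by move=> Dx; rewrite /bil -[X *m g x *m Y^T]trmx11 !trmx_mul trmxK gsym. Qed.

Lemma alongE x X : D x ->
  along (S x) X = wedge x (xi x) X - J x *m wedge x (xi x) X *m J x.
Proof.
move=> Dx; apply/row_matrixP => i; rewrite !rowE.
move: (delta_mx 0 i) => Y; rewrite linear_type//= zeta0// /wedge.
have -> : bil (g x) (X *m J x) 0 = 0 by rewrite /bil trmx0 mulmx0 mxE.
rewrite mulr0 scale0r subr0 (bil_mx X Y)// (bil_mx X (Y *m J x))//.
rewrite /bil -!mul_mx11.
mxlinear.
Qed.

Lemma along_skew x X : D x ->
  along (S x) X *m g x = - (g x *m (along (S x) X)^T).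
Proof.
move=> Dx.
have W : wedge x (xi x) X *m g x = - (g x *m (wedge x (xi x) X)^T).
  by rewrite /wedge raddfB /= !trmx_mul !trmxK gsym//; mxlinear.
have E : J x *m wedge x (xi x) X *m J x *m g x
    = - (g x *m (J x *m wedge x (xi x) X *m J x)^T).
  rewrite -mulmxA Jg// mulmxN !trmx_mul -[in LHS]mulmxA [in LHS](mulmxA (wedge _ _ _)) W.
  by rewrite mulNmx mulmxN opprK !mulmxA Jg// !mulNmx.
rewrite alongE//; move: (wedge _ _ _) (_ *m _ *m J x) W E => a b W E.
by rewrite mulmxBl W E raddfB /= mulmxBr opprB opprK addrC.
Qed.

Lemma xi_along x v : D x ->
  xi x *m along (S x) v = v *m theta1 x *m xi x - v *m theta2 x *m (xi x *m J x).
Proof.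
move=> Dx; rewrite linear_type//= zeta0//.
have -> : bil (g x) (v *m J x) 0 = 0 by rewrite /bil trmx0 mulmx0 mxE.
have -> : bil (g x) (xi x *m J x) (xi x) = 0.
  by rewrite bilE -mulmxA -/(theta1 x) xiJ_theta1// mxE.
have [_ ->] := xi_null Dx.
rewrite mulr0 !scale0r !subr0 addr0 /bil -!mul_mx11 /theta1 /theta2.
by rewrite !mulmxA.
Qed.

Lemma reductiveE x v :
  reductive g S x v = levi_civita g x v - along (S x) v.
Proof. by rewrite /reductive /levi_civita /oneform /along lincombB. Qed.

(** Otherwise contract with a vector [v] such that [v (g eta^T) = 1]: then
    [eta J] is a real multiple of [eta], although [J^2 = -1]. *)
Lemma parallel_twist x (eta : 'rV[R]_m) : D x ->
  J x *m g x *m eta^T *m eta + g x *m eta^T *m (eta *m J x) = 0 -> eta = 0.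
Proof.
move=> Dx E; pose p := g x *m eta^T.
have [p0|/col_left_inverse[v vp]] := eqVneq p 0.
  have : (invmx (g x) *m p)^T = 0 by rewrite p0 mulmx0 trmx0.
  by rewrite mulKmx ?gunit// trmxK.
have EJ : eta *m J x = - (v *m J x *m p) 0 0 *: eta.
  have : v *m (J x *m p *m eta + p *m (eta *m J x)) = 0.
    by rewrite /p !mulmxA in E *; rewrite E mulmx0.
  rewrite mulmxDr (mulmxA v p) vp mul1mx !mulmxA.
  by move=> /eqP; rewrite addrC addr_eq0 => /eqP ->; rewrite mul_mx11 scaleNr.
move: EJ; set l := _ 0 0 => EJ.
have : eta *m (J x *m J x) = - eta by rewrite JJ// mulmxN mulmx1.
rewrite mulmxA EJ -scalemxAl EJ scalerA mulrNN => /eqP; rewrite -addr_eq0.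
rewrite -{2}[eta]scale1r -scalerDl scaler_eq0 => /orP[|/eqP//].
by rewrite gt_eqF// ltr_wpDl// -expr2 sqr_ge0.
Qed.

(** For constant [X] the derivative of [S_X] along the reductive connection is
    the operator of the same shape built from the derivative [eta] of [xi]; it
    vanishes, and [X = J eta] then shows that [eta] is zero. *)
Lemma xi_parallel x v : D x -> is_cov x v 0 xi (reductive g S x v) 0.
Proof.
move=> Dx; set T := reductive g S x v.
pose eta := 'D_v xi x + xi x *m T.
have dxi : is_cov x v 0 xi T eta.
  rewrite /is_cov mul0mx sub0r /eta addrC addrK.
  exact: derivable_of_diff (smooth_differentiable xi_smooth Dx).
suff eta0 : eta = 0 by rewrite -eta0.
have gC := reductive_metric kahler homog v Dx.
have JC := reductive_J kahler homog v Dx.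
have wC X : is_cov x v T (fun y => wedge y (xi y) X) T
    (wedge x (xi x) (X *m T) + wedge x eta X).
  have xiT := cov_tr dxi; rewrite trmx0 oppr0 in xiT.
  have h1 := cov_mul (cov_mul gC (cov_cst x v (- T^T) X^T 0)) dxi.
  have h2 := cov_mul (cov_mul gC xiT) (cov_cst x v 0 X T).
  have := cov_add h1 (cov_opp h2); rewrite /is_cov -/T.
  move=> H; apply: is_derive_eq.
  rewrite /wedge !trmx_mul; mxlinear.
have tw X : wedge x eta X - J x *m wedge x eta X *m J x = 0.
  have h1 := cov_add (wC X) (cov_opp (cov_mul (cov_mul JC (wC X)) JC)).
  have h2 : is_cov x v T (fun y => wedge y (xi y) X + - (J y *m wedge y (xi y) X *m J y)) T
      (along (S x) (X *m T)).
    have := reductive_S homog v X Dx; rewrite /is_cov -/T alongE//.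
    apply: near_eq_is_derive.
    by apply: filterS (open_nbhs_nbhs (conj oD Dx)) => y Dy; rewrite alongE.
  have := cov_unique h1 h2; rewrite alongE//.
  move: (wedge x eta X) (wedge x (xi x) (X *m T)) => a b.
  rewrite mulmx0 addr0 mul0mx add0r mulmxDr mulmxDl opprD addrACA.
  by rewrite -[RHS]addr0 => /addrI.
apply: (@parallel_twist x) => //.
have := tw (eta *m J x); rewrite /wedge.
have -> : g x *m (eta *m J x)^T *m eta = - (J x *m g x *m eta^T *m eta).
  by rewrite trmx_mul Jg// !mulNmx opprK !mulmxA.
rewrite mulmxBr mulmxN mulmxBl mulNmx.
have -> : J x *m (J x *m g x *m eta^T *m eta) *m J x = - (g x *m eta^T *m (eta *m J x)).
  by rewrite !mulmxA JJ// mulNmx mul1mx !mulNmx.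
have -> : J x *m (g x *m eta^T *m (eta *m J x)) *m J x = - (J x *m g x *m eta^T *m eta).
  by rewrite !mulmxA -!mulmxA JJ// mulmxN !mulmxN mulmx1.
move: (J x *m g x *m eta^T *m eta) (g x *m eta^T *m (eta *m J x)) => a b.
rewrite !opprK => E.
have : (2 : R) *: (a + b) = 0.
  by rewrite -oppr0 -E; apply/matrixP => i j; rewrite !mxE; ring.
by move/eqP; rewrite scaler_eq0 pnatr_eq0 => /eqP.
Qed.

Lemma xiJ_parallel x v : D x ->
  is_cov x v 0 (fun y => xi y *m J y) (reductive g S x v) 0.
Proof.
move=> Dx; have := cov_mul (xi_parallel v Dx) (reductive_J kahler homog v Dx).
by rewrite mul0mx mulmx0 addr0.
Qed.

Lemma theta1_parallel x v : D x -> is_cov x v (reductive g S x v) theta1 0 0.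
Proof.
move=> Dx; have := cov_tr (xi_parallel v Dx); rewrite !trmx0 oppr0 => xiT.
have := cov_mul (reductive_metric kahler homog v Dx) xiT.
by rewrite mul0mx mulmx0 addr0.
Qed.

Lemma theta2_parallel x v : D x -> is_cov x v (reductive g S x v) theta2 0 0.
Proof.
move=> Dx; have := cov_tr (xiJ_parallel v Dx); rewrite !trmx0 oppr0 => xiT.
have := cov_mul (reductive_metric kahler homog v Dx) xiT.
by rewrite mul0mx mulmx0 addr0.
Qed.

(** The endomorphism [X |-> theta1 X J xi - theta2 X xi]. *)
Definition turn x : 'M[R]_m := theta1 x *m (xi x *m J x) - theta2 x *m xi x.

Lemma turn_parallel x v : D x ->
  is_cov x v (reductive g S x v) turn (reductive g S x v) 0.
Proof.
move=> Dx; have h1 := cov_mul (theta1_parallel v Dx) (xiJ_parallel v Dx).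
have h2 := cov_mul (theta2_parallel v Dx) (xi_parallel v Dx).
by have := cov_add h1 (cov_opp h2); rewrite !mul0mx !mulmx0 !addr0 subrr.
Qed.

Lemma xi_derive x v : D x -> is_cov x v 0 xi (levi_civita g x v)
  (v *m theta1 x *m xi x - v *m theta2 x *m (xi x *m J x)).
Proof.
move=> Dx; have := cov_change 0 (levi_civita g x v) (xi_parallel v Dx).
rewrite subr0 mul0mx !add0r reductiveE.
by rewrite addrC addKr mulmxN opprK xi_along.
Qed.

Lemma xiJ_derive x v : D x ->
  is_cov x v 0 (fun y => xi y *m J y) (levi_civita g x v)
  (v *m theta1 x *m (xi x *m J x) + v *m theta2 x *m xi x).
Proof.
move=> Dx; have := cov_mul (xi_derive v Dx) (levi_civita_J kahler v Dx).
by rewrite mulmx0 addr0 mulmxBl -!mulmxA JJ// mulmxN mulmx1 !mulmxN opprK !mulmxA.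
Qed.

Lemma theta1_derive x v : D x ->
  is_cov x v (levi_civita g x v) theta1 0
  (theta1 x *m (v *m theta1 x) - theta2 x *m (v *m theta2 x)).
Proof.
move=> Dx; have := cov_tr (xi_derive v Dx); rewrite trmx0 oppr0 => xiT.
have := cov_mul (levi_civita_metric oD kahler v Dx) xiT.
rewrite mul0mx add0r raddfB /= (trmx_mul (v *m theta1 x)) (trmx_mul (v *m theta2 x)).
by rewrite !trmx11 mulmxBr 2!(mulmxA (g x)).
Qed.

Lemma theta2_derive x v : D x ->
  is_cov x v (levi_civita g x v) theta2 0
  (theta2 x *m (v *m theta1 x) + theta1 x *m (v *m theta2 x)).
Proof.
move=> Dx; have := cov_tr (xiJ_derive v Dx); rewrite trmx0 oppr0 => xiT.
have := cov_mul (levi_civita_metric oD kahler v Dx) xiT.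
rewrite mul0mx add0r raddfD /= (trmx_mul (v *m theta1 x)) (trmx_mul (v *m theta2 x)).
by rewrite !trmx11 mulmxDr 2!(mulmxA (g x)).
Qed.

(** From [e] with [theta1 e = 1], subtract the multiple of [e J] that kills
    [theta2]; as [theta2 (e J) = 1], this is a rotation up to scale. *)
Lemma transverse x : D x ->
  exists E : 'rV[R]_m, E *m theta1 x = 1%:M /\ E *m theta2 x = 0.
Proof.
move=> Dx; have : theta1 x != 0.
  apply/negP => /eqP E; have [/negP + _] := xi_null Dx; apply; apply/eqP.
  have : (invmx (g x) *m theta1 x)^T = 0 by rewrite E mulmx0 trmx0.
  by rewrite mulKmx ?gunit// trmxK.
move=> /col_left_inverse[e e1]; pose a := (e *m theta2 x) 0 0.
have e2 : e *m theta2 x = a%:M by rewrite [LHS]mx11_scalar.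
have a0 : 1 + a * a != 0 by rewrite gt_eqF// ltr_pwDl// -expr2 sqr_ge0.
exists ((1 + a * a)^-1 *: (e - a *: (e *m J x))).
rewrite -!scalemxAl !mulmxBl -!scalemxAl -!mulmxA J_theta1// J_theta2//.
rewrite mulmxN e1 e2; split; last by rewrite scale_scalar_mx mulr1 subrr scaler0.
by apply/matrixP => i j; rewrite !mxE; move: (_ == _) => -[] /=; field.
Qed.

Lemma mul11C n (p q : 'rV[R]_n) (a b : 'cV[R]_n) :
  p *m a *m (q *m b) = q *m b *m (p *m a).
Proof. by rewrite mul_mx11 [q *m b *m _]mul_mx11 [p *m a in RHS]mx11_scalar
  [q *m b in LHS]mx11_scalar !scale_scalar_mx mulrC. Qed.

(** The exterior derivatives of [theta1] and [theta2] vanish: their covariant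
    derivatives are symmetric. *)
Lemma closed_form1 (u v : 'rV[R]_m) (p q : 'M[R]_m) (a b : 'cV[R]_m) :
  v *m p = u *m q ->
  v *m (p *m a + (a *m (u *m a) - b *m (u *m b))) =
  u *m (q *m a + (a *m (v *m a) - b *m (v *m b))).
Proof.
move=> E; rewrite ![v *m (_ + _)]mulmxDr ![u *m (_ + _)]mulmxDr (mulmxA v) E.
rewrite (mulmxA u); congr (_ + _).
rewrite !mulmxN (mulmxA v b) (mulmxA u b) (mulmxA v a) (mulmxA u a).
by rewrite [v *m b *m _]mul11C [v *m a *m _]mul11C.
Qed.

Lemma closed_form2 (u v : 'rV[R]_m) (p q : 'M[R]_m) (a b : 'cV[R]_m) :
  v *m p = u *m q ->
  v *m (p *m b + (b *m (u *m a) + a *m (u *m b))) =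
  u *m (q *m b + (b *m (v *m a) + a *m (v *m b))).
Proof.
move=> E; rewrite ![v *m (_ + _)]mulmxDr ![u *m (_ + _)]mulmxDr (mulmxA v) E.
rewrite (mulmxA u); congr (_ + _).
rewrite (mulmxA v b) (mulmxA u b) (mulmxA v a) (mulmxA u a).
by rewrite [v *m b *m _]mul11C [v *m a *m _]mul11C addrC.
Qed.

(** The one-forms [theta1] and [theta2] are closed, so the connection induced
    on the complex line spanned by [xi] is flat. *)
Lemma xi_riemann x u v : D x -> xi x *m riemann g x u v = 0.
Proof.
move=> Dx; pose N := levi_civita g; pose b y (w : 'rV[R]_m) := (w *m theta2 y) 0 0.
pose L y (w : 'rV[R]_m) := w *m theta1 y; pose M y w := N y w + b y w *: J y.
pose d1 y (u : 'rV[R]_m) := N y u *m theta1 y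
  + (theta1 y *m (u *m theta1 y) - theta2 y *m (u *m theta2 y)).
pose d2 y (u : 'rV[R]_m) := N y u *m theta2 y
  + (theta2 y *m (u *m theta1 y) + theta1 y *m (u *m theta2 y)).
have th1d y w : D y -> is_derive y w theta1 (d1 y w).
  by move=> Dy; have := theta1_derive w Dy; rewrite /is_cov mulmx0 subr0.
have th2d y w : D y -> is_derive y w theta2 (d2 y w).
  by move=> Dy; have := theta2_derive w Dy; rewrite /is_cov mulmx0 subr0.
have xid y w : D y -> is_cov y w (L y w) xi (M y w) 0.
  move=> Dy; have := cov_change (L y w) (M y w) (xi_derive w Dy).
  have -> : levi_civita g y w - M y w = - (b y w *: J y).
    by rewrite opprD addrA subrr sub0r.
  rewrite mulmxN opprK -scalemxAr sub0r mulNmx /b -mul_mx11 /L.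
  move: (_ *m _ *m xi y) (_ *m _ *m (_ *m _)) => p q.
  by rewrite [p - q]addrC addrK addNr.
pose dL y u (w : 'rV[R]_m) := w *m d1 y u.
have Ld y u' w : D y -> is_derive y u' (fun z => L z w) (dL y u' w).
  move=> Dy; have := is_derive_mulmx (is_derive_cst w y u') (th1d y u' Dy).
  by rewrite mul0mx add0r.
pose dN := doneform (fun i x => christoffel g x i).
pose dM y u (w : 'rV[R]_m) := dN y u w + ((w *m d2 y u) 0 0 *: J y
  + b y w *: (N y u *m J y - J y *m N y u)).
have Md y u' w : D y -> is_derive y u' (fun z => M z w) (dM y u' w).
  move=> Dy; apply: (is_deriveD (levi_civita_derive oD kahler u' w Dy)).
  apply: is_derive_scale.
    have := is_derive_mulmx (is_derive_cst w y u') (th2d y u' Dy).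
    by rewrite mul0mx add0r => /is_derive_mxP; exact.
  by have := levi_civita_J kahler u' Dy; rewrite /is_cov addr0.
have S1 : dL x u v = dL x v u.
  exact: closed_form1 (torsion_free oD kahler v u Dx).
have S2 : v *m d2 x u = u *m d2 x v.
  exact: closed_form2 (torsion_free oD kahler v u Dx).
have := ricci oD xi_smooth xid Ld Md u v Dx.
have -> : dL x u v - dL x v u + L x v *m L x u - L x u *m L x v = 0.
  by rewrite S1 subrr add0r /L mul11C subrr.
rewrite mul0mx => ->; congr (_ *m _).
rewrite riemannE /dM S2 -/N -/dN /M.
move: (u *m d2 x v) (b x u) (b x v) => s p q; mxlinear.
Qed.

Definition area x (X Y : 'rV[R]_m) :=
  omega (fun Z => (Z *m theta1 x) 0 0) (fun Z => (Z *m theta2 x) 0 0) X Y.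

Lemma xiJ_smooth : smooth_on D (fun x => xi x *m J x).
Proof. by move=> k; exact: (Ck_mulmx oD (xi_smooth k) (JS k)). Qed.

Lemma theta1_smooth : smooth_on D theta1.
Proof. by move=> k; exact: (Ck_mulmx oD (gS k) (Ck_trmx oD (xi_smooth k))). Qed.

Lemma theta2_smooth : smooth_on D theta2.
Proof. by move=> k; exact: (Ck_mulmx oD (gS k) (Ck_trmx oD (xiJ_smooth k))). Qed.

Lemma theta_smooth (t : 'rV[R]_m -> 'cV[R]_m) (X : 'rV[R]_m) :
  smooth_on D t -> smooth_on D (fun x => (X *m t x) 0 0).
Proof. by move=> tS k; exact: (Ck_entry 0 0 oD (Ck_mulmx oD (Ck_cst k D X) (tS k))). Qed.

Lemma turn_smooth : smooth_on D turn.
Proof.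
by move=> k; exact: (CkB oD (Ck_mulmx oD (theta1_smooth k) (xiJ_smooth k))
  (Ck_mulmx oD (theta2_smooth k) (xi_smooth k))).
Qed.

Lemma area_smooth X Y : smooth_on D (fun x => area x X Y).
Proof.
move=> k; have H1 Z := theta_smooth Z theta1_smooth k.
have H2 Z := theta_smooth Z theta2_smooth k.
exact: (CkB oD (CkM oD (H1 X) (H2 Y)) (CkM oD (H2 X) (H1 Y))).
Qed.

Lemma bil_skew x u v Y Z : D x ->
  bil (g x) (Y *m riemann g x u v) Z = - bil (g x) (Z *m riemann g x u v) Y.
Proof.
move=> Dx; rewrite /bil -[Y *m _ *m _ *m _]trmx11 !trmx_mul trmxK gsym//.
rewrite !mulmxA -(mulmxA Z (riemann _ _ _ _)) (riemann_metric oD kahler)//.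
by rewrite mulmxN mulNmx [X in _ = - X]mxE opprK !mulmxA.
Qed.

Lemma bil_along x X Y Z : D x ->
  bil (g x) Z (Y *m along (S x) X) = - bil (g x) (Z *m along (S x) X) Y.
Proof.
move=> Dx; rewrite /bil trmx_mul !mulmxA -(mulmxA Z (along _ _)) along_skew//.
by rewrite mulmxN mulNmx [X in _ = - X]mxE opprK !mulmxA.
Qed.

Lemma bilDl (G : 'M[R]_m) X Y Z : bil G (X + Y) Z = bil G X Z + bil G Y Z.
Proof. by rewrite /bil !mulmxDl mxE. Qed.

Lemma bilZl (G : 'M[R]_m) a X Z : bil G (a *: X) Z = a * bil G X Z.
Proof. by rewrite /bil -!scalemxAl mxE. Qed.

Lemma bilNl (G : 'M[R]_m) X Z : bil G (- X) Z = - bil G X Z.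
Proof. by rewrite -scaleN1r bilZl mulN1r. Qed.

Lemma bil0l (G : 'M[R]_m) Z : bil G 0 Z = 0.
Proof. by rewrite /bil !mul0mx mxE. Qed.

(** [nabla R] is the action of [S] on [R], whence a purely algebraic form of
    the second Bianchi identity. *)
Lemma riemann_bianchi2_along x u v w : D x ->
  let dR u v w := riemann g x u v *m along (S x) w - along (S x) w *m riemann g x u v
    - riemann g x (u *m along (S x) w) v - riemann g x u (v *m along (S x) w) in
  dR u v w + dR v w u + dR w u v = 0.
Proof.
move=> Dx /=.
have riemD a b c : riemann g x (a - b) c = riemann g x a c - riemann g x b c.
  by rewrite addrC -scaleN1r riemann_linear scaleN1r addrC.
have riemDr a b c : riemann g x c (a - b) = riemann g x c a - riemann g x c b.
  by rewrite riemann_skew riemD opprB [riemann g x b c]riemann_skew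
    [riemann g x a c]riemann_skew opprK addrC.
have E a b c : 'D_c (fun y => riemann g y a b) x
    + riemann g x a b *m levi_civita g x c - levi_civita g x c *m riemann g x a b
  = riemann g x a b *m along (S x) c - along (S x) c *m riemann g x a b
    - riemann g x (a *m along (S x) c) b - riemann g x a (b *m along (S x) c)
    + (riemann g x (a *m levi_civita g x c) b - riemann g x (b *m levi_civita g x c) a).
  have [_ ->] := reductive_riemann oD kahler homog a b c Dx.
  rewrite reductiveE !mulmxBr riemD riemDr.
  rewrite [riemann g x (b *m levi_civita g x c) a]riemann_skew.
  move: (riemann g x (a *m levi_civita g x c) b) => p1.
  move: (riemann g x a (b *m levi_civita g x c)) => p2.
  move: (riemann g x (a *m along (S x) c) b) => p3.
  move: (riemann g x a (b *m along (S x) c)) => p4.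
  mxlinear.
have := riemann_bianchi2 oD kahler u v w Dx; rewrite /= !E.
rewrite (torsion_free oD kahler u w)// (torsion_free oD kahler v w)// (torsion_free oD kahler u v)//.
move: (_ - riemann g x u (v *m along _ _)) (_ - riemann g x v (w *m along _ _)) => p q.
move: (_ - riemann g x w (u *m along _ _)) => r.
move: (riemann g x (w *m levi_civita g x u) v) => t1.
move: (riemann g x (w *m levi_civita g x v) u) => t2.
move: (riemann g x (v *m levi_civita g x u) w) => t3 <-.
by apply/matrixP => i j; rewrite !mxE; ring.
Qed.

Lemma bil_turn x X Y : D x -> bil (g x) (X *m turn x) Y = area x X Y.
Proof.
move=> Dx.
have expand (G : 'M[R]_m) (a b : 'cV[R]_m) (p q : 'rV[R]_m) :
    X *m (a *m p - b *m q) *m G *m Y^T =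
    X *m a *m (p *m G *m Y^T) - X *m b *m (q *m G *m Y^T) by mxlinear.
rewrite /bil /turn expand -theta2_tr// -theta1_tr// -!trmx_mul !trmx11.
rewrite /area /omega; move: (X *m _) (X *m _) (Y *m _) (Y *m _) => a b c d.
by rewrite !mul_mx11 !mxE.
Qed.

(** The pointwise form of the curvature, by [curvature_shape]. *)
Lemma riemann_turn x : D x ->
  exists K, forall X Y, riemann g x X Y = (K * area x X Y) *: turn x.
Proof.
move=> Dx; have [E [E1 E2]] := transverse Dx.
pose Rq X Y Z W := bil (g x) (Z *m riemann g x X Y) W.
pose th1 (Z : 'rV[R]_m) := (Z *m theta1 x) 0 0; pose th2 (Z : 'rV[R]_m) := (Z *m theta2 x) 0 0.
have lin1 a X X' Y Z W : Rq (a *: X + X') Y Z W = a * Rq X Y Z W + Rq X' Y Z W.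
  by rewrite /Rq riemann_linear mulmxDr -scalemxAr bilDl bilZl.
have skew12 X Y Z W : Rq X Y Z W = - Rq Y X Z W.
  by rewrite /Rq riemann_skew mulmxN bilNl.
have skew34 X Y Z W : Rq X Y Z W = - Rq X Y W Z by exact: bil_skew.
have bianchi1 X Y Z W : Rq X Y Z W + Rq Y Z X W + Rq Z X Y W = 0.
  by rewrite /Rq -!bilDl (riemann_bianchi1 oD kahler)// bil0l.
have RJ X Y Z W : Rq X Y (Z *m J x) (W *m J x) = Rq X Y Z W.
  rewrite /Rq -mulmxA -(riemann_J oD kahler)// mulmxA.
  by case: kahler => _ _ _ + _ => /(_ x Dx)[_ ->].
have Rxi X Y W : Rq X Y (xi x) W = 0 by rewrite /Rq xi_riemann// bil0l.
have th1J X : th1 (X *m J x) = - th2 X.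
  by rewrite /th1 /th2 -mulmxA J_theta1// mulmxN mxE.
have JJ' (X : 'rV[R]_m) : X *m J x *m J x = - X by rewrite -mulmxA JJ// mulmxN mulmx1.
have SE X Y : bil (g x) X Y *: xi x - th1 Y *: X
    - bil (g x) X (Y *m J x) *: (xi x *m J x) - th2 Y *: (X *m J x)
    = Y *m along (S x) X.
  rewrite linear_type//= zeta0//.
  have -> : bil (g x) (X *m J x) 0 = 0 by rewrite /bil trmx0 mulmx0 mxE.
  rewrite mulr0 scale0r subr0 [bil (g x) Y (xi x)]bilE -mulmxA -/(theta1 x) -/(th1 Y).
  by rewrite [bil (g x) (Y *m J x) (xi x)]bilE -mulmxA -/(theta1 x) -/(th1 _) th1J scaleNr.
have bianchi2 X Y Z W U :
  let S' X Y := bil (g x) X Y *: xi x - th1 Y *: X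
    - bil (g x) X (Y *m J x) *: (xi x *m J x) - th2 Y *: (X *m J x) in
  let dR X Y Z W U := Rq (S' X Y) Z W U + Rq Y (S' X Z) W U + Rq Y Z (S' X W) U
    + Rq Y Z W (S' X U) in
  dR X Y Z W U + dR Y Z X W U + dR Z X Y W U = 0.
  rewrite /= !SE.
  have H a b c : Rq (b *m along (S x) a) c W U + Rq b (c *m along (S x) a) W U
      + Rq b c (W *m along (S x) a) U + Rq b c W (U *m along (S x) a)
    = - bil (g x) (W *m (riemann g x b c *m along (S x) a
        - along (S x) a *m riemann g x b c - riemann g x (b *m along (S x) a) c
        - riemann g x b (c *m along (S x) a))) U.
    rewrite /Rq bil_along// !mulmxBr !bilDl !bilNl !mulmxA; ring.
  rewrite !H -!opprD -!bilDl -!mulmxDr.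
  have := riemann_bianchi2_along X Y Z Dx; rewrite /= => B.
  rewrite -[X in bil _ (W *m X)]addrC addrA [X in bil _ (W *m X)](_ : _ = 0) ?mulmx0 ?bil0l ?oppr0//.
have T1 : th1 E = 1 by rewrite /th1 E1 mxE eqxx.
have T2 : th2 E = 0 by rewrite /th2 E2 mxE.
have := curvature_shape lin1 skew12 skew34 bianchi1 RJ Rxi bianchi2 JJ' th1J T1 T2.
set K := Rq _ _ _ _ => H; exists K => X Y.
suff : riemann g x X Y *m g x = (K * area x X Y) *: turn x *m g x.
  by move=> /(congr1 (mulmx^~ (invmx (g x)))); rewrite !mulmxK// gunit.
apply/matrixP => i j; have := H X Y (delta_mx 0 i) (delta_mx 0 j).
have entry (A : 'M[R]_m) : bil (g x) (delta_mx 0 i *m A) (delta_mx 0 j) = (A *m g x) i j.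
  by rewrite /bil trmx_delta -mulmxA -mulmxA -rowE mulmxA -colE !mxE; apply: eq_bigr.
rewrite {1}/Rq entry => ->; rewrite -scalemxAl mxE -/(area x X Y) mulrA; congr (_ * _).
by rewrite -entry bil_turn.
Qed.

(** The factor relating [R] and the parallel tensor [area (x) turn] is
    constant because both tensors are parallel for the same connection. *)
Lemma curvature_constant x0 : D x0 -> exists r k, [/\ 0 < r,
  forall x, `|x - x0| < r -> D x &
  forall x, `|x - x0| < r -> forall X Y,
    riemann g x X Y = (k * area x X Y) *: turn x].
Proof.
move=> Dx0; have [E [E1 E2]] := transverse Dx0.
have [c c1] : exists c : 'cV[R]_m, xi x0 *m J x0 *m c = 1%:M.
  have : (xi x0 *m J x0)^T != 0.
    apply/negP => /eqP /(congr1 trmx); rewrite trmxK trmx0 => /(congr1 (mulmx^~ (J x0))).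
    rewrite mul0mx -mulmxA JJ// mulmxN mulmx1 => /eqP; rewrite oppr_eq0.
    by apply/negP; have [] := xi_null Dx0.
  move=> /col_left_inverse[v /(congr1 trmx)]; rewrite trmx_mul trmxK tr_scalar_mx => H.
  by exists v^T.
pose Y0 := E *m J x0.
pose H y := area y E Y0 *: turn y.
(* E and c single out an entry that does not vanish at x0. *)
pose h y := (E *m H y *m c) 0 0.
pose f y := E *m riemann g y E Y0 *m c.
have HS : smooth_on D H.
  by move=> k; exact: (Ck_scale oD (area_smooth E Y0 k) (turn_smooth k)).
have hS : smooth_on D h.
  by move=> k; apply: Ck_entry => //; do ?[apply: Ck_mulmx => //|exact: Ck_cst].
have fS : smooth_on D f.
  move=> k; do ?[apply: Ck_mulmx => //|exact: Ck_cst]; exact: (riemann_smooth oD kahler).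
have h0 : h x0 != 0.
  have et : E *m turn x0 = xi x0 *m J x0.
    by rewrite /turn mulmxBr (mulmxA E (theta1 x0)) (mulmxA E (theta2 x0)) E1 E2
      mul0mx mul1mx subr0.
  have Y1 : Y0 *m theta1 x0 = 0 by rewrite -mulmxA J_theta1// mulmxN E2 oppr0.
  have Y2 : Y0 *m theta2 x0 = 1%:M by rewrite -mulmxA J_theta2.
  rewrite /h /H -scalemxAr -scalemxAl et c1 /area /omega E1 E2 Y1 Y2 !mxE.
  by rewrite !mulr1 mul0r subr0 oner_neq0.
have [r r0 rP] : exists2 r : R, 0 < r & forall y, `|y - x0| < r -> D y /\ h y != 0.
  apply: nbhs_dist; apply: filterI; first exact: (open_nbhs_nbhs (conj oD Dx0)).
  have hc : {for x0, continuous h} by exact: (hS 0%N).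
  exact: cvgr_neq0 hc h0.
pose q y := (h y)^-1 *: f y.
have oB := @open_dist R 'rV[R]_m x0 r.
have qS : smooth_on [set y | `|y - x0| < r] q.
  move=> k; apply: Ck_scale => //.
    apply: CkV => //; first by move=> y /rP[].
    by apply: Ck_sub (hS k) => y /rP[].
  by apply: Ck_sub (fS k) => y /rP[].
have HE y v : D y -> is_derive y v H (reductive g S y v *m H y - H y *m reductive g S y v
    + (area y (E *m reductive g S y v) Y0 + area y E (Y0 *m reductive g S y v)) *: turn y).
  move=> Dy; set T := reductive g S y v.
  have e1 (Z : 'rV[R]_m) : is_derive y v (fun z => (Z *m theta1 z) 0 0) ((Z *m T *m theta1 y) 0 0).
    have := theta1_parallel v Dy; rewrite /is_cov mulmx0 subr0 addr0 -/T => d1.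
    have := is_derive_mulmx (is_derive_cst Z y v) d1.
    by rewrite mul0mx add0r mulmxA => /is_derive_mxP; exact.
  have e2 (Z : 'rV[R]_m) : is_derive y v (fun z => (Z *m theta2 z) 0 0) ((Z *m T *m theta2 y) 0 0).
    have := theta2_parallel v Dy; rewrite /is_cov mulmx0 subr0 addr0 -/T => d1.
    have := is_derive_mulmx (is_derive_cst Z y v) d1.
    by rewrite mul0mx add0r mulmxA => /is_derive_mxP; exact.
  have ea : is_derive y v (fun z => area z E Y0) (area y (E *m T) Y0 + area y E (Y0 *m T)).
    apply: (is_derive_eq (is_deriveB (is_deriveM (e1 E) (e2 Y0))
      (is_deriveM (e2 E) (e1 Y0)))).
    rewrite /area /omega /GRing.scale /=; ring.
  apply: (is_derive_eq (is_derive_scale ea (turn_parallel v Dy))).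
  rewrite -/T /H addr0; move: (area y (E *m T) Y0 + _) (area y E Y0) (turn y) => p s t; mxlinear.
exists r, (q x0 0 0); split=> // [x /rP[]//|x xr X Y].
have [Dx hx] := rP x xr; have [K KE] := riemann_turn Dx.
rewrite KE; suff -> : K = q x0 0 0 by [].
have fE y : D y -> forall K, (forall X Y, riemann g y X Y = (K * area y X Y) *: turn y) ->
    f y = (K * h y)%:M.
  move=> Dy K' K'E; rewrite [LHS]mx11_scalar; congr (_%:M).
  by rewrite /f K'E /h /H -!scalemxAr -!scalemxAl -scalerA !mxE.
rewrite -(locally_constant (Y := q) (r := r) (x0 := x0) _ _ xr).
- by rewrite /q (fE x Dx K KE) !mxE eqxx mulrC mulfK.
- by move=> y yr; exact: smooth_differentiable qS yr.
move=> y v yr; have [Dy hy] := rP y yr; have [K' K'E] := riemann_turn Dy.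
have Hd := HE y v Dy; set dH := (X in is_derive _ _ _ X) in Hd.
have Rd : is_derive y v (fun z => riemann g z E Y0) (K' *: dH).
  have := reductive_riemann oD kahler homog E Y0 v Dy; rewrite /is_cov !K'E.
  move=> Rd; apply: is_derive_eq Rd _; rewrite /dH /H.
  move: (reductive g S y v) => T; move: (area y (E *m T) Y0) => s1.
  move: (area y E (Y0 *m T)) (area y E Y0) (turn y) => s2 s3 t; mxlinear.
have sand (F : 'rV[R]_m -> 'M[R]_m) dF : is_derive y v F dF ->
    is_derive y v (fun z => E *m F z *m c) (E *m dF *m c).
  move=> Fd; apply: (is_derive_eq (is_derive_mulmx
    (is_derive_mulmx (is_derive_cst E y v) Fd) (is_derive_cst c y v))).
  by rewrite mul0mx add0r mulmx0 addr0.
have hd : is_derive y v h ((E *m dH *m c) 0 0).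
  by have /is_derive_mxP := sand _ _ Hd; exact.
have qd := derivable_of_diff v (smooth_differentiable qS yr).
have fd : is_derive y v f ((E *m dH *m c) 0 0 *: q y + h y *: 'D_v q y).
  apply: near_eq_is_derive (is_derive_scale hd qd).
  apply: filterS (open_nbhs_nbhs (conj oB yr)) => z /rP[_ hz].
  by rewrite /q scalerA divff// scale1r.
have qE : q y = K'%:M.
  by rewrite /q (fE y Dy K' K'E) scale_scalar_mx mulrC mulfK.
have := is_derive_unique fd (sand _ _ Rd).
rewrite qE -scalemxAr -scalemxAl [E *m dH *m c in RHS]mx11_scalar.
rewrite !scale_scalar_mx [K' * _]mulrC -[RHS]addr0 => /addrI /eqP.
by rewrite scaler_eq0 (negPf hy) => /eqP.
Qed.

End NullLine.

(** * Flat torsion-free connections and affine coordinates *)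

Section AffineCoordinates.
Variables (R : realType) (m : nat) (D : set 'rV[R]_m).
Variable B : 'I_m -> 'rV[R]_m -> 'M[R]_m.
Hypotheses (oD : open D) (BS : forall i, smooth_on D (B i)).
Hypothesis torsion : forall x u v, D x -> v *m oneform B x u = u *m oneform B x v.
Hypothesis flat : forall x u v, D x -> doneform B x u v - doneform B x v u
  + oneform B x v *m oneform B x u - oneform B x u *m oneform B x v = 0.

Lemma lincomb_block n a b c d (P : 'I_n -> 'M[R]_(a, b)) (Q : 'I_n -> 'M[R]_(a, c))
    (S : 'I_n -> 'M[R]_(d, b)) (T : 'I_n -> 'M[R]_(d, c)) v :
  lincomb (fun i => block_mx (P i) (Q i) (S i) (T i)) v =
  block_mx (lincomb P v) (lincomb Q v) (lincomb S v) (lincomb T v).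
Proof.
apply/matrixP => i j; rewrite /lincomb summxE.
case: (split_ordP i) => k ->; case: (split_ordP j) => l ->.
- by rewrite block_mxEul summxE; apply: eq_bigr => s _; rewrite [LHS]mxE [RHS]mxE block_mxEul.
- by rewrite block_mxEur summxE; apply: eq_bigr => s _; rewrite [LHS]mxE [RHS]mxE block_mxEur.
- by rewrite block_mxEdl summxE; apply: eq_bigr => s _; rewrite [LHS]mxE [RHS]mxE block_mxEdl.
- by rewrite block_mxEdr summxE; apply: eq_bigr => s _; rewrite [LHS]mxE [RHS]mxE block_mxEdr.
Qed.

Let B1 (i : 'I_m) x : 'M[R]_(1 + m) := block_mx 0 (delta_mx 0 i) 0 (B i x).

Lemma affine_form x v : oneform B1 x v = block_mx 0 v 0 (oneform B x v).
Proof.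
rewrite /oneform /B1 lincomb_block !lincomb0; congr block_mx.
by rewrite [RHS]row_sum_delta.
Qed.

Lemma affine_smooth i : smooth_on D (B1 i).
Proof.
move=> k; apply: Ck_mx => // p q; rewrite /B1.
case: (split_ordP p) => a ->; case: (split_ordP q) => b ->.
- by under eq_fun do rewrite block_mxEul; exact: Ck_cst.
- by under eq_fun do rewrite block_mxEur; exact: Ck_cst.
- by under eq_fun do rewrite block_mxEdl; exact: Ck_cst.
- by under eq_fun do rewrite block_mxEdr; exact: (Ck_entry a b oD (BS i k)).
Qed.

Lemma affine_dform x u v : D x ->
  doneform B1 x u v = block_mx 0 0 0 (doneform B x u v).
Proof.
move=> Dx; apply: (is_derive_unique (is_derive_oneform affine_smooth u v Dx)).
rewrite (_ : (fun y => _) = fun y => block_mx 0 v 0 (oneform B y v)); last first.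
  by rewrite funeqE => y; exact: affine_form.
apply/is_derive_mxP => p q.
case: (split_ordP p) => a ->; case: (split_ordP q) => b ->.
- rewrite block_mxEul; under eq_fun do rewrite block_mxEul; rewrite mxE.
  exact: is_derive_cst.
- rewrite block_mxEur; under eq_fun do rewrite block_mxEur; rewrite [X in is_derive _ _ _ X]mxE.
  exact: is_derive_cst.
- rewrite block_mxEdl; under eq_fun do rewrite block_mxEdl; rewrite mxE.
  exact: is_derive_cst.
- rewrite block_mxEdr; under eq_fun do rewrite block_mxEdr.
  by have /is_derive_mxP := is_derive_oneform BS u v Dx; exact.
Qed.

(** The parallel frames [U] of the flat connection and the potentials [F] of
    their dual coframes solve one linear total differential system together;
    its integrability is flatness and vanishing torsion. *)
Lemma affine_coordinates p x0 (f0 : 'rV[R]_p) (U0 : 'M[R]_(m, p)) : D x0 ->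
  exists (r : R) F U, [/\ 0 < r, forall x, `|x - x0| < r -> D x,
    F x0 = f0 /\ U x0 = U0,
    smooth_on [set x | `|x - x0| < r] F /\ smooth_on [set x | `|x - x0| < r] U &
    forall x v, `|x - x0| < r ->
      is_derive x v F (v *m U x) /\ is_derive x v U (oneform B x v *m U x)].
Proof.
move=> Dx0.
have flat1 x u v : D x -> doneform B1 x u v - doneform B1 x v u
    + oneform B1 x v *m oneform B1 x u - oneform B1 x u *m oneform B1 x v = 0.
  move=> Dx; rewrite !affine_dform// !affine_form !mulmx_block.
  rewrite !opp_block_mx !add_block_mx !mul0mx !mulmx0 !add0r !oppr0 !addr0.
  by rewrite torsion// flat// add0r subrr block_mx0.
have [r [Y [r0 rD Y0 YS Yd]]] := frobenius oD affine_smooth flat1 (col_mx f0 U0) Dx0.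
have oB := @open_dist R 'rV[R]_m x0 r.
exists r, (fun x => usubmx (Y x)), (fun x => dsubmx (Y x)); split=> //.
- by rewrite Y0 col_mxKu col_mxKd.
- split=> k; apply: (Ck_mx oB) => i j.
    rewrite (_ : (fun x => _) = fun x => Y x (lshift m i) j).
      exact: (Ck_entry _ _ oB (YS k)).
    by rewrite funeqE => x; rewrite mxE.
  rewrite (_ : (fun x => _) = fun x => Y x (rshift 1 i) j).
    exact: (Ck_entry _ _ oB (YS k)).
  by rewrite funeqE => x; rewrite mxE.
move=> x v xr; have dY := derivable_of_diff v (smooth_differentiable YS xr).
have := Yd x v xr; rewrite -[Y x in RHS]vsubmxK affine_form mul_block_col.
rewrite !mul0mx !add0r => E; rewrite E in dY.
have /is_derive_mxP dYE := dY.
split; apply/is_derive_mxP => i j.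
- rewrite (_ : (fun x => _) = fun x => Y x (lshift m i) j).
    by have := dYE (lshift m i) j; rewrite col_mxEu.
  by rewrite funeqE => z; rewrite mxE.
rewrite (_ : (fun x => _) = fun x => Y x (rshift 1 i) j).
  by have := dYE (rshift 1 i) j; rewrite col_mxEd.
by rewrite funeqE => z; rewrite mxE.
Qed.

End AffineCoordinates.

(** * Flattening the Levi-Civita connection *)

Section FlatConnection.
Variables (R : realType) (m : nat) (D : set 'rV[R]_m) (g J : mfield R m)
  (S : cfield R m) (xi zeta : vfield R m) (c : R).
Hypotheses (oD : open D) (kahler : pseudo_kahler_on D g J).
Hypothesis homog : homogeneous_structure_on D g J S.
Hypothesis linear_type : linear_type_on D g J S xi zeta.
Hypothesis xi_smooth : smooth_on D xi.
Hypothesis xi_null : forall x, D x -> xi x != 0 /\ bil (g x) (xi x) (xi x) = 0.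
Hypothesis zeta0 : forall x, D x -> zeta x = 0.
Hypothesis curv : forall x, D x -> forall X Y,
  riemann g x X Y = (2 * c * area g J xi x X Y) *: turn g J xi x.

Let gS : smooth_on D g. Proof. by case: kahler. Qed.
Let JS : smooth_on D J. Proof. by case: kahler. Qed.
Let gsym x : D x -> (g x)^T = g x.
Proof. by case: kahler => _ _ + _ _ => /[apply] -[]. Qed.
Let JJ x : D x -> J x *m J x = - 1%:M.
Proof. by case: kahler => _ _ _ + _ => /[apply] -[]. Qed.

Local Notation t1 := (theta1 g xi).
Local Notation t2 := (theta2 g J xi).
Local Notation Q := (turn g J xi).
Local Notation levi := (levi_civita g).

(** [theta1 (x) xi + theta2 (x) J xi]; up to [g] it is the degenerate metric
    [theta1^2 + theta2^2], and [turn] is its composite with [J]. *)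
Definition shear x : 'M[R]_m := t1 x *m xi x + t2 x *m (xi x *m J x).

Let t1S : smooth_on D t1 := theta1_smooth oD kahler xi_smooth.
Let t2S : smooth_on D t2 := theta2_smooth oD kahler xi_smooth.

Let xit1 x : D x -> xi x *m t1 x = 0.
Proof. exact: (xi_theta1 xi_null). Qed.
Let xit2 x : D x -> xi x *m t2 x = 0.
Proof. exact: (xi_theta2 xi kahler). Qed.
Let xiJt1 x : D x -> xi x *m J x *m t1 x = 0.
Proof. exact: (xiJ_theta1 xi kahler). Qed.
Let xiJt2 x : D x -> xi x *m J x *m t2 x = 0.
Proof. exact: (xiJ_theta2 kahler xi_null). Qed.

Lemma shear_theta1 x : D x -> shear x *m t1 x = 0.
Proof.
move=> Dx; rewrite /shear mulmxDl -(mulmxA (t1 x)) -(mulmxA (t2 x)).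
by rewrite xit1// xiJt1// !mulmx0 addr0.
Qed.

Lemma shear_theta2 x : D x -> shear x *m t2 x = 0.
Proof.
move=> Dx; rewrite /shear mulmxDl -(mulmxA (t1 x)) -(mulmxA (t2 x)).
by rewrite xit2// xiJt2// !mulmx0 addr0.
Qed.

Lemma shearJ x : D x -> shear x *m J x = Q x.
Proof.
move=> Dx; rewrite /shear /turn mulmxDl -(mulmxA (t1 x)) -(mulmxA (t2 x)).
by rewrite -(mulmxA (xi x)) JJ// mulmxN mulmx1 mulmxN.
Qed.

Lemma Jshear x : D x -> J x *m shear x = Q x.
Proof.
move=> Dx; rewrite /shear /turn mulmxDr (mulmxA _ (t1 x)) (mulmxA _ (t2 x)).
by rewrite (J_theta1 xi kahler)// (J_theta2 xi kahler)// mulNmx addrC.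
Qed.

Lemma turn_theta1 x : D x -> Q x *m t1 x = 0.
Proof. by move=> Dx; rewrite -Jshear// -mulmxA shear_theta1// mulmx0. Qed.

Lemma turn_theta2 x : D x -> Q x *m t2 x = 0.
Proof. by move=> Dx; rewrite -Jshear// -mulmxA shear_theta2// mulmx0. Qed.

Lemma mul_shear0 n x (A : 'M[R]_(n, m)) : D x -> A *m t1 x = 0 -> A *m t2 x = 0 ->
  A *m shear x = 0 /\ A *m Q x = 0.
Proof.
move=> Dx E1 E2; suff E : A *m shear x = 0.
  by split=> //; rewrite -shearJ// mulmxA E mul0mx.
by rewrite /shear mulmxDr (mulmxA A (t1 x)) (mulmxA A (t2 x)) E1 E2 !mul0mx addr0.
Qed.

Lemma shear_metric x : D x ->
  shear x *m g x = t1 x *m (t1 x)^T + t2 x *m (t2 x)^T.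
Proof.
move=> Dx; rewrite (theta1_tr xi kahler)// (theta2_tr xi kahler)// /shear mulmxDl.
by rewrite -(mulmxA (t1 x)) -(mulmxA (t2 x)).
Qed.

Lemma turn_metric x : D x ->
  Q x *m g x = t1 x *m (t2 x)^T - t2 x *m (t1 x)^T.
Proof.
move=> Dx; rewrite (theta1_tr xi kahler)// (theta2_tr xi kahler)// /turn mulmxBl.
by rewrite -(mulmxA (t1 x)) -(mulmxA (t2 x)).
Qed.

Let a x v := (v *m t1 x : 'M[R]_1) 0 0.
Let b x v := (v *m t2 x : 'M[R]_1) 0 0.

Let dt1 x v : D x -> is_cov x v (levi x v) t1 0 (a x v *: t1 x - b x v *: t2 x).
Proof.
move=> Dx; have := theta1_derive oD kahler homog linear_type xi_smooth xi_null zeta0 v Dx.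
by rewrite [v *m t1 x]mx11_scalar [v *m t2 x]mx11_scalar !mul_mx_scalar.
Qed.

Let dt2 x v : D x -> is_cov x v (levi x v) t2 0 (a x v *: t2 x + b x v *: t1 x).
Proof.
move=> Dx; have := theta2_derive oD kahler homog linear_type xi_smooth xi_null zeta0 v Dx.
by rewrite [v *m t1 x]mx11_scalar [v *m t2 x]mx11_scalar !mul_mx_scalar.
Qed.

Lemma shear_derive x v : D x ->
  is_cov x v (levi x v) shear (levi x v) ((2 * a x v) *: shear x).
Proof.
move=> Dx.
have d1 := xi_derive oD kahler homog linear_type xi_smooth xi_null zeta0 v Dx.
have d2 := xiJ_derive oD kahler homog linear_type xi_smooth xi_null zeta0 v Dx.
have := cov_add (cov_mul (dt1 v Dx) d1) (cov_mul (dt2 v Dx) d2).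
rewrite [v *m t1 x]mx11_scalar [v *m t2 x]mx11_scalar !mul_scalar_mx -/(a x v) -/(b x v).
rewrite /is_cov /shear; move: (a x v) (b x v) (levi x v) => p q L.
move=> H; apply: (is_derive_eq H); congr (_ + _).
move: (t1 x) (t2 x) (xi x *m J x) (xi x) => u1 u2 y1 y2; mxlinear.
Qed.

Lemma turn_derive x v : D x ->
  is_cov x v (levi x v) Q (levi x v) ((2 * a x v) *: Q x).
Proof.
move=> Dx; have := cov_mul (shear_derive v Dx) (levi_civita_J kahler v Dx).
rewrite -scalemxAl shearJ// mulmx0 addr0 /is_cov => H.
apply: (is_derive_eq (near_eq_is_derive _ H)) => //; last by rewrite -shearJ.
by apply: filterS (open_nbhs_nbhs (conj oD Dx)) => y Dy; rewrite shearJ.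
Qed.

(** The correction to the Levi-Civita connection is [- c] times the real part
    of [phi^2 (x) (xi - i J xi)] with [phi = theta1 + i theta2]: symmetric, hence
    without torsion, and complex linear. *)
Definition flat_form i x : 'M[R]_m :=
  christoffel g x i - c *: (t1 x i 0 *: shear x + t2 x i 0 *: Q x).

Lemma flat_formE x v : oneform flat_form x v =
  levi x v - c *: (a x v *: shear x + b x v *: Q x).
Proof.
rewrite /oneform /flat_form -lincombB; congr (_ - _).
have E (t : 'cV[R]_m) : (v *m t) 0 0 = \sum_i v 0 i * t i 0 by rewrite mxE.
rewrite /a /b !E /lincomb !scaler_suml -big_split /= scaler_sumr; apply: eq_bigr => i _.
move: (t1 x i 0) (t2 x i 0) (v 0 i) (shear x) (Q x) => p q s A T.
by apply/matrixP => j l; rewrite !mxE; ring.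
Qed.

Lemma shear_smooth : smooth_on D shear.
Proof.
move=> k; apply: (CkD oD); first exact: (Ck_mulmx oD (t1S k) (xi_smooth k)).
exact: (Ck_mulmx oD (t2S k) (Ck_mulmx oD (xi_smooth k) (JS k))).
Qed.

Lemma flat_form_smooth i : smooth_on D (flat_form i).
Proof.
move=> k; apply: (CkB oD); first exact: (christoffel_smooth oD kahler).
apply: (Ck_scale oD (Ck_cst k D c)); apply: (CkD oD).
  exact: (Ck_scale oD (Ck_entry i 0 oD (t1S k)) (shear_smooth k)).
exact: (Ck_scale oD (Ck_entry i 0 oD (t2S k)) (turn_smooth oD kahler xi_smooth k)).
Qed.

Lemma mulmx_rank1 n (p : 'rV[R]_n) (t : 'cV[R]_n) (y : 'rV[R]_n) :
  p *m (t *m y) = (p *m t) 0 0 *: y.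
Proof. by rewrite mulmxA mul_mx11. Qed.

Lemma flat_torsion x u v : D x ->
  v *m oneform flat_form x u = u *m oneform flat_form x v.
Proof.
move=> Dx; rewrite !flat_formE !mulmxBr (torsion_free oD kahler v u Dx); congr (_ - _).
have E p q : p *m (c *: (a x q *: shear x + b x q *: Q x)) =
    c *: ((a x q * a x p - b x q * b x p) *: xi x
      + (a x q * b x p + b x q * a x p) *: (xi x *m J x)).
  rewrite -scalemxAr mulmxDr -!scalemxAr /shear /turn mulmxDr mulmxBr.
  rewrite !mulmx_rank1 -/(a x p) -/(b x p).
  move: (a x p) (b x p) (a x q) (b x q) (xi x) (xi x *m J x) => p1 p2 p3 p4 y1 y2.
  by apply/matrixP => i j; rewrite !mxE; ring.
by rewrite !E [a x u * a x v]mulrC [b x u * b x v]mulrC [a x u * b x v]mulrC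
  [b x u * a x v]mulrC [b x v * _ + _]addrC.
Qed.

(** The quadratic terms vanish because [shear] and [turn] annihilate
    [theta1] and [theta2]; as [theta1] and [theta2] are closed, what remains
    is [riemann - 2 c area (x) turn]. *)
Lemma flat_curvature x u v : D x ->
  doneform flat_form x u v - doneform flat_form x v u
  + oneform flat_form x v *m oneform flat_form x u
  - oneform flat_form x u *m oneform flat_form x v = 0.
Proof.
move=> Dx.
pose da u (v : 'rV[R]_m) := v *m (levi x u *m t1 x + (a x u *: t1 x - b x u *: t2 x)).
pose db u (v : 'rV[R]_m) := v *m (levi x u *m t2 x + (a x u *: t2 x + b x u *: t1 x)).
have dE p q : doneform flat_form x p q =
    doneform (fun i y => christoffel g y i) x p q
    - c *: (da p q 0 0 *: shear x + a x q *: (levi x p *m shear x - shear x *m levi x p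
         + (2 * a x p) *: shear x)
      + (db p q 0 0 *: Q x + b x q *: (levi x p *m Q x - Q x *m levi x p
         + (2 * a x p) *: Q x))).
  apply: (is_derive_unique (is_derive_oneform flat_form_smooth p q Dx)).
  rewrite (_ : (fun y => _) = fun y => levi y q - c *: (a y q *: shear y + b y q *: Q y));
    last by rewrite funeqE => y; exact: flat_formE.
  have ad : is_derive x p (fun y => a y q) (da p q 0 0).
    have := dt1 p Dx; rewrite /is_cov mulmx0 subr0 => H.
    have := is_derive_mulmx (is_derive_cst q x p) H.
    by rewrite mul0mx add0r => /is_derive_mxP; exact.
  have bd : is_derive x p (fun y => b y q) (db p q 0 0).
    have := dt2 p Dx; rewrite /is_cov mulmx0 subr0 => H.
    have := is_derive_mulmx (is_derive_cst q x p) H.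
    by rewrite mul0mx add0r => /is_derive_mxP; exact.
  have H := is_deriveD (is_derive_scale ad (shear_derive p Dx)) (is_derive_scale bd (turn_derive p Dx)).
  exact: (is_deriveB (levi_civita_derive oD kahler p q Dx) (is_deriveZ c H)).
have da_sym : da u v = da v u.
  have := closed_form1 (t1 x) (t2 x) (torsion_free oD kahler v u Dx).
  by rewrite /da [u *m t1 x]mx11_scalar [u *m t2 x]mx11_scalar [v *m t1 x]mx11_scalar
    [v *m t2 x]mx11_scalar !mul_mx_scalar.
have db_sym : db u v = db v u.
  have := closed_form2 (t1 x) (t2 x) (torsion_free oD kahler v u Dx).
  by rewrite /db [u *m t1 x]mx11_scalar [u *m t2 x]mx11_scalar [v *m t1 x]mx11_scalar
    [v *m t2 x]mx11_scalar !mul_mx_scalar.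
have [PP PQ] := mul_shear0 Dx (shear_theta1 Dx) (shear_theta2 Dx).
have [QP QQ] := mul_shear0 Dx (turn_theta1 Dx) (turn_theta2 Dx).
rewrite !dE da_sym db_sym !flat_formE.
have := curv Dx u v; rewrite riemannE /area /omega -/(a x u) -/(b x v) -/(a x v) -/(b x u).
set N := doneform (fun i y => christoffel g y i) x.
move: (da v u 0 0) (db v u 0 0) (a x u) (a x v) (b x u) (b x v) => d1 d2 a1 a2 b1 b2.
move: PP PQ QP QQ (levi x u) (levi x v) (N u v) (N v u).
move: (shear x) (Q x) => P T PP PQ QP QQ L1 L2 N1 N2 E.
have E0 : N1 - N2 + L2 *m L1 - L1 *m L2 - (2 * c * (a1 * b2 - b1 * a2)) *: T = 0.
  by rewrite E subrr.
rewrite -E0.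
rewrite ?(mulmxDl, mulmxDr, mulNmx, mulmxN) -?(scalemxAl, scalemxAr).
rewrite ?(mulmxDl, mulmxDr, mulNmx, mulmxN) -?(scalemxAl, scalemxAr) PP PQ QP QQ.
mxlinear.
Qed.


Lemma flat_J x v : D x ->
  is_derive x v J (oneform flat_form x v *m J x - J x *m oneform flat_form x v).
Proof.
move=> Dx; apply: (is_derive_eq (levi_civita_J kahler v Dx)).
rewrite addr0 flat_formE mulmxBl mulmxBr -scalemxAl -scalemxAr mulmxDl mulmxDr.
rewrite -!scalemxAl -!scalemxAr Jshear// shearJ//.
have -> : Q x *m J x = J x *m Q x by rewrite -{1}Jshear// -mulmxA shearJ.
by rewrite opprB addrA subrK.
Qed.

Lemma flat_theta1 x v : D x -> is_derive x v t1
  (oneform flat_form x v *m t1 x + (a x v *: t1 x - b x v *: t2 x)).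
Proof.
move=> Dx; apply: (is_derive_eq (dt1 v Dx)).
rewrite flat_formE mulmxBl -scalemxAl mulmxDl -!scalemxAl.
by rewrite shear_theta1// turn_theta1// !scaler0 addr0 scaler0 mulmx0.
Qed.

Lemma flat_theta2 x v : D x -> is_derive x v t2
  (oneform flat_form x v *m t2 x + (a x v *: t2 x + b x v *: t1 x)).
Proof.
move=> Dx; apply: (is_derive_eq (dt2 v Dx)).
rewrite flat_formE mulmxBl -scalemxAl mulmxDl -!scalemxAl.
by rewrite shear_theta2// turn_theta2// !scaler0 addr0 scaler0 mulmx0.
Qed.

(** Subtracting [c |phi|^2] from [g] compensates the change of connection. *)
Definition flat_metric x : 'M[R]_m :=
  g x - c *: (t1 x *m (t1 x)^T + t2 x *m (t2 x)^T).

Lemma flat_metric_parallel x v : D x -> is_derive x v flat_metric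
  (oneform flat_form x v *m flat_metric x
   + flat_metric x *m (oneform flat_form x v)^T).
Proof.
move=> Dx; have d1 := flat_theta1 v Dx; have d2 := flat_theta2 v Dx.
have dg := levi_civita_metric oD kahler v Dx.
apply: (is_derive_eq (is_deriveB dg (is_deriveZ c (is_deriveD
  (is_derive_mulmx d1 (is_derive_trmx d1)) (is_derive_mulmx d2 (is_derive_trmx d2)))))).
set O := oneform flat_form x v.
have LE : levi x v - O = c *: (a x v *: shear x + b x v *: Q x).
  by rewrite /O flat_formE subKr.
have E : (levi x v - O) *m g x + g x *m (levi x v - O)^T =
    (2 * c * a x v) *: (t1 x *m (t1 x)^T + t2 x *m (t2 x)^T).
  have -> : g x *m (levi x v - O)^T = ((levi x v - O) *m g x)^T.
    by rewrite [RHS]trmx_mul gsym.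
  rewrite LE -scalemxAl mulmxDl -!scalemxAl shear_metric// turn_metric//.
  move: (t1 x) (t2 x) (a x v) (b x v) => p q y z.
  by apply/matrixP => i k; rewrite !mxE !big_ord1 !mxE; ring.
have EL : levi x v *m g x + g x *m (levi x v)^T = O *m g x + g x *m O^T
    + (2 * c * a x v) *: (t1 x *m (t1 x)^T + t2 x *m (t2 x)^T).
  rewrite -E raddfB /=; mxlinear.
rewrite addr0 mulmxN opprK EL /flat_metric.
clear LE E EL d1 d2; clearbody O.
move: (a x v) (b x v) (t1 x) (t2 x) (g x) O => p q u1 u2 G O1.
have sq (A A' : 'M[R]_m) (u w : 'cV[R]_m) : A *m (u *m w^T) + u *m w^T *m A'^T =
    A *m u *m w^T + u *m (A' *m w)^T by rewrite trmx_mul !mulmxA.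
rewrite [RHS](_ : _ = O1 *m G + G *m O1^T - c *: ((O1 *m u1 *m u1^T + u1 *m (O1 *m u1)^T)
  + (O1 *m u2 *m u2^T + u2 *m (O1 *m u2)^T))).
  move: (O1 *m u1) (O1 *m u2) (O1 *m G) (G *m O1^T) => y1 y2 y3 y4.
  by apply/matrixP => i k; rewrite !mxE !big_ord1 !mxE; ring.
by rewrite -!sq; mxlinear.
Qed.


(** The derivative of the last equation of [flat_coordinates] is linear in
    the equation itself. *)
Lemma coframe_algebra (T1 T2 : 'cV[R]_m) (V : 'rV[R]_m) (p q : R) (W : 'rV[R]_2)
    (j : 'M[R]_2) (O U : 'M[R]_m) (N : 'M[R]_(m, 2)) :
  V *m T1 = p%:M -> V *m T2 = q%:M -> j *m j = - 1%:M ->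
  (O *m T1 + (p *: T1 - q *: T2)) *m W + T1 *m (V *m U *m N)
  + (((O *m T2 + (p *: T2 + q *: T1)) *m W + T2 *m (V *m U *m N)) *m j)
  + O *m U *m N =
  O *m (T1 *m W + T2 *m W *m j + U *m N)
  + T1 *m V *m (T1 *m W + T2 *m W *m j + U *m N)
  + T2 *m V *m (T1 *m W + T2 *m W *m j + U *m N) *m j.
Proof.
move=> VT1 VT2 jj.
have A1 (T : 'cV[R]_m) : T *m V *m (T1 *m W) = p *: (T *m W).
  by rewrite -mulmxA (mulmxA V) VT1 mul_scalar_mx scalemxAr.
have A2 (T : 'cV[R]_m) : T *m V *m (T2 *m W *m j) = q *: (T *m W *m j).
  by rewrite -!mulmxA (mulmxA V) VT2 mul_scalar_mx -scalemxAr.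
have A3 (A : 'M[R]_(m, 2)) : A *m j *m j = - A by rewrite -mulmxA jj mulmxN mulmx1.
rewrite ![T1 *m V *m (_ + _)]mulmxDr ![T2 *m V *m (_ + _)]mulmxDr !A1 !A2.
rewrite !mulmxDl -?(scalemxAl _ _ j) A3.
mxlinear.
Qed.

(** Both sides are parallel for the flat connection, hence agree near [x0] as
    soon as they agree at [x0]. The last equation says that, up to the complex
    structure [j] of the plane, [theta1 + i theta2 = - dw / w]. *)
Lemma flat_coordinates x0 (f0 : 'rV[R]_m) (U0 J0 G0 : 'M[R]_m) (N : 'M[R]_(m, 2))
    (j : 'M[R]_2) :
  D x0 -> U0 \in unitmx -> J x0 *m U0 = U0 *m J0 ->
  flat_metric x0 = U0 *m G0 *m U0^T -> j *m j = - 1%:M ->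
  t1 x0 *m (f0 *m N) + t2 x0 *m (f0 *m N) *m j + U0 *m N = 0 ->
  exists r F U, [/\ 0 < r, forall x, `|x - x0| < r -> D x,
    F x0 = f0,
    smooth_on [set x | `|x - x0| < r] F /\ smooth_on [set x | `|x - x0| < r] U &
    forall x, `|x - x0| < r ->
      [/\ U x \in unitmx, forall v, is_derive x v F (v *m U x),
        J x *m U x = U x *m J0, flat_metric x = U x *m G0 *m (U x)^T &
        t1 x *m (F x *m N) + t2 x *m (F x *m N) *m j + U x *m N = 0]].
Proof.
move=> Dx0 U0u JU0 GU0 jj psi0.
have [r1 [F [U [r10 r1D [F0 U0E] [FS US] FU]]]] :=
  affine_coordinates oD flat_form_smooth flat_torsion flat_curvature f0 U0 Dx0.
have [r2 [K [r20 K0 _ OK _]]] := oneform_bounds oD flat_form_smooth Dx0.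
have [r3 [K1 [r30 K10 _ tK1 _]]] := smooth_lipschitz oD Dx0 t1S.
have [r4 [K2 [r40 K20 _ tK2 _]]] := smooth_lipschitz oD Dx0 t2S.
pose r := Num.min (Num.min r1 r2) (Num.min r3 r4).
have r0 : 0 < r by rewrite !lt_min r10 r20 r30.
have rP x : `|x - x0| < r -> [/\ `|x - x0| < r1, `|x - x0| < r2,
    `|x - x0| < r3 & `|x - x0| < r4].
  by rewrite !lt_min => /andP[/andP[? ?] /andP[? ?]].
pose O := oneform flat_form.
have dU x v : `|x - x0| < r -> is_derive x v U (O x v *m U x).
  by move=> /rP[xr _ _ _]; have [_] := FU x v xr.
have dF x v : `|x - x0| < r -> is_derive x v F (v *m U x).
  by move=> /rP[xr _ _ _]; have [] := FU x v xr.
have rD x : `|x - x0| < r -> D x by move=> /rP[/r1D].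
have Ob x v : `|x - x0| < r -> `|O x v| <= K * `|v|.
  by move=> /rP[_ xr _ _]; exact: OK.
have B1 := @open_dist R 'rV[R]_m x0 r1.
have oB := @open_dist R 'rV[R]_m x0 r.
have sub1 : [set x | `|x - x0| < r] `<=` [set x | `|x - x0| < r1] by move=> x /rP[].
have sub : [set x | `|x - x0| < r] `<=` D by move=> x /rD.
have US' k : Ck k [set x | `|x - x0| < r] U := Ck_sub sub1 (US k).
have FS' k : Ck k [set x | `|x - x0| < r] F := Ck_sub sub1 (FS k).
have cst k p q (A : 'M[R]_(p, q)) : Ck k [set x | `|x - x0| < r] (fun=> A) by exact: Ck_cst.
have [s1 s10 E1] : exists2 s, 0 < s & forall x, `|x - x0| < s ->
    J x *m U x - U x *m J0 = 0.
  apply: (vanish_near (C := m%:R * K) r0).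
  - by rewrite U0E JU0 subrr.
  - move=> x xr; apply: (smooth_differentiable _ xr) => k.
    exact: (CkB oB (Ck_mulmx oB (Ck_sub sub (JS k)) (US' k)) (Ck_mulmx oB (US' k) (cst k _ _ J0))).
  move=> x v xr; have Dx := rD x xr.
  have [_ ->] := is_deriveB (is_derive_mulmx (flat_J v Dx) (dU x v xr))
    (is_derive_mulmx (dU x v xr) (is_derive_cst J0 x v)).
  rewrite [X in `|X|](_ : _ = O x v *m (J x *m U x - U x *m J0)).
    by apply: le_trans (mulmx_norm_le _ _) _; rewrite -!mulrA !ler_wpM2l// mulrA ler_wpM2r// Ob.
  by rewrite -/(O x v); mxlinear.
have [s2 s20 E2] : exists2 s, 0 < s & forall x, `|x - x0| < s ->
    flat_metric x - U x *m G0 *m (U x)^T = 0.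
  apply: (vanish_near (C := 2 * (m%:R * K)) r0).
  - by rewrite U0E GU0 subrr.
  - move=> x xr; apply: (smooth_differentiable _ xr) => k.
    apply: (CkB oB); last first.
      exact: (Ck_mulmx oB (Ck_mulmx oB (US' k) (cst k _ _ G0)) (Ck_trmx oB (US' k))).
    apply: (CkB oB (Ck_sub sub (gS k))); apply: (Ck_scale oB (Ck_cst k _ c)).
    have sq (t : 'rV[R]_m -> 'cV[R]_m) : smooth_on D t ->
        Ck k [set x | `|x - x0| < r] (fun x => t x *m (t x)^T).
      by move=> tS; exact: (Ck_mulmx oB (Ck_sub sub (tS k)) (Ck_trmx oB (Ck_sub sub (tS k)))).
    exact: (CkD oB (sq _ t1S) (sq _ t2S)).
  move=> x v xr; have Dx := rD x xr.
  have [_ ->] := is_deriveB (flat_metric_parallel v Dx)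
    (is_derive_mulmx (is_derive_mulmx (dU x v xr) (is_derive_cst G0 x v))
      (is_derive_trmx (dU x v xr))).
  rewrite [X in `|X|](_ : _ = O x v *m (flat_metric x - U x *m G0 *m (U x)^T)
     + (flat_metric x - U x *m G0 *m (U x)^T) *m (O x v)^T); last first.
    by rewrite -/(O x v) trmx_mul; move: (flat_metric x) => Y; mxlinear.
  move: (_ - _) => Y; apply: le_trans (ler_normD _ _) _.
  have OT : `|(O x v)^T| <= K * `|v|.
    apply: mx_norm_le => [|p q]; first by rewrite mulr_ge0.
    by rewrite mxE; apply: le_trans (entry_norm_le _ _ _) (Ob x v xr).
  rewrite [leRHS](_ : _ = m%:R * (K * `|v|) * `|Y| + m%:R * `|Y| * (K * `|v|)); last by ring.
  apply: lerD; apply: le_trans (mulmx_norm_le _ _) _.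
    by rewrite ler_wpM2r// ler_wpM2l// Ob.
  by rewrite ler_wpM2l// mulr_ge0.
pose w x := F x *m N.
have [s3 s30 E3] : exists2 s, 0 < s & forall x, `|x - x0| < s ->
    t1 x *m w x + t2 x *m w x *m j + U x *m N = 0.
  apply: (vanish_near (C := m%:R * K + m%:R * K1 + 2 * (m%:R * K2) * `|j|) r0).
  - by rewrite /w F0 U0E.
  - move=> x xr; apply: (smooth_differentiable _ xr) => k.
    have wS := Ck_mulmx oB (FS' k) (cst k _ _ N).
    apply: (CkD oB (CkD oB (Ck_mulmx oB (Ck_sub sub (t1S k)) wS)
      (Ck_mulmx oB (Ck_mulmx oB (Ck_sub sub (t2S k)) wS) (cst k _ _ j)))
      (Ck_mulmx oB (US' k) (cst k _ _ N))).
  move=> x v xr; have Dx := rD x xr.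
  have dw := is_derive_mulmx (dF x v xr) (is_derive_cst N x v).
  have [_ ->] := is_deriveD (is_deriveD (is_derive_mulmx (flat_theta1 v Dx) dw)
    (is_derive_mulmx (is_derive_mulmx (flat_theta2 v Dx) dw) (is_derive_cst j x v)))
    (is_derive_mulmx (dU x v xr) (is_derive_cst N x v)).
  rewrite [X in `|X|](_ : _ =
      O x v *m (t1 x *m w x + t2 x *m w x *m j + U x *m N)
      + t1 x *m v *m (t1 x *m w x + t2 x *m w x *m j + U x *m N)
      + t2 x *m v *m (t1 x *m w x + t2 x *m w x *m j + U x *m N) *m j); last first.
    have vt1 : v *m t1 x = (a x v)%:M by rewrite [LHS]mx11_scalar.
    have vt2 : v *m t2 x = (b x v)%:M by rewrite [LHS]mx11_scalar.
    by rewrite !mulmx0 !addr0; exact: coframe_algebra.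
  move: (t1 x *m w x + t2 x *m w x *m j + U x *m N) => Y.
  have t1v : `|t1 x *m v| <= K1 * `|v|.
    apply: le_trans (mulmx_norm_le _ _) _; rewrite mul1r ler_wpM2r//.
    by apply: tK1; have [] := rP x xr.
  have t2v : `|t2 x *m v| <= K2 * `|v|.
    apply: le_trans (mulmx_norm_le _ _) _; rewrite mul1r ler_wpM2r//.
    by apply: tK2; have [] := rP x xr.
  have prod (A : 'M[R]_m) k : `|A| <= k * `|v| -> `|A *m Y| <= m%:R * k * `|v| * `|Y|.
    move=> Ak; apply: le_trans (mulmx_norm_le _ _) _.
    by rewrite ler_wpM2r// -mulrA ler_wpM2l.
  rewrite !mulrDl; apply: le_trans (ler_normD _ _) _; apply: lerD.
    by apply: le_trans (ler_normD _ _) _; apply: lerD; apply: prod => //; exact: Ob.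
  apply: le_trans (mulmx_norm_le _ _) _.
  rewrite [leRHS](_ : _ = 2 * (m%:R * K2 * `|v| * `|Y|) * `|j|); last by ring.
  by rewrite ler_wpM2r// ler_wpM2l// prod.
have [s4 s40 E4] : exists2 s : R, 0 < s & forall x, `|x - x0| < s -> U x \in unitmx.
  have dc : {for x0, continuous (fun x => \det (U x))}.
    have := Ck_det oB (US' 0%N); apply; by rewrite /= subrr normr0.
  have d0 : \det (U x0) != 0 by rewrite U0E -unitfE -unitmxE.
  have /nbhs_dist[s s0 sP] : \forall x \near x0, \det (U x) != 0.
    exact: cvgr_neq0 dc d0.
  by exists s => // x /sP; rewrite unitmxE unitfE.
pose r' := Num.min r (Num.min (Num.min s1 s2) (Num.min s3 s4)).
have r'P x : `|x - x0| < r' -> [/\ `|x - x0| < r, `|x - x0| < s1,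
    `|x - x0| < s2, `|x - x0| < s3 & `|x - x0| < s4].
  by rewrite !lt_min => /andP[? /andP[/andP[? ?] /andP[? ?]]].
have r'0 : 0 < r' by rewrite lt_min r0 !lt_min s10 s20 s30.
have subr : [set x | `|x - x0| < r'] `<=` [set x | `|x - x0| < r] by move=> x /r'P[].
exists r', F, U; split=> //.
- by move=> x /r'P[/rD].
- by split=> k; [exact: Ck_sub subr (FS' k)|exact: Ck_sub subr (US' k)].
move=> x /r'P[x1 x2 x3 x4 x5]; split.
- exact: E4.
- by move=> v; exact: dF.
- by have /eqP := E1 x x2; rewrite subr_eq0 => /eqP.
- by have /eqP := E2 x x3; rewrite subr_eq0 => /eqP.
- exact: E3.
Qed.

End FlatConnection.

(** * Normal form of a Hermitian metric with a null vector *)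

Section HermitianNormalForm.
Variables (R : realType) (m : nat) (G J : 'M[R]_m).
Hypotheses (Gsym : G^T = G) (Gunit : G \in unitmx).
Hypotheses (JJ : J *m J = - 1%:M) (Gherm : J *m G *m J^T = G).

Local Notation b := (bil G).

Lemma bilC x y : b x y = b y x.
Proof. by rewrite /bil -[x *m G *m y^T]trmx11 !trmx_mul trmxK Gsym mulmxA. Qed.

Lemma bilDr x y z : b x (y + z) = b x y + b x z.
Proof. by rewrite bilC bilDl !(bilC x). Qed.

Lemma bilZr a x y : b x (a *: y) = a * b x y.
Proof. by rewrite bilC bilZl (bilC x). Qed.

Lemma bil_suml (I : finType) (F : I -> 'rV[R]_m) y :
  b (\sum_i F i) y = \sum_i b (F i) y.
Proof. by rewrite /bil !mulmx_suml summxE. Qed.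

Lemma bilJ x y : b (x *m J) (y *m J) = b x y.
Proof. by rewrite /bil -[in RHS]Gherm trmx_mul !mulmxA. Qed.

Lemma bilJl x y : b (x *m J) y = - b x (y *m J).
Proof.
have := bilJ x (y *m J); rewrite -mulmxA JJ mulmxN mulmx1 => <-.
by rewrite -[- y]scaleN1r bilZr mulN1r opprK.
Qed.

Lemma bil_selfJ x : b x (x *m J) = 0.
Proof. by have := bilJl x x; rewrite bilC; lra. Qed.

(** [v 0, v 1] will span a hyperbolic plane and the other [v p] will be
    orthonormal up to the signs [e p]. *)
Definition swap01 p := if p is 0 then 1%N else if p is 1 then 0%N else p.

Lemma swap01K : involutive swap01. Proof. by case=> [|[]]. Qed.

Definition gram (e : nat -> R) p q : R := (q == swap01 p)%:R * e p.

Definition normal_family (e : nat -> R) (v : nat -> 'rV[R]_m) k :=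
  [/\ e 0%N = 1 /\ e 1%N = 1, forall p, e p = 1 \/ e p = -1,
      forall p q, (p < k)%N -> (q < k)%N -> b (v p) (v q) = gram e p q &
      forall p q, (p < k)%N -> (q < k)%N -> b (v p) (v q *m J) = 0].

Definition orthogonal_to (v : nat -> 'rV[R]_m) k x :=
  forall p, (p < k)%N -> b x (v p) = 0 /\ b x (v p *m J) = 0.

(** The conditions are [2 k < m] linear equations. *)
Lemma orthogonal_exists v k :
  (k + k < m)%N -> exists2 x, x != 0 & orthogonal_to v k x.
Proof.
move=> km; pose A := row_mx (\matrix_(i < m, p < k) (G *m (v p)^T) i 0)
  (\matrix_(i < m, p < k) (G *m (v p *m J)^T) i 0).
have : kermx A != 0.
  rewrite -mxrank_eq0 mxrank_ker -lt0n subn_gt0.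
  exact: leq_ltn_trans (rank_leq_col A) km.
move=> /rowV0Pn[x /sub_kermxP xA x0]; exists x => // p pk.
have E (i : 'I_(k + k)) : (x *m A) 0 i = 0 by rewrite xA mxE.
split.
- have := E (lshift k (Ordinal pk)); rewrite mul_mx_row row_mxEl /bil -mulmxA => <-.
  by rewrite !mxE; apply: eq_bigr => i _; rewrite !mxE.
- have := E (rshift k (Ordinal pk)); rewrite mul_mx_row row_mxEr /bil -mulmxA => <-.
  by rewrite !mxE; apply: eq_bigr => i _; rewrite !mxE.
Qed.

Lemma gram_dual e v k p q : normal_family e v k -> (1 < k)%N ->
  (p < k)%N -> (q < k)%N -> e p * b (v (swap01 p)) (v q) = (p == q)%:R.
Proof.
move=> [[e0 e1] eN vv _] k1 pk qk.
have sk : (swap01 p < k)%N by case: p pk => [|[|p]]//= _; exact: ltnW.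
have ee : e (swap01 p) = e p by case: p {pk sk} => [|[|p]]//=; rewrite e0 e1.
rewrite vv// /gram swap01K ee mulrCA eq_sym.
by case: (eN p) => ->; rewrite ?mulrNN mulr1 ?mulr1.
Qed.

(** A vector [x] orthogonal to the family is not orthogonal to all such
    vectors: project a vector [y] with [<x, y> != 0]. *)
Lemma orthogonal_nondegenerate e v k x : normal_family e v k -> (1 < k)%N ->
  x != 0 -> orthogonal_to v k x ->
  exists2 y, orthogonal_to v k y & b x y != 0.
Proof.
move=> nf k1 x0 xv.
have [y0 xy0] : exists y0, b x y0 != 0.
  have : (x *m G)^T != 0.
    apply/eqP => /(congr1 trmx); rewrite trmxK trmx0 => /(congr1 (mulmx^~ (invmx G))).
    by rewrite mulmxK// mul0mx; apply/eqP.
  move=> /col_left_inverse[y /(congr1 trmx)]; rewrite trmx_mul trmxK tr_scalar_mx => E.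
  by exists y; rewrite /bil E mxE eqxx oner_neq0.
pose d p := e p *: v (swap01 p).
pose y := y0 - \sum_(p < k) (b y0 (v p) *: d p + b y0 (v p *m J) *: (d p *m J)).
have dv p q : (p < k)%N -> (q < k)%N -> b (d p) (v q) = (p == q)%:R.
  by move=> pk qk; rewrite bilZl (gram_dual nf).
have dvJ p q : (p < k)%N -> (q < k)%N -> b (d p) (v q *m J) = 0.
  move=> pk qk; case: nf => _ _ _ vJ; rewrite bilZl vJ ?mulr0//.
  by case: p pk => [|[|p]]//= _; exact: ltnW.
have bilB z : b y z = b y0 z - \sum_(p < k)
    (b y0 (v p) * b (d p) z + b y0 (v p *m J) * b (d p *m J) z).
  rewrite /y bilDl -scaleN1r bilZl mulN1r bil_suml; congr (_ - _).
  by apply: eq_bigr => p _; rewrite bilDl !bilZl.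
exists y => [q qk|].
- split; rewrite bilB.
    rewrite (bigD1 (Ordinal qk))//= dv// eqxx bilJl dvJ// oppr0 mulr0 mulr1 addr0.
    rewrite big1 ?addr0 ?subrr// => p pq; rewrite dv// bilJl dvJ// oppr0 mulr0 addr0.
    by rewrite (negPf (_ : _ != _)) ?mulr0//; apply: contra_neq pq => pq; exact: val_inj.
  rewrite (bigD1 (Ordinal qk))//= dvJ// bilJ dv// eqxx mulr0 mulr1 add0r.
  rewrite big1 ?addr0 ?subrr// => p pq; rewrite dvJ// bilJ dv// mulr0 add0r.
  by rewrite (negPf (_ : _ != _)) ?mulr0//; apply: contra_neq pq => pq; exact: val_inj.
- rewrite bilC bilB big1 ?subr0 1?bilC// => p _.
  have sk : (swap01 p < k)%N by case: (nat_of_ord p) (ltn_ord p) => [|[|q]]//= _; exact: ltnW.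
  rewrite !bilZl -scalemxAl bilZl [X in _ * (_ * X)]bilC (proj1 (xv _ sk)).
  by rewrite [X in _ + _ * (_ * X)]bilC (proj2 (xv _ sk)) !mulr0 addr0.
Qed.

(** By polarization one of [x], [y], [x + y] is not null, where [x] and [y]
    come from [orthogonal_nondegenerate]. *)
Lemma orthogonal_unit e v k : normal_family e v k -> (1 < k)%N -> (k + k < m)%N ->
  exists2 x, orthogonal_to v k x & b x x = 1 \/ b x x = -1.
Proof.
move=> nf k1 km; have [x x0 xv] := orthogonal_exists v km.
have [y yv xy] := orthogonal_nondegenerate nf k1 x0 xv.
have [z zv zz] : exists2 z, orthogonal_to v k z & b z z != 0.
  have [xx|xx] := eqVneq (b x x) 0; last by exists x.
  have [yy|yy] := eqVneq (b y y) 0; last by exists y.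
  exists (x + y).
    move=> p pk; have [[a1 a2] [b1 b2]] := (xv p pk, yv p pk).
    by rewrite !bilDl a1 a2 b1 b2 addr0.
  rewrite bilDl !bilDr xx yy add0r addr0 (bilC y) -mulr2n -mulr_natr.
  by rewrite mulf_neq0// pnatr_eq0.
pose s := (Num.sqrt `|b z z|)^-1.
exists (s *: z); first by move=> p pk; have [h1 h2] := zv p pk; rewrite !bilZl h1 h2 mulr0.
have E : b (s *: z) (s *: z) = Num.sg (b z z).
  rewrite bilZl bilZr mulrA -expr2 /s exprVn sqr_sqrtr// {2}[bil _ _ _]numEsg.
  by rewrite mulrCA mulVf ?mulr1// normr_eq0.
rewrite E; case: sgrP => [/eqP||_]; [by rewrite (negPf zz)|by left|by right].
Qed.

Lemma normal_family_extend e v k : normal_family e v k -> (1 < k)%N -> (k + k < m)%N ->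
  exists e' v', normal_family e' v' k.+1 /\ forall p, (p < k)%N -> v' p = v p.
Proof.
move=> nf k1 km; have [x xv xx] := orthogonal_unit nf k1 km.
case: nf => [[e0 e1] eN vv vJ].
pose e' p := if p == k then b x x else e p.
pose v' p := if p == k then x else v p.
have lt_eqF p : (p < k)%N -> (p == k) = false by move=> pk; rewrite ltn_eqF.
exists e', v'; split; last by move=> p /lt_eqF; rewrite /v' => ->.
have cases p : (p < k.+1)%N -> p = k \/ (p < k)%N.
  by rewrite ltnS leq_eqVlt => /orP[/eqP|]; [left|right].
have sk : swap01 k = k by case: k k1 {km xv vv vJ e' v' lt_eqF cases} => [|[]].
have skF p : (p < k)%N -> (swap01 p == k) = false.
  move=> pk; rewrite ltn_eqF//; case: p pk => [|[|p]]//= _; exact: ltnW.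
split.
- by rewrite /e' !lt_eqF// ltnW.
- by move=> p; rewrite /e'; case: ifP.
- move=> p q /cases[->|pk] /cases[->|qk]; rewrite /v' /gram /e' ?eqxx ?lt_eqF//.
  + by rewrite sk eqxx mul1r.
  + by rewrite sk lt_eqF// mul0r; have [] := xv q qk.
  + by rewrite [k == _]eq_sym skF// mul0r bilC; have [] := xv p pk.
  + exact: vv.
- move=> p q /cases[->|pk] /cases[->|qk]; rewrite /v' ?eqxx ?lt_eqF//.
  + exact: bil_selfJ.
  + by have [] := xv q qk.
  + by have [_ E] := xv p pk; rewrite -[LHS]opprK -bilJl bilC E oppr0.
  + exact: vJ.
Qed.

(** Induction on [k]. The first plane is spanned by [xi] and by [eta] corrected
    along [xi] to a null vector. *)
Lemma normal_family_exists xi eta k :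
  b xi xi = 0 -> b eta xi = 1 -> b eta (xi *m J) = 0 ->
  (k.+2.*2 <= m)%N ->
  exists e v, normal_family e v k.+2 /\ v 1%N = xi.
Proof.
move=> xx ex exJ; elim: k => [_|k IH km].
  pose eta' := eta - (2^-1 * b eta eta) *: xi.
  have exi : b xi eta = 1 by rewrite bilC.
  have ee : b eta' eta' = 0.
    rewrite /eta' -scaleNr bilDl !bilDr !bilZl !bilZr xx ex exi; by field.
  have e1 : b eta' xi = 1 by rewrite /eta' -scaleNr bilDl bilZl xx ex mulr0 addr0.
  have eJ : b eta' (xi *m J) = 0.
    by rewrite /eta' -scaleNr bilDl bilZl exJ bil_selfJ mulr0 addr0.
  exists (fun=> 1), (fun p => if p is 0 then eta' else xi); split=> //; split=> //.
  - by left.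
  - move=> [|[|p]]// [|[|q]]// _ _; rewrite /gram /= ?eqxx ?mul1r ?mul0r//.
    by rewrite bilC.
  - move=> [|[|p]]// [|[|q]]// _ _; rewrite ?bil_selfJ//.
    by rewrite -[LHS]opprK -bilJl bilC eJ oppr0.
have [|e [v [nf v1]]] := IH; first by apply: leq_trans km; rewrite leq_double.
have [||e' [v' [nf' vv']]] := normal_family_extend nf => //.
  by rewrite addnn; apply: leq_trans km; rewrite [leqRHS]doubleS; exact: leqnSn.
by exists e', v'; split=> //; rewrite vv'.
Qed.

End HermitianNormalForm.

Section ModelFrame.
Variables (R : realType) (n : nat).
Local Notation m := n.*2.+4.

(** Index of the coordinate paired with the [i]-th one by the flat metric. *)
Definition partner i := if (i < 2)%N then i.+2 else if (i < 4)%N then i.-2 else i.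

Lemma partnerK : involutive partner.
Proof. by case=> [|[|[|[|i]]]]. Qed.

Lemma partner_lt i : (i < m)%N -> (partner i < m)%N.
Proof. by case: i => [|[|[|[|i]]]]. Qed.

Lemma partnerE i j :
  (j == partner i) = (odd i == odd j) && (j./2 == swap01 i./2).
Proof.
by case: i => [|[|[|[|i]]]]; rewrite /partner /=; lia.
Qed.

Definition flat_gram (e : nat -> R) : 'M[R]_m :=
  \matrix_(i, j) ((j == partner i :> nat)%:R * e i./2).

(** Each coordinate is paired with one other, with sign [1] or [-1]. *)
Lemma flat_gram_involutive e : e 0%N = 1 /\ e 1%N = 1 ->
  (forall p, e p = 1 \/ e p = -1) -> flat_gram e *m flat_gram e = 1%:M.
Proof.
move=> [e0 e1] eN; apply/matrixP => i k; rewrite !mxE.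
rewrite (bigD1 (Ordinal (partner_lt (ltn_ord i))))//= big1 ?addr0 => [|j ji]; last first.
  rewrite !mxE (_ : (_ == _ :> nat) = false) ?mul0r//.
  by apply/negbTE; apply: contra_neq ji => ji; exact: val_inj.
rewrite !mxE /= eqxx mul1r partnerK mulrCA.
have -> : e (partner i)./2 = e i./2.
  by rewrite /partner; case: (nat_of_ord i) => [|[|[|[|p]]]]//=; rewrite e0 e1.
have -> : e i./2 * e i./2 = 1 by case: (eN i./2) => ->; rewrite ?mulrNN mulr1.
by rewrite mulr1 eq_sym.
Qed.

Definition frame (J : 'M[R]_m) (v : nat -> 'rV[R]_m) : 'M[R]_m :=
  \matrix_(i < m) (if odd i then v i./2 *m J else v i./2).

Lemma frame_gram (G J : 'M[R]_m) e v : G^T = G -> J *m J = - 1%:M ->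
  J *m G *m J^T = G -> normal_family G J e v n.+2 ->
  frame J v *m G *m (frame J v)^T = flat_gram e.
Proof.
move=> Gsym JJ Gh [_ _ vv vJ]; apply/matrixP => i j.
have lt (k : 'I_m) : (k./2 < n.+2)%N by have := ltn_ord k; lia.
have -> : (frame J v *m G *m (frame J v)^T) i j =
    bil G (row i (frame J v)) (row j (frame J v)).
  rewrite /bil -!row_mul !mxE; apply: eq_bigr => k _; congr (_ * _).
  by rewrite !mxE.
rewrite /frame !rowK mxE partnerE.
case: ifP => oi; case: ifP => oj /=.
- by rewrite bilJ// vv.
- by rewrite bilJl// vJ// oppr0 mul0r.
- by rewrite vJ// mul0r.
- by rewrite vv.
Qed.

Lemma frame_J (J : 'M[R]_m) v x : J *m J = - 1%:M ->
  frame J v *m J = @standard_J R n x *m frame J v.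
Proof.
move=> JJ; apply/row_matrixP => i; rewrite !row_mul rowK.
case: ifP => oi.
  have i0 : (i.-1 < m)%N by have := ltn_ord i; lia.
  have -> : row i (@standard_J R n x) = - delta_mx 0 (Ordinal i0).
    apply/rowP => j; rewrite !mxE oi eqxx /=; congr (- _%:R).
    by rewrite -val_eqE /=; move: oi; case: (nat_of_ord i) => //= k _; rewrite eqSS eq_sym.
  rewrite mulNmx -rowE rowK /= -mulmxA JJ mulmxN mulmx1; congr (- _).
  by move: oi; case: (nat_of_ord i) => //= k ok; rewrite (negPf ok) uphalf_half (negPf ok).
have i1 : (i.+1 < m)%N by have := ltn_ord i; lia.
have -> : row i (@standard_J R n x) = delta_mx 0 (Ordinal i1).
  by apply/rowP => j; rewrite !mxE oi eqxx /= -val_eqE.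
by rewrite -rowE rowK /= oi /= uphalf_half oi.
Qed.

(** The metric of the model in terms of the pairing of the coordinates. *)
Lemma model_metricE (e : nat -> R) (h : 'rV[R]_2 -> R) x : e 0%N = 1 /\ e 1%N = 1 ->
  model_metric (fun a : 'I_n => e a.+2) h (fun _ _ => 0) (fun _ _ => 0) x =
  flat_gram e + h (wpart x) *: (delta_mx (cw1 n) (cw1 n) + delta_mx (cw2 n) (cw2 n)).
Proof.
move=> [e0 e1]; rewrite /model_metric.
rewrite [X in _ + X + _ + _]big1 => [|a _]; last by rewrite scale0r.
rewrite [X in _ + X + _]big1 => [|a _]; last by rewrite scale0r.
rewrite !addr0 /dd !eqxx addrAC; congr (_ + _).
have ord k (kn : (k < m)%N) (i : 'I_m) : (i == inord k) = (i == k :> nat).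
  by rewrite -val_eqE /= inordK.
have neq a c : (a < m)%N -> (c < m)%N -> a != c -> (inord a == inord c :> 'I_m) = false.
  by move=> am cm ac; rewrite -val_eqE /= !inordK//; exact: negbTE.
rewrite /cw1 /cz1 /cw2 /cz2 !neq//.
apply/matrixP => i j; rewrite !mxE summxE !ord//.
have term (a : 'I_n) : ((e a.+2 *: ((if cx a == cx a then delta_mx (cx a) (cx a)
      else delta_mx (cx a) (cx a) + delta_mx (cx a) (cx a)) +
     (if cy a == cy a then delta_mx (cy a) (cy a)
      else delta_mx (cy a) (cy a) + delta_mx (cy a) (cy a)))) : 'M[R]_m) i j
    = e a.+2 * ((i == j :> nat) && (i./2 == a.+2))%:R.
  have an := ltn_ord a; have x4 : (4 + a.*2 < m)%N by lia.
  have y5 : (5 + a.*2 < m)%N by lia.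
  rewrite !eqxx !mxE /cx /cy !(ord _ x4) !(ord _ y5).
  by congr (_ * _); rewrite -natrD; congr _%:R; lia.
rewrite (eq_bigr _ (fun a _ => term a)).
have [i4|i4] := ltnP i 4.
  rewrite big1 ?addr0 => [|a _]; last first.
    by rewrite (_ : (_ == a.+2) = false) ?andbF ?mulr0//; lia.
  move: (nat_of_ord i) (nat_of_ord j) i4 => [|[|[|[|k]]]]//= l _;
  by rewrite ?e0 ?e1 mulr1 ?addr0 ?add0r.
have ia : (i./2 - 2 < n)%N by have := ltn_ord i; lia.
rewrite (bigD1 (Ordinal ia))//= big1 ?addr0 => [|a aia]; last first.
  rewrite (_ : (_ == a.+2) = false) ?andbF ?mulr0//.
  by apply/negbTE; apply: contra_neq aia => E; apply: val_inj => /=; lia.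
have -> : ((i./2 - 2).+2 = i./2)%N by lia.
have -> : partner i = i by rewrite /partner; case: (nat_of_ord i) i4 => [|[|[|[|k]]]].
have nk k : (k < 4)%N -> (nat_of_ord i == k) = false by move=> k4; lia.
by rewrite eqxx andbT (nk 0%N)// (nk 1%N)// (nk 2%N)// (nk 3%N)//= !add0r mulrC eq_sym.
Qed.

End ModelFrame.

(** * The potential [c / |w|^2] *)

Section RadialPotential.
Variables (R : realType) (k : nat) (i j : 'I_k).
Implicit Types x v : 'rV[R]_k.

Definition sqnorm x : R := x 0 i ^+ 2 + x 0 j ^+ 2.

Lemma is_derive_coord x v l : is_derive x v (fun y : 'rV[R]_k => y 0 l) (v 0 l).
Proof. by have /is_derive_mxP := is_derive_id x v; exact. Qed.

Lemma sqnorm_derive x v :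
  is_derive x v sqnorm (2 * (x 0 i * v 0 i + x 0 j * v 0 j)).
Proof.
have sq l := is_deriveM (is_derive_coord x v l) (is_derive_coord x v l).
apply: (is_derive_eq (is_deriveD (sq i) (sq j))).
rewrite /GRing.scale /=; ring.
Qed.

Lemma sqnorm_inv_derive c x v : sqnorm x != 0 ->
  is_derive x v (fun y => c / sqnorm y)
    (- (2 * c) * (x 0 i * v 0 i + x 0 j * v 0 j) / sqnorm x ^+ 2).
Proof.
move=> x0; have qd := sqnorm_derive x v.
have iq : is_derive x v (fun y => (sqnorm y)^-1) (- (sqnorm x) ^- 2 *
    (2 * (x 0 i * v 0 i + x 0 j * v 0 j))).
  apply: DeriveDef; first by apply: derivableV => //; case: qd.
  by rewrite deriveV//; case: qd => // _ ->.
apply: (is_derive_eq (is_deriveZ c iq)).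
by rewrite /GRing.scale /=; field.
Qed.

Lemma sqnorm_smooth : smooth_on setT sqnorm.
Proof.
move=> n; have H l : Ck n setT (fun y : 'rV[R]_k => y 0 l).
  apply: (Ck_entry 0 l openT); case: n => [|n] /=; first by move=> x _; exact: cvg_id.
  split=> [x _|v]; first by have [] := is_diff_id x.
  rewrite (_ : 'D_v _ = fun=> v); first exact: Ck_cst.
  by rewrite funeqE => x; have [_] := is_derive_id x v.
exact: (CkD openT (CkM openT (H i) (H i)) (CkM openT (H j) (H j))).
Qed.

Lemma sqnorm_neq0_open : open [set x | sqnorm x != 0].
Proof.
have c : continuous sqnorm.
  by move=> x; apply: (sqnorm_smooth 0%N).
by apply: (@open_comp _ _ sqnorm [set y | y != 0]) => //; exact: open_neq.
Qed.

Lemma sqnorm_inv_smooth c :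
  smooth_on [set x | sqnorm x != 0] (fun x => c / sqnorm x).
Proof.
move=> n; apply: (CkM sqnorm_neq0_open (Ck_cst _ _ c)).
apply: (CkV sqnorm_neq0_open) => //.
by apply: Ck_sub (sqnorm_smooth n).
Qed.

End RadialPotential.

(** Each second derivative is [- 2 c / |w|^4 + 8 c w_l^2 / |w|^6]; the two sum to
    [4 c / |w|^4]. *)
Lemma laplacian_radial (R : realType) (c : R) (w : 'rV[R]_2) :
  sqnorm 0 1 w != 0 ->
  laplacian (fun w => c / sqnorm 0 1 w) w = 4 * c / (w 0 0 ^+ 2 + w 0 1 ^+ 2) ^+ 2.
Proof.
move=> w0; rewrite /laplacian -/(sqnorm 0 1 w).
have second (l : 'I_2) : pd l (pd l (fun w => c / sqnorm 0 1 w)) w =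
    - (2 * c) / sqnorm 0 1 w ^+ 2 + 8 * c * w 0 l ^+ 2 / sqnorm 0 1 w ^+ 3.
  have nbh : \forall y \near w, sqnorm 0 1 y != 0.
    exact: (open_nbhs_nbhs (conj (@sqnorm_neq0_open R 2 0 1) w0)).
  have coord (y : 'rV[R]_2) :
      y 0 0 * (delta_mx 0 l : 'rV[R]_2) 0 0 + y 0 1 * (delta_mx 0 l : 'rV[R]_2) 0 1 = y 0 l.
    rewrite !mxE !eqxx; case: l => [[|[|//]] lt]; rewrite /= ?mulr1 ?mulr0 ?addr0 ?add0r;
    by congr (y _ _); exact: val_inj.
  have first y : sqnorm 0 1 y != 0 -> pd l (fun w => c / sqnorm 0 1 w) y =
      (c / sqnorm 0 1 y) * ((- 2 / sqnorm 0 1 y) * y 0 l).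
    move=> y0; have [_ E] := sqnorm_inv_derive c (delta_mx 0 l) y0.
    by apply: etrans E _; rewrite coord; field.
  have d1 := sqnorm_inv_derive c (delta_mx 0 l) w0.
  have d2 := sqnorm_inv_derive (- 2) (delta_mx 0 l) w0.
  have d3 := is_derive_coord w (delta_mx 0 l) l.
  have [_ E] := near_eq_is_derive (filterS (fun y y0 => esym (first y y0)) nbh)
    (is_deriveM d1 (is_deriveM d2 d3)).
  apply: etrans E _; rewrite !coord.
  transitivity (c / sqnorm 0 1 w * (- 2 / sqnorm 0 1 w * (delta_mx 0 l : 'rV[R]_2) 0 l
      + w 0 l * (- (2 * - 2) * w 0 l / sqnorm 0 1 w ^+ 2))
    + (- 2 / sqnorm 0 1 w * w 0 l) * (- (2 * c) * w 0 l / sqnorm 0 1 w ^+ 2)) => //.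
  by rewrite mxE !eqxx /=; field.
rewrite !second; move: w0; rewrite /sqnorm => w0.
by field.
Qed.

(** * The model metrics are Kähler *)

Section Model.
Variables (R : realType) (n : nat).
Local Notation m := n.*2.+4.
Local Notation J0 := (@standard_J R n 0).

(** Multiplication by [i] on row vectors [w^1, w^2]. *)
Definition rot2 : 'M[R]_2 :=
  \matrix_(k, l) if k == 0 then (l == 1)%:R else - (l == 0)%:R.

(** Selects the coordinates [w^1, w^2]. *)
Definition wsel : 'M[R]_(m, 2) := \matrix_(i, k) (i == k :> nat)%:R.

Lemma mx2P a (A B : 'M[R]_(a, 2)) :
  (forall i, A i 0 = B i 0 /\ A i 1 = B i 1) -> A = B.
Proof.
move=> H; apply/matrixP => i k; have [H0 H1] := H i.
by case: k => [[|[|//]] lt]; [move: H0|move: H1];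
  congr (A _ _ = B _ _); exact: val_inj.
Qed.

Lemma sum2 (F : 'I_2 -> R) : \sum_k F k = F 0 + F 1.
Proof.
by rewrite big_ord_recl big_ord1; congr (_ + F _); exact: val_inj.
Qed.

Lemma ord2P (P : 'I_2 -> Prop) : P 0 -> P 1 -> forall k, P k.
Proof.
move=> P0 P1 [[|[|//]] lt]; [move: P0|move: P1]; congr (P _); exact: val_inj.
Qed.

Lemma rot2_sq : rot2 *m rot2 = - 1%:M.
Proof.
by apply: mx2P; apply: ord2P; rewrite !mxE !sum2 !mxE /=; split; ring.
Qed.

Lemma rot2_orthogonal : rot2 *m rot2^T = 1%:M.
Proof.
by apply: mx2P; apply: ord2P; rewrite !mxE !sum2 !mxE /=; split; ring.
Qed.

Lemma rot2_skew (w : 'rV[R]_2) : w *m rot2 *m w^T = 0.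
Proof.
by rewrite [LHS]mx11_scalar !mxE !sum2 !mxE !sum2 !mxE /=; apply/matrixP => i k;
  rewrite !mxE; case: (_ == _); rewrite ?mulr0n// mulr1n; ring.
Qed.

(** [t] is twice the Christoffel symbol of a conformally flat metric of the
    plane, [b] being the differential of the factor; it commutes with the
    rotation since in dimension two every Hermitian metric is Kähler. *)
Lemma conformal_kahler (r : 'rV[R]_2) (b : 'cV[R]_2) :
  let t := (r *m b) 0 0 *: 1%:M + b *m r - r^T *m b^T in
  rot2 *m t + t *m rot2^T = 0.
Proof.
move=> t; apply: mx2P; apply: ord2P; split; rewrite mxE [X in X + _]mxE [X in _ + X]mxE !sum2.
- by rewrite !mxE !big_ord1 !sum2 !mxE /=; ring.
- by rewrite !mxE !big_ord1 !sum2 !mxE /=; ring.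
- by rewrite !mxE !big_ord1 !sum2 !mxE /=; ring.
- by rewrite !mxE !big_ord1 !sum2 !mxE /=; ring.
Qed.

Lemma wsel_J x : @standard_J R n x *m wsel = wsel *m rot2.
Proof.
have entries (a : nat) (k : 'I_2) : odd a -> - (a.-1 == k :> nat)%:R =
    (a == 0)%:R * (if (0 : 'I_2) == 0 then (k == 1)%:R else - (k == 0)%:R)
    + (a == 1)%:R * (if (1 : 'I_2) == 0 then (k == 1)%:R else - (k == 0)%:R) :> R.
  case: a => [|[|[|a]]]//= _; move: k; apply: ord2P => /=;
  by rewrite ?mulr0n ?mulr1n ?mul0r ?mul1r ?add0r ?addr0 ?oppr0.
have entries' (a : nat) (k : 'I_2) : ~~ odd a -> (a.+1 == k :> nat)%:R =
    (a == 0)%:R * (if (0 : 'I_2) == 0 then (k == 1)%:R else - (k == 0)%:R)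
    + (a == 1)%:R * (if (1 : 'I_2) == 0 then (k == 1)%:R else - (k == 0)%:R) :> R.
  case: a => [|[|[|a]]]//= _; move: k; apply: ord2P => /=;
  by rewrite ?mulr0n ?mulr1n ?mul0r ?mul1r ?add0r ?addr0 ?oppr0.
apply/matrixP => i k; rewrite !mxE sum2 !mxE.
case: (boolP (odd i)) => oi.
  have i0 : (i.-1 < m)%N by have := ltn_ord i; lia.
  rewrite (bigD1 (Ordinal i0))//= big1 ?addr0 => [|l li]; last first.
    rewrite !mxE oi (_ : (_ == _) = false) ?oppr0 ?mul0r//.
    by apply/negbTE; apply: contra_neq li => li; apply: val_inj => /=; lia.
  rewrite !mxE oi /= (_ : (i.-1.+1 == i) = true) ?mulN1r; last by lia.
  exact: (entries i k oi).
have i1 : (i.+1 < m)%N by have := ltn_ord i; lia.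
rewrite (bigD1 (Ordinal i1))//= big1 ?addr0 => [|l li]; last first.
  rewrite !mxE (negPf oi) (_ : (_ == _) = false) ?mul0r//.
  by apply/negbTE; apply: contra_neq li => li; exact: val_inj.
rewrite !mxE (negPf oi) eqxx mul1r.
exact: (entries' i k oi).
Qed.

Lemma wsel_gram : wsel *m wsel^T = delta_mx (cw1 n) (cw1 n) + delta_mx (cw2 n) (cw2 n).
Proof.
apply/matrixP => i k; rewrite !mxE sum2 !mxE /cw1 /cw2 -!natrM -!val_eqE /= !inordK//.
by rewrite !mulnb.
Qed.

Lemma wpart_wsel (x : 'rV[R]_m) : x *m wsel = wpart x.
Proof.
have H (a : nat) (am : (a < m)%N) (k : 'I_2) : a = k -> (x *m wsel) 0 k = x 0 (inord a).
  move=> ak; rewrite mxE (bigD1 (inord a))//= big1 => [|l li].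
    by rewrite addr0 mxE inordK// ak eqxx mulr1.
  rewrite mxE (_ : (_ == _) = false) ?mulr0//; apply/negbTE; apply: contra_neq li => li.
  by apply: val_inj; rewrite /= inordK// li ak.
apply: mx2P => i; rewrite ord1; split; rewrite [RHS]mxE /=; exact: H.
Qed.

Lemma wpart_sqnorm (x : 'rV[R]_m) :
  sqnorm 0 1 (wpart x) = sqnorm (cw1 n) (cw2 n) x.
Proof. by rewrite /sqnorm !mxE. Qed.

Variables (e : nat -> R) (c : R).

(** The model with [r = s = 0] and [b = c / |w|^2]. *)
Definition radial_metric x : 'M[R]_m :=
  flat_gram n e + (c / sqnorm (cw1 n) (cw2 n) x) *: (wsel *m wsel^T).

Local Notation V := [set x : 'rV[R]_m | sqnorm (cw1 n) (cw2 n) x != 0].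

Lemma radial_metric_smooth : smooth_on V radial_metric.
Proof.
have oV := @sqnorm_neq0_open R m (cw1 n) (cw2 n).
move=> k; apply: (CkD oV (Ck_cst k _ _)).
exact: (Ck_scale oV (sqnorm_inv_smooth (cw1 n) (cw2 n) c k) (Ck_cst k _ (wsel *m wsel^T))).
Qed.

Lemma radial_metric_pd x : V x -> exists b : 'cV[R]_2, forall i,
  pd i radial_metric x = (wsel *m b) i 0 *: (wsel *m wsel^T).
Proof.
move=> Vx; pose b : 'cV[R]_2 := (- (2 * c) / sqnorm (cw1 n) (cw2 n) x ^+ 2) *: (wpart x)^T.
exists b => i.
have [_ E] := is_deriveD (is_derive_cst (flat_gram n e) x (delta_mx 0 i))
  (is_derive_scale (sqnorm_inv_derive c (delta_mx 0 i) Vx)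
    (is_derive_cst (wsel *m wsel^T) x (delta_mx 0 i))).
apply: etrans E _; rewrite scaler0 addr0 add0r; congr (_ *: _).
rewrite /b -scalemxAr [RHS]mxE mulrAC; congr (_ * _).
rewrite !mxE sum2 !mxE /cw1 /cw2 -!val_eqE /= !inordK// ![_ == nat_of_ord i]eq_sym.
by rewrite [x 0 _ * _]mulrC [x 0 (inord 1) * _]mulrC.
Qed.

Lemma conformal_entries (A : 'M[R]_(m, 2)) (b : 'cV[R]_2) i j l :
  let r := row i A in let t := (r *m b) 0 0 *: 1%:M + b *m r - r^T *m b^T in
  2^-1 * ((A *m b) i 0 * (A *m A^T) j l + (A *m b) j 0 * (A *m A^T) i l
    - (A *m b) l 0 * (A *m A^T) i j) = (2^-1 *: (A *m t *m A^T)) j l.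
Proof.
move=> r t; rewrite [RHS]mxE; congr (_ * _).
rewrite /t /r !(mxE, sum2, big_ord1) /=; ring.
Qed.

(** The derivatives of the metric only involve [w], so the Christoffel symbols
    with lowered index come from the plane by [wsel], where
    [conformal_kahler] applies. *)
Lemma radial_metric_kahler x i : V x -> radial_metric x \in unitmx ->
  J0 *m J0 = - 1%:M -> J0 *m radial_metric x *m J0^T = radial_metric x ->
  cov11 (christoffel radial_metric) (@standard_J R n) x i = 0.
Proof.
move=> Vx gU JJ Jg; have [b pdE] := radial_metric_pd Vx.
pose r := row i wsel; pose t := (r *m b) 0 0 *: 1%:M + b *m r - r^T *m b^T.
have TE : christoffel radial_metric x i =
    2^-1 *: (wsel *m t *m wsel^T) *m invmx (radial_metric x).
  apply/matrixP => j k; rewrite !mxE; apply: eq_bigr => l _; congr (_ * _).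
  rewrite !pdE -(conformal_entries wsel b i j l) ![(_ *: (wsel *m wsel^T)) _ _]mxE.
  by [].
have Jinv : invmx (radial_metric x) *m J0 = - (J0^T *m invmx (radial_metric x)).
  have Jg' : J0 *m radial_metric x = - (radial_metric x *m J0^T).
    have : J0 *m radial_metric x *m J0^T *m J0^T = radial_metric x *m J0^T by rewrite Jg.
    by rewrite -mulmxA -trmx_mul JJ raddfN /= trmx1 mulmxN mulmx1 => <-; rewrite opprK.
  have := congr1 (fun M => invmx (radial_metric x) *m (M *m invmx (radial_metric x))) Jg'.
  by rewrite mulmxK// mulNmx mulmxN !mulmxA mulVmx// mul1mx => ->.
have pdJ : pd i (@standard_J R n) x = 0 by exact: derive_cst.
rewrite /cov11 TE pdJ add0r -[@standard_J R n x]/J0 mulmxA -(mulmxA _ (invmx _)) Jinv.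
rewrite mulmxN opprK mulmxA -mulmxDl -scalemxAr -scalemxAl -scalerDr.
have WJ : wsel^T *m J0^T = rot2^T *m wsel^T by rewrite -!trmx_mul wsel_J.
rewrite -!mulmxA WJ !mulmxA wsel_J -mulmxDl -!mulmxA -mulmxDr.
by rewrite conformal_kahler mulmx0 mul0mx scaler0 mul0mx.
Qed.

End Model.

(** * Normal coordinates near a point *)

Section NormalFrame.
Variables (R : realType) (n : nat).
Local Notation m := n.*2.+4.
Variables (D : set 'rV[R]_m) (g J : mfield R m) (xi : vfield R m) (c : R).
Hypothesis kahler : pseudo_kahler_on D g J.
Hypothesis xi_null : forall x, D x -> xi x != 0 /\ bil (g x) (xi x) (xi x) = 0.

Local Notation t1 := (theta1 g xi).
Local Notation t2 := (theta2 g J xi).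
Local Notation gh := (flat_metric g J xi c).

Lemma flat_metric_xi x : D x -> gh x *m (xi x)^T = t1 x.
Proof.
move=> Dx; rewrite /flat_metric mulmxBl -scalemxAl mulmxDl -!mulmxA -!trmx_mul.
by rewrite (xi_theta1 xi_null)// (xi_theta2 xi kahler)// !mul0mx trmx0 mulmx0 addr0 scaler0 subr0.
Qed.

Lemma flat_metric_xiJ x : D x -> gh x *m (xi x *m J x)^T = t2 x.
Proof.
move=> Dx; rewrite /flat_metric mulmxBl -scalemxAl mulmxDl.
rewrite -(mulmxA (t1 x)) -(mulmxA (t2 x)) -!(trmx_mul (xi x *m J x)).
rewrite (xiJ_theta1 xi kahler)// (xiJ_theta2 kahler xi_null)//.
by rewrite trmx0 !mulmx0 addr0 scaler0 subr0.
Qed.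

Lemma flat_metric_sym x : D x -> (gh x)^T = gh x.
Proof.
case: kahler => _ _ + _ _ => /[apply] -[gs _].
rewrite /flat_metric; move: (t1 x) (t2 x) (g x) gs => p q G gs.
by rewrite raddfB /= gs linearZ raddfD /= !trmx_mul !trmxK.
Qed.

(** [flat_metric = (1 - c shear) g] and [shear] has square zero. *)
Lemma flat_metric_unit x : D x -> gh x \in unitmx.
Proof.
move=> Dx; have [[_ gU] E] : ((g x)^T = g x /\ g x \in unitmx) /\
    gh x = (1%:M - c *: shear g J xi x) *m g x.
  split; first by case: kahler => _ _ + _ _; apply.
  by rewrite mulmxBl mul1mx -scalemxAl (shear_metric xi kahler).
rewrite E unitmx_mul gU andbT.
have [PP _] := mul_shear0 kahler Dx (shear_theta1 kahler xi_null Dx)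
  (shear_theta2 kahler xi_null Dx).
suff : (1%:M - c *: shear g J xi x) *m (1%:M + c *: shear g J xi x) = 1%:M.
  by move=> /mulmx1_unit[].
rewrite mulmxDr mulmx1 mulmxBl mul1mx -scalemxAl -scalemxAr PP !scaler0 subr0.
by rewrite subrK.
Qed.

Lemma flat_metric_herm x : D x -> J x *m gh x *m (J x)^T = gh x.
Proof.
move=> Dx; rewrite /flat_metric mulmxBr mulmxBl (hermitian kahler)//; congr (_ - _).
rewrite -scalemxAr -scalemxAl; congr (_ *: _); rewrite mulmxDr mulmxDl.
have sq (t : 'cV[R]_m) : J x *m (t *m t^T) *m (J x)^T = (J x *m t) *m (J x *m t)^T.
  by rewrite trmx_mul !mulmxA.
rewrite !sq (J_theta1 xi kahler)// (J_theta2 xi kahler)// raddfN /= mulmxN mulNmx opprK.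
by rewrite addrC.
Qed.

(** [U] is inverse to the frame of a normal family containing [xi]. As
    [xi] is [d_z1] in this frame, its dual one-forms [theta1] and [theta2] are
    [dw^1] and [dw^2], which is the initial condition [phi = - dw / w] at [w = -1]. *)
Lemma normal_frame x : D x ->
  exists e U, [/\ e 0%N = 1 /\ e 1%N = 1, forall p, e p = 1 \/ e p = -1,
    U \in unitmx /\ gh x = U *m flat_gram n e *m U^T,
    J x *m U = U *m @standard_J R n 0 &
    forall f0, f0 *m wsel R n = - delta_mx 0 0 ->
      t1 x *m (f0 *m wsel R n) + t2 x *m (f0 *m wsel R n) *m rot2 R + U *m wsel R n = 0].
Proof.
move=> Dx; have JJ : J x *m J x = - 1%:M by case: kahler => _ _ _ + _ => /(_ x Dx)[].
have gs := flat_metric_sym Dx; have gU := flat_metric_unit Dx.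
have gH := flat_metric_herm Dx.
have [eta [eta1 eta2]] := transverse kahler xi_null Dx.
have xx : bil (gh x) (xi x) (xi x) = 0.
  by rewrite /bil -mulmxA flat_metric_xi// (xi_theta1 xi_null)// mxE.
have ex : bil (gh x) eta (xi x) = 1.
  by rewrite /bil -mulmxA flat_metric_xi// eta1 mxE eqxx.
have exJ : bil (gh x) eta (xi x *m J x) = 0.
  by rewrite /bil -mulmxA flat_metric_xiJ// eta2 mxE.
have [e [v [nf v1]]] := normal_family_exists gs gU JJ gH xx ex exJ (leqnn n.+2.*2).
have [e01 eN _ _] := nf.
pose E : 'M[R]_m := frame (J x) v.
have EG : E *m gh x *m E^T = flat_gram n e := frame_gram gs JJ gH nf.
have EU : E \in unitmx.
  have := flat_gram_involutive n e01 eN; rewrite -{1}EG -!mulmxA.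
  by move=> /mulmx1_unit[].
have EJ : E *m J x = @standard_J R n 0 *m E := frame_J v 0 JJ.
have VE : invmx E *m E = 1%:M by rewrite mulVmx.
have EV : E *m invmx E = 1%:M by rewrite mulmxV.
exists e, (invmx E); split=> //.
- rewrite unitmx_inv; split=> //; rewrite -EG !mulmxA VE mul1mx -mulmxA -trmx_mul VE.
  by rewrite trmx1 mulmx1.
- have := congr1 (fun M => invmx E *m M *m invmx E) EJ.
  by rewrite !mulmxA VE mul1mx -!mulmxA EV mulmx1.
move=> f0 ->.
have rowE3 (k : 'I_2) : row (inord k.+2) E = if k == 0 then xi x else xi x *m J x.
  by move: k; apply: ord2P; rewrite rowK inordK //= v1.
have gramE (k : 'I_2) : flat_gram n e *m delta_mx (inord k.+2) 0 = wsel R n *m delta_mx k 0 :> 'cV[R]_m.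
  rewrite -!colE; apply/colP => i; rewrite !mxE inordK; last by have := ltn_ord k; lia.
  case: e01 => e0 e1; move: (nat_of_ord i) (nat_of_ord k) (ltn_ord k) => [|[|[|[|a]]]] [|[|b]]//= _;
  by rewrite ?e0 ?e1 ?mulr1 ?mul0r.
have Et (k : 'I_2) : E *m gh x *m (row (inord k.+2) E)^T = wsel R n *m delta_mx k 0.
  by rewrite rowE trmx_mul trmx_delta mulmxA EG gramE.
have Et1 : E *m t1 x = wsel R n *m delta_mx 0 0.
  by rewrite -Et rowE3 /= -mulmxA flat_metric_xi.
have Et2 : E *m t2 x = wsel R n *m delta_mx 1 0.
  by rewrite -Et rowE3 /= -mulmxA flat_metric_xiJ.
have : E *m (t1 x *m - delta_mx 0 0 + t2 x *m - delta_mx 0 0 *m rot2 R + invmx E *m wsel R n) = 0.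
  rewrite !mulmxDr (mulmxA E (invmx E)) EV mul1mx -(mulmxA (t2 x)).
  rewrite (mulmxA E (t1 x)) (mulmxA E (t2 x)) Et1 Et2 -!mulmxA -mulmxDr.
  rewrite -[X in _ + X]mulmx1 -mulmxDr; set M := (X in wsel R n *m X).
  have -> : M = 0; last by rewrite mulmx0.
  by rewrite /M; apply: mx2P; apply: ord2P; rewrite !(mxE, big_ord1, sum2) /=; split; ring.
move=> /(congr1 (mulmx (invmx E))); rewrite mulmxA VE mul1mx mulmx0; exact.
Qed.

End NormalFrame.

(** For complex numbers: [|phi w|^2 = |phi|^2 |w|^2]. *)
Lemma coframe_square (R : realType) m (T1 T2 : 'cV[R]_m) (w : 'rV[R]_2) :
  (T1 *m w + T2 *m w *m rot2 R) *m (T1 *m w + T2 *m w *m rot2 R)^T =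
  (w *m w^T) 0 0 *: (T1 *m T1^T + T2 *m T2^T).
Proof.
have H (T T' : 'cV[R]_m) (p p' : 'rV[R]_2) :
    T *m p *m (T' *m p')^T = (p *m p'^T) 0 0 *: (T *m T'^T).
  by rewrite trmx_mul -mulmxA (mulmxA p) mul_mx11 scalemxAr.
have s0 : w *m rot2 R *m w^T = 0 := rot2_skew w.
have s1 : w *m (w *m rot2 R)^T = 0.
  by have := congr1 trmx s0; rewrite trmx_mul trmxK trmx0.
have s2 : w *m rot2 R *m (w *m rot2 R)^T = w *m w^T.
  by rewrite trmx_mul -mulmxA (mulmxA (rot2 R)) rot2_orthogonal mul1mx.
have z : (0 : 'M[R]_1) 0 0 = 0 by rewrite mxE.
rewrite -(mulmxA T2) raddfD /= mulmxDr !mulmxDl !H s0 s1 s2 z !scale0r.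
by rewrite addr0 add0r scalerDr.
Qed.

Section LocalModel.
Variables (R : realType) (n : nat).
Local Notation m := n.*2.+4.
Variables (D : set 'rV[R]_m) (g J : mfield R m) (S : cfield R m)
  (xi zeta : vfield R m).
Hypotheses (oD : open D) (kahler : pseudo_kahler_on D g J).
Hypothesis homog : homogeneous_structure_on D g J S.
Hypothesis linear_type : linear_type_on D g J S xi zeta.
Hypothesis xi_smooth : smooth_on D xi.
Hypothesis xi_null : forall x, D x -> xi x != 0 /\ bil (g x) (xi x) (xi x) = 0.
Hypothesis zeta0 : forall x, D x -> zeta x = 0.

(** [phi = - dw / w] turns [g = flat_metric + c |phi|^2] into
    [flat_metric + (c / |w|^2) |dw|^2]. *)
Lemma local_model x0 : D x0 -> exists (r : R) e c F U,
  [/\ 0 < r /\ (forall x, `|x - x0| < r -> D x),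
    (e 0%N = 1 /\ e 1%N = 1) /\ (forall p, e p = 1 \/ e p = -1),
    F x0 *m wsel R n = - delta_mx 0 0,
    smooth_on [set x | `|x - x0| < r] F /\ smooth_on [set x | `|x - x0| < r] U &
    forall x, `|x - x0| < r ->
      [/\ U x \in unitmx, forall v, is_derive x v F (v *m U x),
        J x *m U x = U x *m @standard_J R n 0 &
        sqnorm (cw1 n) (cw2 n) (F x) != 0 ->
        g x = U x *m radial_metric e c (F x) *m (U x)^T]].
Proof.
move=> Dx0.
have [r1 [k [r10 r1D curv]]] :=
  curvature_constant oD kahler homog linear_type xi_smooth xi_null zeta0 Dx0.
pose B := [set x | `|x - x0| < r1]; pose c := k / 2.
have oB : open B := open_dist x0 r1.
have BD : B `<=` D by move=> x; exact: r1D.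
have Bx0 : B x0 by rewrite /B /= subrr normr0.
have kB : pseudo_kahler_on B g J.
  by case: kahler => h1 h2 h3 h4 h5; split=> [l|l|x /BD|x /BD|x /BD]; auto;
  [exact: Ck_sub BD (h1 l)|exact: Ck_sub BD (h2 l)].
have hB : homogeneous_structure_on B g J S.
  by case: homog => h1 h2 h3 h4 h5; split=> [i l|x /BD|x /BD|x /BD|x /BD]; auto;
  exact: Ck_sub BD (h1 i l).
have lB : linear_type_on B g J S xi zeta by move=> x /BD; exact: linear_type.
have xB : smooth_on B xi by move=> l; exact: Ck_sub BD (xi_smooth l).
have nB x : B x -> xi x != 0 /\ bil (g x) (xi x) (xi x) = 0 by move=> /BD; exact: xi_null.
have zB x : B x -> zeta x = 0 by move=> /BD; exact: zeta0.
have cB x : B x -> forall X Y,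
    riemann g x X Y = (2 * c * area g J xi x X Y) *: turn g J xi x.
  by move=> Bx X Y; rewrite curv//; congr (_ * _ *: _); rewrite /c; field.
have [e [U0 [e01 eN [U0u gU0] JU0 psi0]]] := normal_frame c kB nB Bx0.
(* The point w = -1, where phi = dw. *)
pose f0 : 'rV[R]_m := - delta_mx 0 (cw1 n).
have f0E : f0 *m wsel R n = - delta_mx 0 0.
  rewrite mulNmx; congr (- _); rewrite -rowE; apply/rowP => l.
  by rewrite !mxE /cw1 inordK// eq_sym.
have [r [F [U [r0 rB F0 FUS FU]]]] := flat_coordinates oB kB hB lB xB nB zB cB
  Bx0 U0u JU0 gU0 (rot2_sq R) (psi0 f0 f0E).
exists r, e, c, F, U; split=> //.
- by split=> // x /rB/BD.
- by rewrite F0.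
move=> x xr; have [Uu Fd JU gU psi] := FU x xr; split=> // q0.
set w := F x *m wsel R n in psi.
have Uw : U x *m wsel R n = - (theta1 g xi x *m w + theta2 g J xi x *m w *m rot2 R).
  by move/eqP: psi; rewrite addrC addr_eq0 => /eqP.
have sq : U x *m (wsel R n *m (wsel R n)^T) *m (U x)^T = sqnorm (cw1 n) (cw2 n) (F x) *:
    (theta1 g xi x *m (theta1 g xi x)^T + theta2 g J xi x *m (theta2 g J xi x)^T).
  rewrite mulmxA -mulmxA -trmx_mul Uw raddfN /= mulNmx mulmxN opprK coframe_square.
  congr (_ *: _); rewrite /w wpart_wsel -wpart_sqnorm /sqnorm mxE sum2 !mxE.
  by rewrite !expr2.
rewrite /radial_metric mulmxDr mulmxDl -gU -scalemxAr -scalemxAl sq scalerA.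
by rewrite divfK// /flat_metric subrK.
Qed.

End LocalModel.

(** * Charts *)

Section Charts.
Variables (R : realType) (M : topologicalType) (m : nat).
Implicit Types c d : chart R M m.

Lemma tdom_open c d : open (tdom c d).
Proof.
rewrite openE => x [cx dx]; apply: filterI.
  exact: (open_nbhs_nbhs (conj (@cimg_open _ _ _ c) cx)).
have := cinv_continuous cx; apply.
exact: (open_nbhs_nbhs (conj (@cdom_open _ _ _ d) dx)).
Qed.

Lemma jacobianE (f : 'rV[R]_m -> 'rV[R]_m) x v :
  differentiable f x -> v *m jacobian f x = 'D_v f x.
Proof. by move=> df; rewrite deriveE// /jacobian mul_rV_lin1. Qed.

Lemma jacobian_comp (f h : 'rV[R]_m -> 'rV[R]_m) x :
  differentiable f x -> differentiable h (f x) ->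
  jacobian (h \o f) x = jacobian f x *m jacobian h (f x).
Proof.
move=> df dh; apply/row_matrixP => i; rewrite !rowE; move: (delta_mx 0 i) => v.
have chain : 'D_v (h \o f) x = 'D_('D_v f x) h (f x).
  apply: etrans (deriveE v (differentiable_comp df dh)) _.
  apply: etrans (congr1 (fun k => k v) (diff_comp df dh)) _.
  apply: etrans _ (esym (deriveE _ dh)).
  exact: (congr1 (fun w => 'd h (f x) w) (esym (deriveE v df))).
apply: etrans (jacobianE v (differentiable_comp df dh)) _.
apply: etrans chain _; apply: etrans (esym (jacobianE _ dh)) _.
apply: etrans (congr1 (mulmx^~ (jacobian h (f x))) (esym (jacobianE v df))) _.
exact: (esym (mulmxA _ _ _)).
Qed.

Lemma chart_comp c (x0 f0 : 'rV[R]_m) (r s : R) (F G : 'rV[R]_m -> 'rV[R]_m) :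
  (forall x, `|x - x0| < r -> cimg c x) ->
  (forall x, `|x - x0| < r -> {for x, continuous F}) ->
  (forall x y, `|x - x0| < r -> `|y - x0| < r -> F x = F y -> x = y) ->
  (forall y, `|y - f0| < s -> `|G y - x0| < r /\ F (G y) = y) ->
  (forall y, `|y - f0| < s -> {for y, continuous G}) ->
  exists d : chart R M m, [/\
    cdom d = [set q | cdom c q /\ (`|cmap c q - x0| < r /\ `|F (cmap c q) - f0| < s)],
    cimg d = [set y | `|y - f0| < s], cmap d = F \o cmap c & cinv d = cinv c \o G].
Proof.
move=> rD Fc Finj FG Gc.
pose A := [set q | cdom c q /\ (`|cmap c q - x0| < r /\ `|F (cmap c q) - f0| < s)].
pose B := [set y | `|y - f0| < s].
have oA : open A.
  rewrite openE => q [cq [qr qs]]; apply: filterI.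
    exact: (open_nbhs_nbhs (conj (@cdom_open _ _ _ c) cq)).
  have Fr : nbhs (cmap c q) [set x | `|x - x0| < r /\ `|F x - f0| < s].
    apply: filterI; first exact: (open_nbhs_nbhs (conj (open_dist x0 r) qr)).
    have H : nbhs (F (cmap c q)) [set y | `|y - f0| < s].
      exact: (open_nbhs_nbhs (conj (open_dist f0 s) qs)).
    exact: (Fc _ qr _ H).
  exact: (cmap_continuous cq Fr).
have oB : open B := open_dist f0 s.
have img q : A q -> B ((F \o cmap c) q) by case=> _ [].
have dom y : B y -> A ((cinv c \o G) y).
  move=> By; have [Gr FGy] := FG y By; have cG := rD _ Gr.
  by rewrite /A /= cinvK// FGy; split; [exact: cinv_dom|].
have mapK q : A q -> (cinv c \o G) ((F \o cmap c) q) = q.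
  move=> [cq [qr qs]] /=; have [Gr FGq] := FG _ qs.
  by rewrite (Finj _ _ Gr qr FGq) cmapK.
have invK y : B y -> (F \o cmap c) ((cinv c \o G) y) = y.
  by move=> /FG[Gr FGy] /=; rewrite cinvK//; exact: rD.
have mapc q : A q -> {for q, continuous (F \o cmap c)}.
  by move=> [cq [qr _]]; apply: continuous_comp; [exact: cmap_continuous|exact: Fc].
have invc y : B y -> {for y, continuous (cinv c \o G)}.
  move=> By; apply: continuous_comp; first exact: Gc.
  by apply: cinv_continuous; apply: rD; have [] := FG y By.
by exists (Chart oA oB img dom mapK invK mapc invc).
Qed.

End Charts.

(** The transition from any chart of the atlas to [psi] is the transition to
    the chart [c] followed by [F], with differential [U]. *)
Lemma comp_holomorphic_isometry (R : realType) (m : nat) (M : manifold R m)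
    (g J : chart_index M -> mfield R m) (psi : chart R M m) (l : chart_index M)
    (x0 f0 : 'rV[R]_m) (r s : R) (F G : 'rV[R]_m -> 'rV[R]_m)
    (U g' : 'rV[R]_m -> 'M[R]_m) (J' : 'M[R]_m) :
  let c := atlas l in
  pseudo_kahler g J ->
  (forall x, `|x - x0| < r -> cimg c x) ->
  smooth_on [set x | `|x - x0| < r] F -> smooth_on [set y | `|y - f0| < s] G ->
  (forall y, `|y - f0| < s -> `|G y - x0| < r /\ F (G y) = y) ->
  (forall x v, `|x - x0| < r -> is_derive x v F (v *m U x)) ->
  (forall x, `|x - x0| < r -> `|F x - f0| < s -> g l x = U x *m g' (F x) *m (U x)^T) ->
  (forall x, `|x - x0| < r -> J l x *m U x = U x *m J') ->
  cdom psi = [set q | cdom c q /\ (`|cmap c q - x0| < r /\ `|F (cmap c q) - f0| < s)] ->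
  cimg psi = [set y | `|y - f0| < s] -> cmap psi = F \o cmap c -> cinv psi = cinv c \o G ->
  holomorphic_isometry g J psi g' (fun=> J').
Proof.
move=> c [gJ gJc] rD FS GS FG Fd gU JU domE imgE mapE invE i /=.
have oP := @tdom_open R M m (atlas i) psi.
have dom x : tdom (atlas i) psi x -> tdom (atlas i) c x /\
    (`|transition (atlas i) c x - x0| < r /\ `|F (transition (atlas i) c x) - f0| < s).
  by case=> cx; rewrite domE => -[dx H].
have tauE : transition (atlas i) psi = F \o transition (atlas i) c.
  by rewrite funeqE => x; rewrite /transition mapE.
have [tS tS'] := atlas_compatible i l.
have jacE x : tdom (atlas i) psi x -> jacobian (transition (atlas i) psi) x =
    jacobian (transition (atlas i) c) x *m U (transition (atlas i) c x).
  move=> /dom[tx [xr _]].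
  have td := smooth_differentiable tS tx.
  have Fdiff := smooth_differentiable FS xr.
  rewrite tauE; apply: etrans (jacobian_comp td Fdiff) _; congr (_ *m _).
  apply/row_matrixP => a; rewrite !rowE; apply: etrans (jacobianE _ Fdiff) _.
  by have [_ ->] := Fd _ (delta_mx 0 a) xr.
have [rm re] := gJc i l.
split.
- split.
    rewrite tauE => k; apply: (Ck_comp oP (D' := [set x | `|x - x0| < r])).
    + by move=> x /dom[_ []].
    + by apply: Ck_sub (tS k) => x /dom[].
    + exact: FS.
  have sub y : tdom psi (atlas i) y -> `|y - f0| < s /\ tdom c (atlas i) (G y).
    rewrite /tdom /= imgE invE => -[/= ys dy]; split=> //; split=> //.
    by apply: rD; have [] := FG y ys.
  rewrite (_ : transition psi (atlas i) = transition c (atlas i) \o G); last first.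
    by rewrite funeqE => y; rewrite /transition invE.
  move=> k; apply: (Ck_comp (@tdom_open R M m psi (atlas i)) (D' := tdom c (atlas i))).
  + by move=> y /sub[].
  + by apply: Ck_sub (GS k) => y /sub[].
  + exact: tS'.
- move=> x Px X Y; have [tx [xr xs]] := dom x Px.
  rewrite jacE// !mulmxA tauE /= -(rm x tx) gU// /bil !trmx_mul !mulmxA.
  by [].
- move=> x Px; have [tx [xr xs]] := dom x Px.
  by rewrite jacE// mulmxA (re x tx) -!mulmxA JU.
Qed.

(** * The local isometry with the model *)

(** A linear isometry [u] carries the pointwise properties of the metric and
    of the complex structure to the model. *)
Section Congruence.
Variables (R : fieldType) (m : nat) (u j j' G G' : 'M[R]_m).
Hypotheses (uu : u \in unitmx) (ju : j *m u = u *m j') (GE : G = u *m G' *m u^T).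

Lemma congruent_cancel (A B : 'M[R]_m) : u *m A *m u^T = u *m B *m u^T -> A = B.
Proof.
have tu : u^T \in unitmx by rewrite unitmx_tr.
by move=> /(can_inj (mulmxK tu)) /(can_inj (mulKmx uu)).
Qed.

Lemma congruent_complex : j *m j = - 1%:M -> j' *m j' = - 1%:M.
Proof.
move=> jj; apply: (can_inj (mulKmx uu)).
by rewrite mulmxA -ju -mulmxA -ju mulmxA jj mulNmx mulmxN mul1mx mulmx1.
Qed.

Lemma congruent_hermitian : j *m G *m j^T = G -> j' *m G' *m j'^T = G'.
Proof.
move=> jG; apply: congruent_cancel; rewrite -GE -[RHS]jG GE.
by rewrite !mulmxA ju -!mulmxA -!trmx_mul ju.
Qed.

Lemma congruent_sym : G^T = G -> G'^T = G'.
Proof.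
by move=> Gs; apply: congruent_cancel; rewrite -GE -[RHS]Gs GE !trmx_mul trmxK mulmxA.
Qed.

End Congruence.

Unset Implicit Arguments.

Theorem theorem3p2 (R : realType) (n : nat) (M : manifold R n.*2.+4)
    (g J : chart_index M -> mfield R n.*2.+4) (S : chart_index M -> cfield R n.*2.+4)
    (hgJ : pseudo_kahler g J)
    (hS : homogeneous_pseudo_kahler_structure g J S)
    (hdeg : strongly_degenerate g J S) :
  forall p : M,
  exists (psi : chart R M n.*2.+4) (eps : 'I_n -> R) (b : 'rV[R]_2 -> R)
         (r s : 'I_n -> 'rV[R]_2 -> R) (b0 : R),
    let V := cimg psi in
    let W := [set wpart x | x in V] in
    let g0 := model_metric eps b r s in
    [/\ cdom psi p,
        holomorphic_isometry g J psi g0 (@standard_J R n),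
        pseudo_kahler_on V g0 (@standard_J R n),
        ~ W 0
      & [/\ forall a, eps a = 1 \/ eps a = -1,
            smooth_on W b /\
            (forall a, smooth_on W (r a) /\ smooth_on W (s a)),
            forall a w, W w -> pd 0 (s a) w = pd 1 (r a) w,
            forall a w, W w -> pd 1 (s a) w = - pd 0 (r a) w
          & forall w, W w ->
              laplacian b w = b0 / ((w 0 0) ^+ 2 + (w 0 1) ^+ 2) ^+ 2]].
Proof.
move=> p; have [l cp] := atlas_cover p; pose c := atlas l.
have [xi [zeta [[xiS _] _ lin null zeta0]]] := hdeg.
have kahler := hgJ.1 l; have homog := hS.1 l.
pose x0 := cmap c p; have Dx0 : cimg c x0 := cmap_img cp.
have [r [e [k [F [U [[r0 rD] [e01 eN] F0 [FS US] FU]]]]]] :=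
  local_model (@cimg_open _ _ _ c) kahler homog (lin l) (xiS l) (null l) (zeta0 l) Dx0.
have Bx0 : [set x | `|x - x0| < r] x0 by rewrite /= subrr normr0.
have Fd x v : `|x - x0| < r -> is_derive x v F (v *m U x) by move=> /FU[].
have [r' [s1 [G [[r'0 s10] r'r Finj FG GS]]]] :
    exists (r' s : R) G, [/\ 0 < r' /\ 0 < s,
      forall x, `|x - x0| < r' -> `|x - x0| < r,
      (forall x y, `|x - x0| < r' -> `|y - x0| < r' -> F x = F y -> x = y),
      (forall y, `|y - F x0| < s -> `|G y - x0| < r' /\ F (G y) = y) &
      smooth_on [set y | `|y - F x0| < s] G].
  apply: (inverse_function (D := [set x | `|x - x0| < r]) (U := U)) => //.
  - exact: open_dist.
  - by move=> x; exact: smooth_differentiable.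
  - by move=> x v xr; have [_] := Fd x v xr.
  - by move=> x /FU[].
(* On a ball of radius 1 / 2 around a point with w^1 = -1, w does not vanish. *)
pose s := Num.min s1 2^-1.
have s0 : 0 < s by rewrite lt_min s10 invr_gt0 ltr0n.
have ss1 y : `|y - F x0| < s -> `|y - F x0| < s1 by rewrite lt_min => /andP[].
have r'D x : `|x - x0| < r' -> cimg c x by move=> /r'r/rD.
have [psi [domE imgE mapE invE]] := chart_comp (f0 := F x0) (s := s) r'D
  (fun x xr => FS 0%N x (r'r x xr)) Finj (fun y ys => FG y (ss1 y ys))
  (fun y ys => GS 0%N y (ss1 y ys)).
have q0 y : `|y - F x0| < s -> sqnorm (cw1 n) (cw2 n) y != 0.
  rewrite lt_min => /andP[_ ys].
  have F01 : F x0 0 (cw1 n) = - 1.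
    have := congr1 (fun w : 'rV[R]_2 => w 0 0) F0; rewrite wpart_wsel !mxE !eqxx /= => ->.
    by [].
  have : `|y 0 (cw1 n) + 1| < 2^-1.
    by apply: le_lt_trans ys; have := entry_norm_le (y - F x0) 0 (cw1 n); rewrite !mxE F01 opprK.
  rewrite ltr_norml => /andP[_ H]; rewrite /sqnorm gt_eqF// ltr_pwDl ?sqr_ge0//.
  rewrite exprn_even_gt0//= lt_eqF//; move: H; move: (y 0 _) => t; lra.
pose b (w : 'rV[R]_2) := k / sqnorm 0 1 w.
pose eps (a : 'I_n) := e a.+2.
have g0E : model_metric eps b (fun _ _ => 0) (fun _ _ => 0) = radial_metric e k.
  by rewrite funeqE => x; rewrite model_metricE// /radial_metric wsel_gram /b wpart_sqnorm.
have pull x : `|x - x0| < r' -> `|F x - F x0| < s ->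
    g l x = U x *m radial_metric e k (F x) *m (U x)^T.
  by move=> /r'r xr xs; have [_ _ _] := FU x xr; apply; exact: q0.
have Wq w : [set wpart x | x in cimg psi] w -> sqnorm 0 1 w != 0.
  by move=> [y]; rewrite imgE => ys <-; rewrite wpart_sqnorm; exact: q0.
exists psi, eps, b, (fun _ _ => 0), (fun _ _ => 0), (4 * k); split.
- by rewrite domE /= -/x0 !subrr !normr0.
- rewrite g0E; apply: (comp_holomorphic_isometry (l := l) (x0 := x0) (f0 := F x0)
    (r := r') (s := s) (F := F) (G := G) (U := U)) => //.
  + by move=> j; apply: Ck_sub (FS j) => x /r'r.
  + by move=> j; apply: Ck_sub (GS j) => y /ss1.
  + by move=> y /ss1/FG.
  + by move=> x v /r'r; exact: Fd.
  + by move=> x /r'r/FU[].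
- rewrite g0E imgE.
  have model y : `|y - F x0| < s -> exists2 x, cimg c x &
      [/\ U x \in unitmx, g l x = U x *m radial_metric e k y *m (U x)^T &
      J l x *m U x = U x *m @standard_J R n 0].
    move=> ys; have [xr FGy] := FG y (ss1 y ys); exists (G y); first exact: r'D.
    have [Uu _ JU _] := FU _ (r'r _ xr); split=> //.
    by rewrite pull// FGy.
  have [_ _ symu herm _] := kahler.
  have J0E y : `|y - F x0| < s ->
      @standard_J R n 0 *m @standard_J R n 0 = - 1%:M /\
      @standard_J R n 0 *m radial_metric e k y *m (@standard_J R n 0)^T = radial_metric e k y.
    move=> ys; have [x Dx [Uu gx JU]] := model y ys.
    have [JJ _] := herm x Dx; split; first exact: congruent_complex Uu JU JJ.
    exact: congruent_hermitian Uu JU gx (hermitian kahler Dx).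
  have unit y : `|y - F x0| < s -> radial_metric e k y \in unitmx.
    move=> ys; have [x Dx [Uu gx JU]] := model y ys; have [_ gu] := symu x Dx.
    by move: gu; rewrite gx !unitmx_mul => /andP[/andP[]].
  split.
  + by move=> j; apply: Ck_sub (radial_metric_smooth n e k j) => y ys; exact: q0.
  + by move=> j; exact: Ck_cst.
  + move=> y ys; split; last exact: unit.
    have [x Dx [Uu gx JU]] := model y ys; have [gs _] := symu x Dx.
    exact: congruent_sym Uu gx gs.
  + move=> y ys; have [JJ Jg] := J0E y ys; split=> // X Y.
    by rewrite /bil -[in RHS]Jg trmx_mul !mulmxA.
  + move=> y ys i; have [JJ Jg] := J0E y ys.
    by apply: radial_metric_kahler => //; [exact: q0|exact: unit].
- by move=> /Wq; rewrite /sqnorm !mxE expr0n addr0 eqxx.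
split.
- by move=> a; exact: eN.
- split; first by move=> j; apply: Ck_sub (sqnorm_inv_smooth 0 1 k j) => w /Wq.
  by split=> j; exact: Ck_cst.
- by move=> a w _; rewrite /pd !derive_cst.
- by move=> a w _; rewrite /pd !derive_cst oppr0.
- by move=> w /Wq; exact: laplacian_radial.
Qed.
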